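(* Let $H_1,H_2$ be separable Hilbert spaces and let $\mathcal L_i\subset B(H_i)$, $i=1,2$, be reflexive lattices. If there exists a $*$-isomorphism $\theta:\mathcal L_1''\to\mathcal L_2''$ such that $\theta(\mathcal L_1)=\mathcal L_2$, then the algebras $\mathrm{Alg}(\mathcal L_1)$ and $\mathrm{Alg}(\mathcal L_2)$ are weak TRO equivalent, and therefore $k_c(\mathrm{Alg}(\mathcal L_1))=k_c(\mathrm{Alg}(\mathcal L_2))$.
   Context: Lattices: a lattice $\mathcal L\subset B(H)$ is a set of (orthogonal) projections containing $0$ and the identity and closed under arbitrary suprema and infima. $\mathrm{Alg}(\mathcal L)=\{A\in B(H):L^\perp AL=0\ \forall L\in\mathcal L\}$; for an algebra $\mathcal A\subset B(H)$, $\mathrm{Lat}(\mathcal A)$ is the set of projections $L\in B(H)$ with $L^\perp\mathcal AL=0$. $\mathcal L$ is reflexive if $\mathrm{Lat}(\mathrm{Alg}(\mathcal L))=\mathcal L$. $\mathcal L'$ is the commutant, $\mathcal L''$ the double commutant. Weak TRO equivalence: a TRO is a subspace $\mathcal M\subset B(H,K)$ with $\mathcal M\mathcal M^*\mathcal M\subset\mathcal M$. Weak* closed spaces $\mathcal U\subset B(K_1,K_2)$ and $\mathcal V\subset B(H_1,H_2)$ are weak TRO equivalent if there exist TROs $\mathcal M_i\subset B(H_i,K_i)$, $i=1,2$, such that $\mathcal U=[\mathcal M_2\mathcal V\mathcal M_1^*]^{-w^*}$ and $\mathcal V=[\mathcal M_2^*\mathcal U\mathcal M_1]^{-w^*}$,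 where $[\,\cdot\,]^{-w^*}$ is the weak* closed linear span. Matrices: for a weak* closed space $\mathcal X\subset B(H,K)$, $M_\infty^w(\mathcal X)$ is the space of $\aleph_0\times\aleph_0$ matrices with entries in $\mathcal X$ whose finite submatrices have uniformly bounded norm, regarded as a subspace of $B(H^\infty,K^\infty)$, where $H^\infty$, $K^\infty$ are the Hilbert space direct sums of $\aleph_0$ copies. Hyperreflexivity constant: for a subspace $\mathcal X\subset B(H,K)$ and $T\in B(H,K)$ put $d(T,\mathcal X)=\inf_{X\in\mathcal X}\|T-X\|$ and $r_{\mathcal X}(T)=\sup\{|\langle T\xi,\eta\rangle|:\|\xi\|=\|\eta\|=1,\ \langle X\xi,\eta\rangle=0\ \forall X\in\mathcal X\}$. $\mathcal X$ is hyperreflexive if there is $k>0$ with $d(T,\mathcal X)\le k\,r_{\mathcal X}(T)$ for all $T$; $k(\mathcal X)=\sup_{T\notin\mathcal X} d(T,\mathcal X)/r_{\mathcal X}(T)$, with $k(\mathcal X)=\infty$ if $\mathcal X$ is not hyperreflexive and $k(\mathcal X)=1$ if $\mathcal X=B(H,K)$. The complete hyperreflexivity constant is $k_c(\mathcal X)=k(M_\infty^w(\mathcal X))\in[1,\infty]$. *)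

(* Defs.v *)
From HB Require Import structures.
From mathcomp Require Import all_boot all_order all_algebra.
From mathcomp Require Import sesquilinear finmap complex ring lra.
From mathcomp Require Import mathcomp_extra boolp classical_sets functions
  cardinality reals ereal topology normedtype sequences.
Set Implicit Arguments.
Unset Strict Implicit.
Unset Printing Implicit Defensive.
Import Order.TTheory GRing.Theory Num.Theory.
Import numFieldNormedType.Exports.
Import Normc.
Local Open Scope classical_set_scope.
Local Open Scope complex_scope.
Local Open Scope ring_scope.

(* The inner product is linear in the first variable and conjugate linear in
   the second one; on R[i], Num.conj is convertible to conjc. *)
HB.mixin Record isHilbert (R : realType) H & CompleteNormedModule R[i] H := {
  inner : {dot H for (@Num.conj R[i])};
  norm_inner : forall x : H, `|x| ^+ 2 = inner x x }.

#[short(type="hilbertType")]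
HB.structure Definition Hilbert (R : realType) :=
  {H of isHilbert R H & CompleteNormedModule R[i] H}.

Section DotForm.
Context (C : numClosedFieldType) (U : lmodType C) (form : {dot U for (@Num.conj C)}).
Local Notation "''[' u , v ]" := (form u v) : ring_scope.
Local Notation "''[' u ]" := '[u, u] : ring_scope.

Lemma dot_CS u v : `|'[u, v]| ^+ 2 <= '[u] * '[v].
Proof.
have [->|v0] := eqVneq v 0; first by rewrite !linear0r normr0 expr0n mulr0.
have v_gt0 : 0 < '[v] by rewrite neq0_dnorm_gt0.
pose a := '[u, v] / '[v].
have vu : '[v, u] = '[u, v]^* by rewrite hermC expr0 mul1r.
have : 0 <= '[u - a *: v] by exact: dnorm_ge0.
rewrite linearBl /= !linearBr /= !linearZl_LR /= !linearZr_LR /=.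
have av : a * '[v] = '[u, v] by rewrite /a divfK// gt_eqF.
rewrite vu (mulrCA a) av opprB addrA subrK => h.
have -> : `|'[u, v]| ^+ 2 = a * '[u, v]^* * '[v] by rewrite normCK mulrAC av.
by rewrite -subr_ge0 -mulrBl mulr_ge0// ltW.
Qed.

Lemma dot_triangle u v : sqrtC '[u + v] <= sqrtC '[u] + sqrtC '[v].
Proof.
rewrite -(@ler_sqr C) ?nnegrE ?addr_ge0 ?sqrtC_ge0 ?dnorm_ge0//.
rewrite sqrrD !sqrtCK dnormD [leRHS]addrAC lerD2l.
have uv : `|'[u, v]| <= sqrtC '[u] * sqrtC '[v].
  rewrite -(@ler_sqr C) ?nnegrE ?mulr_ge0 ?sqrtC_ge0 ?dnorm_ge0//.
  by rewrite exprMn !sqrtCK dot_CS.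
apply: (@le_trans _ _ (`|'[u, v]| *+ 2)); last by rewrite lerMn2r uv orbT.
rewrite (le_trans (real_ler_norm _))//.
  by rewrite CrealE rmorphD /= conjCK addrC.
by rewrite (le_trans (ler_normD _ _))// norm_conjC mulr2n.
Qed.
End DotForm.

Lemma ltr0c (R : realType) (k : R) : (0 < k%:C) = (0 < k).
Proof. exact: (ltcR 0 k). Qed.

Lemma normc_ge0 (R : realType) (z : R[i]) : 0 <= normc z.
Proof. by case: z => a b; exact: sqrtr_ge0. Qed.

Section Norm.
Context (R : realType) (H : hilbertType R).
Implicit Types x y : H.

Definition hnorm x : R := complex.Re `|x|.

Lemma hnormE x : `|x| = (hnorm x)%:C.
Proof. by rewrite /hnorm RRe_real// ger0_real. Qed.

Lemma hnorm_ge0 x : 0 <= hnorm x.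
Proof. by rewrite -ler0c -hnormE. Qed.

Lemma sqr_hnorm x : (hnorm x ^+ 2)%:C = inner x x.
Proof. by rewrite rmorphXn/= -hnormE norm_inner. Qed.

Lemma ler_hnormD x y : hnorm (x + y) <= hnorm x + hnorm y.
Proof. by rewrite -lecR rmorphD/= -!hnormE ler_normD. Qed.

Lemma hnormZ (a : R[i]) x : hnorm (a *: x) = normc a * hnorm x.
Proof. by apply: complexI; rewrite rmorphM/= -!hnormE normrZ. Qed.

Lemma hnormN x : hnorm (- x) = hnorm x.
Proof. by rewrite /hnorm normrN. Qed.

Lemma hnorm0 : hnorm (0 : H) = 0.
Proof. by rewrite /hnorm normr0. Qed.

Lemma inner_CS x y : normc (inner x y) <= hnorm x * hnorm y.
Proof.
rewrite -(@ler_sqr R) ?nnegrE ?mulr_ge0 ?hnorm_ge0 ?normc_ge0//.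
have -> : ((hnorm x * hnorm y) ^+ 2) = complex.Re (inner x x * inner y y).
  by rewrite -!sqr_hnorm -rmorphM/= exprMn.
rewrite -lecR rmorphXn/= RRe_real; first exact: (dot_CS (@inner R H)).
by rewrite -!sqr_hnorm -rmorphM/= complex_real.
Qed.

End Norm.

Section Bounded.
Context (R : realType) (H K : hilbertType R).

Definition bounded_op (f : H -> K) :=
  (forall (a : R[i]) x y, f (a *: x + y) = a *: f x + f y) /\
  exists M : R, forall x, hnorm (f x) <= M * hnorm x.

Definition bounded_op_pred : {pred H -> K} := fun f => `[< bounded_op f >].

Lemma bounded_op_submod : submod_closed bounded_op_pred.
Proof.
split; first apply/asboolP.
  split=> [a x y|]; first by rewrite /= scaler0 addr0.
  by exists 0 => x; rewrite /= hnorm0 mul0r.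
move=> c f g /asboolP[fl [M fM]] /asboolP[gl [N gN]]; apply/asboolP; split.
  move=> a x y; rewrite !fctE.
  by rewrite fl gl !scalerDr !scalerA [c * a]mulrC addrACA.
exists (normc c * M + N) => x; rewrite !fctE.
rewrite (le_trans (ler_hnormD _ _))// mulrDl lerD// hnormZ -mulrA.
by rewrite ler_wpM2l// normc_ge0.
Qed.

HB.instance Definition _ := GRing.isSubmodClosed.Build R[i] (H -> K)
  bounded_op_pred bounded_op_submod.

Record bop := BOp { bop_fun :> H -> K; _ : bop_fun \in bounded_op_pred }.

HB.instance Definition _ := [isSub for bop_fun].
HB.instance Definition _ := [Choice of bop by <:].
HB.instance Definition _ := [SubChoice_isSubLmodule of bop by <:].

Lemma bopP (T : bop) : bounded_op T.
Proof. by case: T => f /= /asboolP. Qed.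

Lemma bop_linear (T : bop) : linear T.
Proof. exact: (bopP T).1. Qed.

HB.instance Definition _ (T : bop) :=
  GRing.isLinear.Build R[i] H K *:%R T (bop_linear T).

End Bounded.

Section ComplexSeries.
Context (R : realType).
Implicit Types u v : nat -> R[i].

Definition csummable u :=
  cvgn (series (fun n => complex.Re (u n))) /\
  cvgn (series (fun n => complex.Im (u n))).

Definition csum u : R[i] :=
  limn (series (fun n => complex.Re (u n))) +i*
  limn (series (fun n => complex.Im (u n))).

Lemma csummable_le u (w : nat -> R) : (forall n, normc (u n) <= w n) ->
  cvgn (series w) -> csummable u.
Proof.
move=> uw cw.
have le0w n : 0 <= w n by rewrite (le_trans _ (uw n))// normc_ge0.
have sub (f : R[i] -> R) : (forall z, `|f z| <= normc z) ->
    cvgn (series (fun n => f (u n))).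
  move=> fz; apply: normed_cvg; apply: (@series_le_cvg _ _ w) => //= n.
  exact: le_trans (fz _) (uw n).
split; apply: sub => -[a b] /=; rewrite -sqrtr_sqr ler_wsqrtr//.
- by rewrite lerDl sqr_ge0.
- by rewrite lerDr sqr_ge0.
Qed.

Lemma csum_linear a u v : csummable u -> csummable v ->
  csum (fun n => a * u n + v n) = a * csum u + csum v.
Proof.
move=> [ur ui] [vr vi]; case: a => a b; rewrite /csum.
have hZ c (f : R ^nat) : cvgn (series f) ->
    series (fun n => c * f n) @ \oo --> c * limn (series f).
  move=> cf; have -> : (fun n => c * f n) = c *: f by [].
  by rewrite seriesZ; apply: cvgMl_tmp.
have hD (f g : R ^nat) x y : series f @ \oo --> x -> series g @ \oo --> y ->
    series (fun n => f n + g n) @ \oo --> x + y.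
  by move=> fx gy; rewrite [series _](seriesD f g); apply: cvgD.
have hN (f : R ^nat) x : series f @ \oo --> x ->
    series (fun n => - f n) @ \oo --> - x.
  by move=> fx; rewrite [series _](seriesN f); apply: cvgN.
have idR (f : R ^nat) : cvgn (series f) -> series f @ \oo --> limn (series f).
  by [].
apply/eqP; rewrite eq_complex /=; apply/andP; split; apply/eqP; apply/cvg_lim => //.
- rewrite (_ : (fun n => _) = (fun n => (a * complex.Re (u n) +
      - (b * complex.Im (u n))) + complex.Re (v n))); last first.
    by apply/funext => n; case: (u n) => ? ?; case: (v n).
  by apply: (hD); [apply: (hD); [exact: hZ|apply: (hN); exact: hZ]|exact: idR].
- rewrite (_ : (fun n => _) = (fun n => (a * complex.Im (u n) +
      b * complex.Re (u n)) + complex.Im (v n))); last first.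
    by apply/funext => n; case: (u n) => ? ?; case: (v n).
  by apply: (hD); [apply: (hD); exact: hZ|exact: idR].
Qed.

Lemma csum_conj u : csummable u -> csum (fun n => (u n)^*%C) = (csum u)^*%C.
Proof.
move=> [ur ui]; rewrite /csum /=.
have -> : (fun n => complex.Re (u n)^*%C) = (fun n => complex.Re (u n)).
  by apply/funext => n; rewrite ?fctE; case: (u n).
have -> : (fun n => complex.Im (u n)^*%C) = - (fun n => complex.Im (u n)).
  by apply/funext => n; rewrite ?fctE; case: (u n).
by rewrite lim_seriesN.
Qed.

End ComplexSeries.

(* l2 H is H^infty, the Hilbert space direct sum of aleph_0 copies of H. *)
Section L2.
Context (R : realType) (H : hilbertType R).

Definition square_summable (x : nat -> H) :=
  cvgn (series (fun n => hnorm (x n) ^+ 2)).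

Definition l2_pred : {pred nat -> H} := fun x => `[< square_summable x >].

Lemma sqrD_le (a b : R) : (a + b) ^+ 2 <= 2 * a ^+ 2 + 2 * b ^+ 2.
Proof.
rewrite -subr_ge0.
have -> : 2 * a ^+ 2 + 2 * b ^+ 2 - (a + b) ^+ 2 = (a - b) ^+ 2 by ring.
exact: sqr_ge0.
Qed.

Lemma square_summable_lin (a : R[i]) x y :
  square_summable x -> square_summable y -> square_summable (a *: x + y).
Proof.
move=> sx sy.
apply: (@series_le_cvg _ _ ((2 * normc a ^+ 2) *: (fun n => hnorm (x n) ^+ 2) +
   2 *: (fun n => hnorm (y n) ^+ 2))).
- by move=> n; exact: sqr_ge0.
- by move=> n; apply: addr_ge0; rewrite !mulr_ge0 ?normc_ge0 ?hnorm_ge0.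
- move=> n; rewrite !fctE.
  apply: (@le_trans _ _ ((hnorm (a *: x n) + hnorm (y n)) ^+ 2)).
    by rewrite ler_sqr ?nnegrE ?addr_ge0 ?hnorm_ge0// ler_hnormD.
  by rewrite (le_trans (sqrD_le _ _))// hnormZ exprMn mulrA.
- by apply: is_cvg_seriesD; exact: is_cvg_seriesZ.
Qed.

Lemma l2_submod : submod_closed l2_pred.
Proof.
split; first apply/asboolP.
  rewrite /square_summable (_ : (fun _ => _) = 0); last first.
    by apply/funext => n; rewrite hnorm0 expr0n.
  rewrite (_ : series _ = cst 0); first exact: is_cvg_cst.
  by apply/funext => n; rewrite /series/= big1.

by move=> a x y /asboolP sx /asboolP sy; apply/asboolP/square_summable_lin.
Qed.

HB.instance Definition _ := GRing.isSubmodClosed.Build R[i] (nat -> H)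
  l2_pred l2_submod.

Record l2 := L2Seq { l2_fun :> nat -> H; _ : l2_fun \in l2_pred }.

HB.instance Definition _ := [isSub for l2_fun].
HB.instance Definition _ := [Choice of l2 by <:].
HB.instance Definition _ := [SubChoice_isSubLmodule of l2 by <:].

Lemma l2P (x : l2) : square_summable x.
Proof. by case: x => f /= /asboolP. Qed.

Definition l2_inner (x y : l2) : R[i] := csum (fun n => inner (x n) (y n)).

Lemma l2_csummable (x y : l2) : csummable (fun n => inner (x n) (y n)).
Proof.
apply: (@csummable_le _ _ ((fun n => hnorm (x n) ^+ 2) +
  (fun n => hnorm (y n) ^+ 2))).
  move=> n; rewrite fctE (le_trans (inner_CS _ _))//.
  have a0 := hnorm_ge0 (x n); have b0 := hnorm_ge0 (y n); nra.
by apply: is_cvg_seriesD; exact: l2P.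
Qed.

Lemma l2_inner_linearl y : linear_for *%R (l2_inner ^~ y).
Proof.
move=> a x x'; rewrite /l2_inner -csum_linear; try exact: l2_csummable.
congr csum; apply/funext => n.
by rewrite [l2_fun _ n]/(a *: x n + x' n) linearPl.
Qed.

Lemma l2_inner_herm x y : l2_inner x y = (-1) ^+ false * Num.conj (l2_inner y x).
Proof.
rewrite expr0 mul1r /l2_inner -[RHS]csum_conj; last exact: l2_csummable.
by congr csum; apply/funext => n; rewrite hermC expr0 mul1r.
Qed.

Lemma l2_inner_linearr x : linear_for (Num.conj \; *%R) (l2_inner x).
Proof.
move=> a y y'; rewrite l2_inner_herm expr0 mul1r l2_inner_linearl.
by rewrite rmorphD rmorphM/= 2![l2_inner x _]l2_inner_herm !expr0 !mul1r.
Qed.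

HB.instance Definition _ := bilinear_isBilinear.Build R[i] l2 l2 R[i]
  _ _ l2_inner (l2_inner_linearl, l2_inner_linearr).
HB.instance Definition _ := isHermitianSesquilinear.Build R[i] l2
  false (@Num.conj R[i]) l2_inner l2_inner_herm.

Implicit Types x y : l2.

Lemma l2_innerxx x :
  l2_inner x x = (limn (series (fun n => hnorm (x n) ^+ 2)))%:C.
Proof.
rewrite /l2_inner /csum; congr Complex.
  have -> // : (fun n => complex.Re (inner (x n) (x n))) =
    (fun n => hnorm (x n) ^+ 2) by apply/funext => n; rewrite -sqr_hnorm.
have -> : (fun n => complex.Im (inner (x n) (x n))) = (fun=> 0).
  by apply/funext => n; rewrite -sqr_hnorm.
apply/cvg_lim => //; rewrite (_ : series _ = cst 0); first exact: cvg_cst.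
by apply/funext => n; rewrite /series/= big1.
Qed.

Lemma l2_sum_le (x : l2) n :
  \sum_(0 <= i < n) hnorm (x i) ^+ 2 <=
  limn (series (fun n => hnorm (x n) ^+ 2)).
Proof.
have nd : nondecreasing_seq (series (fun n => hnorm (x n) ^+ 2)).
  by apply: nondecreasing_series => i _ _; exact: sqr_ge0.
exact: (nondecreasing_cvgn_le nd (l2P (x:=x)) n).
Qed.

Lemma l2_coord_le (x : l2) n :
  hnorm (x n) ^+ 2 <= limn (series (fun n => hnorm (x n) ^+ 2)).
Proof.
apply: le_trans (l2_sum_le x n.+1); rewrite big_nat_recr//= lerDr.
by apply: sumr_ge0 => i _; exact: sqr_ge0.
Qed.

Lemma l2_inner_gt0 x : x != 0 -> 0 < l2_inner x x.
Proof.
move=> x0; have [n xn0] : exists n, x n != 0.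
  apply/not_existsP => h; case/eqP: x0; apply/val_inj/funext => n /=.
  by apply/eqP/negPn/negP/h.
rewrite l2_innerxx ltcR (lt_le_trans _ (l2_coord_le x n))// exprn_gt0//.
by rewrite -ltcR -hnormE normr_gt0.
Qed.

HB.instance Definition _ := isDotProduct.Build R[i] l2 l2_inner l2_inner_gt0.

Definition l2_norm (x : l2) : R[i] := sqrtC (l2_inner x x).

Lemma ler_l2_normD x y : l2_norm (x + y) <= l2_norm x + l2_norm y.
Proof. exact: dot_triangle. Qed.

Lemma l2_normZ (a : R[i]) x : l2_norm (a *: x) = `|a| * l2_norm x.
Proof.
apply/eqP; rewrite -(@eqrXn2 _ 2)// ?mulr_ge0 ?sqrt_dnorm_ge0//.
by rewrite exprMn !sqrtCK dnormZ.
Qed.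

Lemma l2_norm_eq0 x : l2_norm x = 0 -> x = 0.
Proof. by move/eqP; rewrite sqrt_dnorm_eq0 => /eqP. Qed.

HB.instance Definition _ := Lmodule_isNormed.Build R[i] l2
  ler_l2_normD l2_normZ l2_norm_eq0.

Lemma sqr_l2_norm (x : l2) : `|x| ^+ 2 = l2_inner x x.
Proof. exact: sqrtCK. Qed.

Lemma l2_coord_norm_le (x : l2) n : `|x n| <= `|x|.
Proof.
rewrite -(@ler_sqr R[i]) ?nnegrE ?normr_ge0// sqr_l2_norm l2_innerxx.
by rewrite hnormE -rmorphXn/= lecR l2_coord_le.
Qed.

Lemma l2_sum_ltE (x : l2) (e : R) n : `|x| < e%:C ->
  \sum_(0 <= i < n) hnorm (x i) ^+ 2 <= e ^+ 2.
Proof.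
move=> xe; have e0 : 0 <= e%:C := le_trans (normr_ge0 x) (ltW xe).
apply: le_trans (l2_sum_le x n) _.
rewrite -lecR -l2_innerxx -sqr_l2_norm rmorphXn/=.
by rewrite ler_sqr ?nnegrE ?normr_ge0// ltW.
Qed.

Lemma l2_norm_le_sum (x : l2) (e : R) : 0 <= e ->
  (forall n, \sum_(0 <= i < n) hnorm (x i) ^+ 2 <= e ^+ 2) -> `|x| <= e%:C.
Proof.
move=> e0 xe; rewrite -(@ler_sqr R[i]) ?nnegrE ?normr_ge0 ?ler0c//.
rewrite sqr_l2_norm l2_innerxx -rmorphXn/= lecR.
by apply: limr_le; [exact: l2P | exact: nearW].
Qed.

Lemma l2_complete (F : set_system l2) : ProperFilter F -> cauchy F -> cvg F.
Proof.
move=> FF /cauchy_ballP Fc.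
have Fx (e : R) : 0 < e -> \forall x & y \near F, `|x - y| < e%:C.
  by move=> e0; have /Fc : 0 < e%:C by rewrite ltr0c.
have cvi i : cvg ((fun x : l2 => x i) @ F).
  apply/cauchy_cvgP/cauchy_ballP => e e0; have := Fc _ e0.
  rewrite -!ball_normE /= near_map2; apply: filterS => -[x y] /= xye.
  exact: le_lt_trans (l2_coord_norm_le (x - y) i) xye.
pose l i : H := lim ((fun x : l2 => x i) @ F).
have near_l n (d : R) : 0 < d ->
    \forall y \near F, forall i, (i < n)%N -> hnorm (l i - (y : l2) i) < d.
  move=> d0; elim: n => [|n IH]; first exact: nearW.
  have /cvgrPdist_lt/(_ d%:C) : (fun x : l2 => x n) @ F --> l n by exact: cvi.
  rewrite ltr0c => /(_ d0) cn; near=> y => i; rewrite ltnS leq_eqVlt => /orP[/eqP ->|].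
    by rewrite -ltcR -hnormE; near: y.
  by move: i; near: y.
have Fl (e : R) : 0 < e -> \forall x \near F,
    forall n, \sum_(0 <= i < n) hnorm ((x : l2) i - l i) ^+ 2 <= e ^+ 2.
  move=> e0; have d0 : 0 < e / 2 by rewrite divr_gt0.
  near=> x => n; have dn0 : 0 < e / 2 / n.+1%:R by rewrite divr_gt0.
  have [y [xy yl]] : exists y : l2, `|x - y| < (e / 2)%:C /\
      forall i, (i < n)%N -> hnorm (l i - y i) < e / 2 / n.+1%:R.
    near F => y; exists y; split; near: y; last exact: near_l.
    by near: x; apply: (@nearP_dep _ _ F F); exact: Fx.
  apply: (@le_trans _ _ (\sum_(0 <= i < n)
      (2 * hnorm ((x - y) i) ^+ 2 + 2 * (e / 2 / n.+1%:R) ^+ 2))).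
    rewrite !big_nat; apply: ler_sum => i /andP[_ ilt].
    apply: (@le_trans _ _ ((hnorm ((x - y) i) + hnorm (l i - y i)) ^+ 2)).
      rewrite ler_sqr ?nnegrE ?addr_ge0 ?hnorm_ge0//.
      have -> : x i - l i = (x - y) i + (y i - l i) by rewrite addrA subrK.
      by rewrite -(hnormN (l i - y i)) opprB ler_hnormD.
    apply: le_trans (sqrD_le _ _) _; rewrite lerD2l ler_pM2l//.
    by rewrite ler_sqr ?nnegrE ?hnorm_ge0 ?ltW ?yl.
  rewrite big_split/= -mulr_sumr sumr_const_nat subn0.
  have := l2_sum_ltE n xy => hs.
  have hn : (2 * (e / 2 / n.+1%:R) ^+ 2) *+ n <= 2 * (e / 2) ^+ 2.
    rewrite -mulrnAr ler_pM2l// expr_div_n -mulr_natr -mulrA.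
    rewrite ler_piMr ?sqr_ge0// mulrC ler_pdivrMr ?exprn_gt0// mul1r.
    by rewrite -natrX ler_nat (leq_trans (leqnSn n))// leq_pmulr.
  apply: le_trans (lerD (ler_wpM2l _ hs) hn) _ => //.
  have -> : 2 * (e / 2) ^+ 2 + 2 * (e / 2) ^+ 2 = e ^+ 2 by field.
  exact: lexx.
have [x0 x0l] : exists x : l2, square_summable (fun i => x i - l i).
  near F => x; exists x; apply: nondecreasing_is_cvgn.
    by apply: nondecreasing_series => i _ _; exact: sqr_ge0.
  exists (1 ^+ 2) => _ [n _ <-]; move: n; near: x; exact: Fl.
have Ls : square_summable l.
  have -> : l = (-1) *: (fun i => x0 i - l i) + x0.
    by apply/funext => i; rewrite !fctE scaleN1r opprB subrK.
  by apply: square_summable_lin => //; exact: l2P.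
apply/cvg_ex; exists (L2Seq (asboolT Ls)); apply/cvgrPdist_le => e e0.
have [er ee er0] : exists2 r : R, e = r%:C & 0 < r.
  exists (complex.Re e); first by rewrite RRe_real// gtr0_real.
  by rewrite -ltr0c RRe_real// gtr0_real.
rewrite ee; near=> x; rewrite distrC; apply: l2_norm_le_sum; first exact: ltW.
by near: x; exact: Fl.
Unshelve. all: by end_near. Qed.

HB.instance Definition _ := Uniform_isComplete.Build l2 l2_complete.
HB.instance Definition _ := isHilbert.Build R l2 sqr_l2_norm.

End L2.

Arguments bounded_op_pred {R} H K.

Section Composition.
Context (R : realType) (H K L : hilbertType R).

Lemma bcomp_subproof (S : bop K L) (T : bop H K) : S \o T \in bounded_op_pred H L.
Proof.
apply/asboolP; split=> [a x y|]; first by rewrite /= !linearP.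
have [_ [M SM]] := bopP S; have [_ [N TN]] := bopP T.
exists (`|M| * N) => x /=; rewrite (le_trans (SM _))//.
rewrite (@le_trans _ _ (`|M| * hnorm (T x)))//.
  by rewrite ler_wpM2r ?hnorm_ge0// ler_norm.
by rewrite -mulrA ler_wpM2l.
Qed.

Definition bcomp (S : bop K L) (T : bop H K) : bop H L :=
  BOp (bcomp_subproof S T).

Lemma bid_subproof : @idfun H \in bounded_op_pred H H.
Proof. by apply/asboolP; split=> //; exists 1 => x; rewrite mul1r. Qed.

Definition bid : bop H H := BOp bid_subproof.

End Composition.

Arguments bid {R H}.
Notation "S \ob T" := (bcomp S T) (at level 40, left associativity).

Section Operators.
Context (R : realType).
Implicit Types H K : hilbertType R.

(* S = T^*; the adjoint of a bounded operator exists and is unique. *)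
Definition adjoint_pair H K (T : bop H K) (S : bop K H) :=
  forall x y, inner (T x) y = inner x (S y).

Definition adjoint_set H K (M : set (bop H K)) : set (bop K H) :=
  [set S | exists2 T, M T & adjoint_pair T S].

Definition comp_set H K L (A : set (bop K L)) (B : set (bop H K)) :
  set (bop H L) := [set S \ob T | S in A & T in B].

Definition subspace H K (X : set (bop H K)) :=
  X 0 /\ forall (a : R[i]) S T, X S -> X T -> X (a *: S + T).

Definition opnorm H K (T : bop H K) : R :=
  sup [set hnorm (T x) | x in [set x | hnorm x <= 1]].

(* The weak* topology of B(H, K), i.e. the topology of the duality with the
   trace class operators, is the coarsest one for which the functionals
   T |-> sum_n <T xi_n, eta_n> with sum_n |xi_n|^2 and sum_n |eta_n|^2 finite
   are continuous. *)
Definition wstar_pairing H K (xi : l2 H) (eta : l2 K) (T : bop H K) : R[i] :=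
  csum (fun n => inner (T (xi n)) (eta n)).

Definition wstar_closure H K (X : set (bop H K)) : set (bop H K) :=
  [set T | forall (s : seq (l2 H * l2 K)) (e : R), 0 < e ->
    exists2 S, X S &
      forall p, p \in s -> normc (wstar_pairing p.1 p.2 (T - S)) < e].

Definition wstar_span H K (X : set (bop H K)) : set (bop H K) :=
  wstar_closure (smallest (@subspace H K) X).

Definition tro H K (M : set (bop H K)) :=
  subspace M /\ comp_set (comp_set M (adjoint_set M)) M `<=` M.

Definition weak_tro_equivalent K1 K2 H1 H2
    (U : set (bop K1 K2)) (V : set (bop H1 H2)) :=
  exists (M1 : set (bop H1 K1)) (M2 : set (bop H2 K2)),
    [/\ tro M1, tro M2,
        U = wstar_span (comp_set (comp_set M2 V) (adjoint_set M1)) &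
        V = wstar_span (comp_set (comp_set (adjoint_set M2) U) M1)].

(* M_infty^w(X), each matrix being identified with the operator from the
   direct sum H^infty to K^infty that it defines *)
Definition bounded_submatrices H K (a : nat -> nat -> bop H K) :=
  exists C : R, forall (I J : {fset nat}) (x : nat -> H),
    \sum_(i <- I) hnorm (\sum_(j <- J) a i j (x j)) ^+ 2 <=
    C ^+ 2 * \sum_(j <- J) hnorm (x j) ^+ 2.

Definition matrix_operator H K (a : nat -> nat -> bop H K)
    (T : bop (l2 H) (l2 K)) :=
  forall (x : l2 H) (i : nat), series (fun j => a i j (x j)) @ \oo --> T x i.

Definition Minfty H K (X : set (bop H K)) : set (bop (l2 H) (l2 K)) :=
  [set T | exists a : nat -> nat -> bop H K,
    [/\ forall i j, X (a i j), bounded_submatrices a & matrix_operator a T]].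

Definition dist_op H K (T : bop H K) (X : set (bop H K)) : R :=
  inf [set opnorm (T - S) | S in X].

(* Real sup of the empty set is 0. *)
Definition refl_seminorm H K (X : set (bop H K)) (T : bop H K) : R :=
  sup [set r | exists xi eta, [/\ hnorm xi = 1, hnorm eta = 1,
    forall S, X S -> inner (S xi) eta = 0 & r = normc (inner (T xi) eta)]].

Definition hyperreflexive H K (X : set (bop H K)) :=
  exists2 k : R, 0 < k & forall T, dist_op T X <= k * refl_seminorm X T.

(* If X is norm closed and hyperreflexive, dist_op T X > 0 for T outside X, so
   the quotients below have nonzero denominators. *)
Definition hyperreflexivity_constant H K (X : set (bop H K)) : \bar R :=
  if `[< X = setT >] then 1%E
  else if `[< hyperreflexive X >] then
    ereal_sup [set (dist_op T X / refl_seminorm X T)%:E | T in ~` X]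
  else +oo%E.

Definition complete_hyperreflexivity_constant H K (X : set (bop H K)) :=
  hyperreflexivity_constant (Minfty X).

Definition projection H (P : bop H H) := P \ob P = P /\ adjoint_pair P P.

Definition proj_le H (P Q : bop H H) := range P `<=` range Q.

Definition proj_sup H (S : set (bop H H)) (P : bop H H) :=
  [/\ projection P, forall Q, S Q -> proj_le Q P &
      forall P', projection P' -> (forall Q, S Q -> proj_le Q P') ->
        proj_le P P'].

Definition proj_inf H (S : set (bop H H)) (P : bop H H) :=
  [/\ projection P, forall Q, S Q -> proj_le P Q &
      forall P', projection P' -> (forall Q, S Q -> proj_le P' Q) ->
        proj_le P' P].

Definition proj_lattice H (L : set (bop H H)) :=
  [/\ L `<=` @projection H, L 0, L bid,
      forall S P, S `<=` L -> proj_sup S P -> L P &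
      forall S P, S `<=` L -> proj_inf S P -> L P].

Definition Alg H (L : set (bop H H)) : set (bop H H) :=
  [set A | forall P, L P -> (bid - P) \ob A \ob P = 0].

Definition Lat H (A : set (bop H H)) : set (bop H H) :=
  [set P | projection P /\ forall T, A T -> (bid - P) \ob T \ob P = 0].

Definition reflexive_lattice H (L : set (bop H H)) :=
  proj_lattice L /\ Lat (Alg L) = L.

Definition commutant H (A : set (bop H H)) : set (bop H H) :=
  [set T | forall S, A S -> T \ob S = S \ob T].

(* Only the values of theta on A matter. *)
Definition star_isomorphism H1 H2 (A : set (bop H1 H1)) (B : set (bop H2 H2))
    (theta : bop H1 H1 -> bop H2 H2) :=
  [/\ set_bij A B theta,
      forall (a : R[i]) S T, A S -> A T ->
        theta (a *: S + T) = a *: theta S + theta T,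
      forall S T, A S -> A T -> theta (S \ob T) = theta S \ob theta T &
      forall S T, A S -> A T -> adjoint_pair S T ->
        adjoint_pair (theta S) (theta T)].

Definition separable_space H := exists2 D : set H, countable D & dense D.

End Operators.

(* Main.v *)
From mathcomp Require Import all_boot all_order all_algebra.
From mathcomp Require Import sesquilinear finmap complex ring lra.
From mathcomp Require Import mathcomp_extra boolp classical_sets functions
  cardinality reals ereal topology normedtype sequences.
Require Import Defs.
Set Implicit Arguments.
Unset Strict Implicit.
Unset Printing Implicit Defensive.
Import Order.TTheory GRing.Theory Num.Theory.
Import numFieldNormedType.Exports.
Import Normc.
Local Open Scope classical_set_scope.
Local Open Scope complex_scope.
Local Open Scope ring_scope.

(** The isomorphism theta is spatial up to multiplicity, and once it has enough
    intertwiners both conclusions are formal.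

    Let G be the set of pairs (a, b) with a in the double commutant of L1 and
    b = theta a. An intertwiner is an operator T with T a = b T for all (a, b) in
    G. As G is closed under adjoints, the intertwiners form a ternary ring M.
    Suppose that the identity is a strong sum of operators adj (W k) W k with
    W k in M. Then A in Alg L1 is the weak* limit of the sums of
    adj (W k) (W k A adj (W l)) W l, and W k A adj (W l) is in Alg L2 because theta
    carries L1 onto L2 (Alg_wstar_span). By symmetry the algebras are weak TRO
    equivalent through the adjoints of M. The same resolution for the amplified
    representation on l2 H1 gives the rows of an isometry V from l2 H1 to l2 H2
    with V (a tensor 1) = (b tensor 1) V (amplified_isometry). The maps
    T |-> V T adj V and T |-> adj V T V exchange the spaces Minfty (Alg L1) and
    Minfty (Alg L2), distances do not decrease under the first one and the
    seminorms do not increase, so one constant is at most the other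
    (hyperreflexivity_constant_compress); symmetry gives equality.

    Two facts carry the proof.

    The common kernel of the intertwiners is 0 (vn_iso_itw_null). This holds the
    essential content of the automatic normality of theta. If xi is in the common
    kernel, consider the projection onto the closure of {(a xi, b eta)}: its corner
    from H1 to H2 is an intertwiner, so it kills xi, and (xi, 0) turns out to be in
    that closure. Thus some a is close to the identity at xi while its image b is
    close to 0 at eta. A projection in a
    real Hilbert space makes a and b selfadjoint, and resolvents make them bounded.
    Summing such elements with fast decreasing errors and taking resolvents of the
    partial sums gives a decreasing sequence which tends to 0 on the kernel, while
    its image remains bounded below at eta. The isomorphism preserves order, so
    this is a contradiction. Separability enters through a sequence of vectors
    spanning a dense subspace of the kernel.

    A ternary ring without common kernel resolves the identity
    (greedy_resolution): peeling off Q (adj T) T Q from the remainder Q, with T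
    nearly maximal at one vector of a total sequence at a time, leaves nothing. *)

(** * The real part of the inner product *)

Section RealInner.
Context (R : realType) (H : hilbertType R).
Implicit Types x y z : H.

(** All estimates are made with the real inner product Re <x, y>: it
    determines complex linear operators and their adjoints, and inequalities for it
    compare real numbers. *)
Definition rin x y : R := complex.Re (inner x y).

Lemma rinDl x y z : rin (x + y) z = rin x z + rin y z.
Proof. by rewrite /rin linearDl raddfD. Qed.

Lemma rinDr x y z : rin x (y + z) = rin x y + rin x z.
Proof. by rewrite /rin linearDr raddfD. Qed.

Lemma innerC x y : inner y x = (inner x y)^*%C.
Proof. by rewrite hermC expr0 mul1r. Qed.

Lemma rinC x y : rin x y = rin y x.
Proof. by rewrite /rin innerC; case: (inner y x). Qed.

Lemma rinZl (r : R) x y : rin (r%:C *: x) y = r * rin x y.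
Proof.
by rewrite /rin linearZl_LR /=; case: (inner x y) => a b /=; rewrite mul0r subr0.
Qed.

Lemma rinZr (r : R) x y : rin x (r%:C *: y) = r * rin x y.
Proof. by rewrite rinC rinZl rinC. Qed.

Lemma rinNl x y : rin (- x) y = - rin x y.
Proof. by rewrite /rin linearNl raddfN. Qed.

Lemma rinNr x y : rin x (- y) = - rin x y.
Proof. by rewrite rinC rinNl rinC. Qed.

Lemma rinBl x y z : rin (x - y) z = rin x z - rin y z.
Proof. by rewrite rinDl rinNl. Qed.

Lemma rinBr x y z : rin x (y - z) = rin x y - rin x z.
Proof. by rewrite rinDr rinNr. Qed.

Lemma rin0l x : rin 0 x = 0.
Proof. by rewrite /rin linear0l. Qed.

Lemma rin0r x : rin x 0 = 0.
Proof. by rewrite rinC rin0l. Qed.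

Lemma rinxx x : rin x x = hnorm x ^+ 2.
Proof. by rewrite /rin -sqr_hnorm. Qed.

Lemma rinxx_ge0 x : 0 <= rin x x.
Proof. by rewrite rinxx sqr_ge0. Qed.

Lemma hnorm_eq0 x : hnorm x = 0 -> x = 0.
Proof. by move=> h; apply/eqP; rewrite -normr_eq0 hnormE h. Qed.

Lemma rinxx_eq0 x : rin x x = 0 -> x = 0.
Proof. by rewrite rinxx => /eqP; rewrite sqrf_eq0 => /eqP /hnorm_eq0. Qed.

Lemma Re_le_normc (z : R[i]) : `|complex.Re z| <= normc z.
Proof.
by case: z => a b /=; rewrite -sqrtr_sqr ler_wsqrtr// lerDl sqr_ge0.
Qed.

Lemma rin_CS x y : `|rin x y| <= hnorm x * hnorm y.
Proof. exact: le_trans (Re_le_normc _) (inner_CS x y). Qed.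

Lemma inner_rin x y : inner x y = rin x y +i* rin x ('i *: y).
Proof.
rewrite /rin linearZr_LR /=; case: (inner x y) => a b /=.
by congr Complex; ring.
Qed.

Lemma rin_eq0_all x : (forall y, rin x y = 0) -> x = 0.
Proof. by move=> h; apply: rinxx_eq0. Qed.

Lemma rin_ext x y : (forall z, rin x z = rin y z) -> x = y.
Proof.
move=> h; apply/eqP; rewrite -subr_eq0; apply/eqP/rin_eq0_all => z.
by rewrite rinBl h subrr.
Qed.

Lemma hnormB x y : hnorm (x - y) = hnorm (y - x).
Proof. by rewrite -opprB hnormN. Qed.

Lemma ler_hnormB x y : hnorm (x - y) <= hnorm x + hnorm y.
Proof. by rewrite -(hnormN y) ler_hnormD. Qed.

Lemma hnorm_triangle z x y : hnorm (x - y) <= hnorm (x - z) + hnorm (z - y).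
Proof. by rewrite -[x - y](subrKA z) ler_hnormD. Qed.

Lemma hnormZr (r : R) x : hnorm (r%:C *: x) = `|r| * hnorm x.
Proof. by rewrite hnormZ /= expr0n addr0 sqrtr_sqr. Qed.

Lemma hnormD_sqr x y : hnorm (x + y) ^+ 2 = hnorm x ^+ 2 + 2 * rin x y + hnorm y ^+ 2.
Proof. by rewrite -!rinxx rinDl !rinDr (rinC y x); ring. Qed.

Lemma hnormB_sqr x y : hnorm (x - y) ^+ 2 = hnorm x ^+ 2 - 2 * rin x y + hnorm y ^+ 2.
Proof. by rewrite -!rinxx rinBl !rinBr (rinC y x); ring. Qed.

End RealInner.

(** * Norm convergence of sequences *)

Section Convergence.
Context (R : realType) (H : hilbertType R).
Implicit Types (u v : nat -> H).

Definition conv u (l : H) := (fun n => hnorm (u n - l)) @ \oo --> (0 : R).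

Lemma convP u l : conv u l <->
  forall e : R, 0 < e -> exists N, forall n, (N <= n)%N -> hnorm (u n - l) < e.
Proof.
split=> [/cvgrPdist_lt h e e0|h].
  have [N _ hN] := h e e0; exists N => n Nn.
  by have := hN n Nn; rewrite /= sub0r normrN ger0_norm ?hnorm_ge0.
apply/cvgrPdist_lt => e e0; have [N hN] := h e e0.
exists N => // n /= Nn.
by rewrite sub0r normrN ger0_norm ?hnorm_ge0 ?hN.
Qed.

Lemma convE u l : (u @ \oo --> l) <-> conv u l.
Proof.
rewrite convP; split=> [/cvgrPdist_lt h e e0|h].
  have [|N _ hN] := h e%:C; first by rewrite ltr0c.
  by exists N => n Nn; rewrite hnormB -ltcR -hnormE; exact: hN.
apply/cvgrPdist_lt => e e0.
have er : e = (complex.Re e)%:C by rewrite RRe_real// gtr0_real.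
have [|N hN] := h (complex.Re e); first by rewrite -ltr0c -er.
exists N => // n /= Nn; rewrite distrC hnormE er ltcR; exact: hN.
Qed.

Lemma conv_unique u l l' : conv u l -> conv u l' -> l = l'.
Proof.
move=> /convE ul /convE ul'.
exact: (cvg_unique (@norm_hausdorff _ H) ul ul').
Qed.

Lemma cauchy_conv u :
  (forall e : R, 0 < e -> exists N, forall m n, (N <= m)%N -> (N <= n)%N ->
     hnorm (u m - u n) < e) -> exists l, conv u l.
Proof.
move=> h; have : cvg (u @ \oo).
  apply/cauchy_cvgP/cauchy_ballP => e e0.
  have er : e = (complex.Re e)%:C by rewrite RRe_real// gtr0_real.
  have [|N hN] := h (complex.Re e); first by rewrite -ltr0c -er.
  rewrite -ball_normE near_map2; exists ([set n | (N <= n)%N], [set n | (N <= n)%N]).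
    by split; exists N.
  by move=> [m n] [/= Nm Nn]; rewrite /= hnormE er ltcR; exact: hN.
by move/cvg_ex => [l /convE ul]; exists l.
Qed.

Lemma conv_eq u v l : (forall n, u n = v n) -> conv v l -> conv u l.
Proof. by move=> /funext ->. Qed.

Lemma conv_cst (x : H) : conv (fun=> x) x.
Proof. by apply/convP => e e0; exists 0%N => n _; rewrite subrr hnorm0. Qed.

Lemma conv_squeeze u l (w : nat -> R) : (forall n, hnorm (u n - l) <= w n) ->
  w @ \oo --> (0 : R) -> conv u l.
Proof.
move=> uw w0; apply: (@squeeze_cvgr _ _ _ _ (cst 0) w) => //; last exact: cvg_cst.
by apply: nearW => n; rewrite hnorm_ge0 uw.
Qed.

Lemma convD u v l l' : conv u l -> conv v l' -> conv (fun n => u n + v n) (l + l').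
Proof.
move=> ul vl.
apply: (@conv_squeeze _ _ (fun n => hnorm (u n - l) + hnorm (v n - l'))).
  by move=> n; rewrite opprD addrACA ler_hnormD.
by rewrite -[0]addr0; exact: cvgD.
Qed.

Lemma convZ (a : R[i]) u l : conv u l -> conv (fun n => a *: u n) (a *: l).
Proof.
move=> ul; apply: (@conv_squeeze _ _ (fun n => normc a * hnorm (u n - l))).
  by move=> n; rewrite -scalerBr hnormZ.
by rewrite -[0](mulr0 (normc a)); apply: cvgMl_tmp.
Qed.

Lemma convN u l : conv u l -> conv (fun n => - u n) (- l).
Proof.
move=> ul; apply: (@conv_squeeze _ _ (fun n => hnorm (u n - l))) => // n.
by rewrite -opprD hnormN.
Qed.

Lemma convB u v l l' : conv u l -> conv v l' -> conv (fun n => u n - v n) (l - l').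
Proof. by move=> ul vl; apply: convD => //; exact: convN. Qed.

Lemma conv_rin u l y : conv u l -> (fun n => rin (u n) y) @ \oo --> rin l y.
Proof.
move=> ul; apply/cvgrPdist_le => e e0.
have y1 : 0 < hnorm y + 1 by rewrite ltr_wpDl ?hnorm_ge0.
have [N hN] := (convP _ _).1 ul _ (divr_gt0 e0 y1).
exists N => [//|n /= Nn]; rewrite -rinBl (le_trans (rin_CS _ _))// hnormB.
have := hN n Nn; rewrite ltr_pdivlMr// => /ltW h.
by rewrite (le_trans _ h)// ler_wpM2l ?hnorm_ge0// lerDl.
Qed.

Lemma conv_hnorm u l : conv u l -> (fun n => hnorm (u n)) @ \oo --> hnorm l.
Proof.
move=> ul; apply/cvgrPdist_lt => e e0.
have [N hN] := (convP _ _).1 ul e e0; exists N => // n /= /hN h.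
have h1 := ler_hnormD (u n - l) l; have h2 := ler_hnormD (l - u n) (u n).
rewrite !subrK in h1 h2; rewrite hnormB in h2.
by rewrite ltr_norml; apply/andP; split; lra.
Qed.

End Convergence.

(** * Bounded operators *)

Section BopBasics.
Context (R : realType).
Implicit Types H K L : hilbertType R.

Lemma bop_ext H K (S T : bop H K) : (forall x, S x = T x) -> S = T.
Proof. by move=> h; apply/val_inj/funext. Qed.

Lemma bop_bound H K (T : bop H K) : exists2 M : R, 0 < M & forall x, hnorm (T x) <= M * hnorm x.
Proof.
have [_ [M hM]] := bopP T; exists (`|M| + 1); first by rewrite ltr_wpDl.
move=> x; apply: le_trans (hM x) _; rewrite ler_wpM2r ?hnorm_ge0//.
by rewrite (le_trans (ler_norm _))// lerDl.
Qed.

Lemma mk_bop H K (f : H -> K) (M : R) :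
  (forall (a : R[i]) x y, f (a *: x + y) = a *: f x + f y) ->
  (forall x, hnorm (f x) <= M * hnorm x) -> exists T : bop H K, forall x, T x = f x.
Proof.
move=> fl fM; have fb : f \in bounded_op_pred H K by apply/asboolP; split=> //; exists M.
by exists (BOp fb).
Qed.

Lemma bopDE H K (S T : bop H K) x : (S + T) x = S x + T x. Proof. by []. Qed.
Lemma bopNE H K (S : bop H K) x : (- S) x = - S x. Proof. by []. Qed.
Lemma bopBE H K (S T : bop H K) x : (S - T) x = S x - T x. Proof. by []. Qed.
Lemma bopZE H K a (S : bop H K) x : (a *: S) x = a *: S x. Proof. by []. Qed.
Lemma bop0E H K x : (0 : bop H K) x = 0. Proof. by []. Qed.
Lemma bcompE H K L (S : bop K L) (T : bop H K) x : (S \ob T) x = S (T x). Proof. by []. Qed.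
Lemma bidE H x : (bid : bop H H) x = x. Proof. by []. Qed.

Definition bopE := (bopDE, bopNE, bopZE, bop0E, bcompE, bidE).

Lemma bop_add H K (T : bop H K) x y : T (x + y) = T x + T y. Proof. exact: linearD. Qed.
Lemma bop_sub H K (T : bop H K) x y : T (x - y) = T x - T y. Proof. exact: linearB. Qed.
Lemma bop_opp H K (T : bop H K) x : T (- x) = - T x. Proof. exact: linearN. Qed.
Lemma bop_zero H K (T : bop H K) : T 0 = 0. Proof. exact: linear0. Qed.
Lemma bop_scale H K (T : bop H K) a x : T (a *: x) = a *: T x. Proof. exact: linearZ. Qed.

Lemma bcompA H K L L' (S : bop L L') (T : bop K L) (U : bop H K) :
  S \ob (T \ob U) = S \ob T \ob U.
Proof. exact: bop_ext. Qed.

Lemma conv_bop H K (T : bop H K) u l : conv u l -> conv (fun n => T (u n)) (T l).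
Proof.
move=> ul; have [M M0 hM] := bop_bound T.
apply: (@conv_squeeze _ _ _ _ (fun n => M * hnorm (u n - l))).
  by move=> n; rewrite -linearB hM.
by rewrite -[0](mulr0 M); apply: cvgMl_tmp.
Qed.

End BopBasics.

(** * Real quadratic inequalities *)

Section RealLemmas.
Context (R : realType).

Lemma linear_le_quadratic (X Y : R) : (forall t, 2 * t * X <= t ^+ 2 * Y) -> X = 0.
Proof.
move=> h; have Y0 : 0 <= Y.
  have := h 1; have := h (-1); rewrite sqrrN expr1n; lra.
have Y1 : 0 < Y + 1 by rewrite ltr_wpDl.
have := h (X / (Y + 1)); rewrite -subr_ge0.
have -> : (X / (Y + 1)) ^+ 2 * Y - 2 * (X / (Y + 1)) * X =
   - (X ^+ 2 * ((Y + 2) / (Y + 1) ^+ 2)).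
  by field; rewrite gt_eqF.
rewrite oppr_ge0 pmulr_lle0; last by rewrite divr_gt0 ?exprn_gt0 ?ltr_wpDl.
by move=> hX; apply/eqP; rewrite -sqrf_eq0 eq_le hX sqr_ge0.
Qed.

Lemma discriminant_le (A B C : R) : 0 <= C ->
  (forall t, 0 <= A - 2 * t * B + t ^+ 2 * C) -> B ^+ 2 <= A * C.
Proof.
rewrite le_eqVlt eq_sym => /predU1P[C0|C0] h; last first.
  have := h (B / C); have -> : A - 2 * (B / C) * B + (B / C) ^+ 2 * C = A - B ^+ 2 / C.
    by field; rewrite gt_eqF.
  by rewrite subr_ge0 ler_pdivrMr.
suff -> : B = 0 by rewrite C0 mulr0 expr0n.
  apply/eqP/negPn/negP => B0; have := h ((A + 1) / (2 * B)).
  have -> : A - 2 * ((A + 1) / (2 * B)) * B + ((A + 1) / (2 * B)) ^+ 2 * C = - 1.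
    by rewrite C0; field.
  lra.
Qed.

Lemma le_of_sqr_le_mul (a b : R) : 0 <= a -> 0 <= b -> a ^+ 2 <= b * a -> a <= b.
Proof.
by rewrite le_eqVlt eq_sym => /predU1P[->//|a0] _; rewrite expr2 ler_pM2r.
Qed.

End RealLemmas.

(** * Orthogonal projection in a direct sum *)

Section Projection.
Context (R : realType).
Implicit Types K : hilbertType R.

Lemma cauchy_sqr_conv K (u : nat -> K) (w : nat -> R) :
  (forall m n, hnorm (u m - u n) ^+ 2 <= w m + w n) -> w @ \oo --> (0 : R) ->
  exists l, conv u l.
Proof.
move=> uw /cvgrPdist_lt w0; apply: cauchy_conv => e e0.
have e2 : 0 < e ^+ 2 / 2 by rewrite divr_gt0// exprn_gt0.
have [N _ hN] := w0 _ e2; exists N => m n Nm Nn.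
rewrite -(@ltr_sqr R) ?nnegrE ?hnorm_ge0 ?(ltW e0)//.
apply: le_lt_trans (uw m n) _.
have := hN m Nm; have := hN n Nn; rewrite /= !sub0r !normrN => h1 h2.
have := ler_norm (w m); have := ler_norm (w n); lra.
Qed.

(** The orthogonal projection theorem in the direct sum of K1 and K2, for the
    closure of a real subspace S of pairs: a minimizing sequence is Cauchy by the
    parallelogram identity. Working with pairs spares the construction of the
    direct sum as a Hilbert space, and real scalars are what allows S to consist
    of the vectors (c xi, d eta) with c and d selfadjoint. *)
Lemma pair_projection K1 K2 (S : set (K1 * K2)) (u : K1) (v : K2) :
  S (0, 0) ->
  (forall p q, S p -> S q -> S (p.1 + q.1, p.2 + q.2)) ->
  (forall (r : R) p, S p -> S (r%:C *: p.1, r%:C *: p.2)) ->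
  exists p q,
   (exists a b, [/\ forall n : nat, S (a n, b n), conv a p & conv b q]) /\
   forall a b, S (a, b) -> rin (u - p) a + rin (v - q) b = 0.
Proof.
move=> S0 SD SZ.
pose f (p : K1 * K2) : R := hnorm (u - p.1) ^+ 2 + hnorm (v - p.2) ^+ 2.
have f0 p : 0 <= f p by rewrite addr_ge0 ?sqr_ge0.
have hi : has_inf [set f p | p in S].
  split; first by exists (f (0,0)), (0,0).
  by exists 0 => _ [p _ <-].
pose d := inf [set f p | p in S].
have fd p : S p -> d <= f p by move=> Sp; apply: ge_inf; [exact: hi.2|exists p].
have /choice[a ha] n : exists p, S p /\ f p < d + n.+1%:R^-1.
  have [|_ [p Sp <-] fp] := @inf_adherent R _ n.+1%:R^-1 _ hi; first by rewrite invr_gt0.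
  by exists p.
have cau m n : hnorm ((a m).1 - (a n).1) ^+ 2 + hnorm ((a m).2 - (a n).2) ^+ 2 <=
    2 * m.+1%:R^-1 + 2 * n.+1%:R^-1.
  have [Sm fm] := ha m; have [Sn fn] := ha n.
  have : d <= hnorm (u - (2^-1)%:C *: ((a m).1 + (a n).1)) ^+ 2 +
      hnorm (v - (2^-1)%:C *: ((a m).2 + (a n).2)) ^+ 2.
    exact: fd _ (SZ (2^-1) _ (SD _ _ Sm Sn)).
  have par K (x y z : K) : hnorm (x - y) ^+ 2 = 2 * hnorm (z - x) ^+ 2 +
     2 * hnorm (z - y) ^+ 2 - 4 * hnorm (z - (2^-1)%:C *: (x + y)) ^+ 2.
    rewrite !hnormB_sqr rinZr hnormZr exprMn rinDr hnormD_sqr.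
    rewrite ger0_norm ?invr_ge0//.
    by field.
  rewrite (par _ (a m).1 (a n).1 u) (par _ (a m).2 (a n).2 v).
  move: fm fn; rewrite /f; clearbody d; move: (_.+1%:R^-1) (_.+1%:R^-1) => i j; lra.
have w0 : (fun n : nat => 2 * n.+1%:R^-1) @ \oo --> (0 : R).
  by rewrite -[0](mulr0 2); apply: cvgMl_tmp; exact: cvg_harmonic.
have [p ap] : exists p, conv (fun n => (a n).1) p.
  apply: cauchy_sqr_conv w0 => m n; apply: le_trans (cau m n).
  by rewrite lerDl sqr_ge0.
have [q aq] : exists q, conv (fun n => (a n).2) q.
  apply: cauchy_sqr_conv w0 => m n; apply: le_trans (cau m n).
  by rewrite lerDr sqr_ge0.
exists p, q; split.
  exists (fun n => (a n).1), (fun n => (a n).2); split=> // n.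
  by have [] := ha n; case: (a n).
move=> x y Sxy; apply: (@linear_le_quadratic R _ (hnorm x ^+ 2 + hnorm y ^+ 2)) => t.
set Y := hnorm x ^+ 2 + hnorm y ^+ 2.
pose X n := rin (u - (a n).1) x + rin (v - (a n).2) y.
have XX : X @ \oo --> rin (u - p) x + rin (v - q) y.
  by apply: cvgD; apply: conv_rin; apply: convB => //; exact: conv_cst.
have le n : 2 * t * X n - n.+1%:R^-1 <= t ^+ 2 * Y.
  have [Sn fn] := ha n.
  have : d <= hnorm (u - ((a n).1 + t%:C *: x)) ^+ 2 +
      hnorm (v - ((a n).2 + t%:C *: y)) ^+ 2.
    exact: fd _ (SD _ _ Sn (SZ t _ Sxy)).
  move: fn; rewrite /f /X /Y !opprD !addrA.
  rewrite (hnormB_sqr _ (t%:C *: x)) (hnormB_sqr _ (t%:C *: y)) !rinZr.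
  rewrite !hnormZr !exprMn !real_normK ?num_real//; clearbody d; move: (_.+1%:R^-1) => i; lra.
have L : (fun n => 2 * t * X n - n.+1%:R^-1) @ \oo -->
    2 * t * (rin (u - p) x + rin (v - q) y) - 0.
  by apply: cvgB; [apply: cvgMl_tmp|exact: cvg_harmonic].
rewrite subr0 in L.
by rewrite -(cvg_lim _ L)//; apply: limr_le; [apply/cvg_ex; eexists; exact: L|exact: nearW].
Qed.

End Projection.

(** * Adjoints *)

Section Adjoint.
Context (R : realType).
Implicit Types H K L : hilbertType R.

Lemma rin_conjZ H (a : R[i]) (x y : H) : rin (a^*%C *: x) y = rin x (a *: y).
Proof. by rewrite /rin linearZl_LR linearZr_LR. Qed.

Lemma rinZi H (x y : H) : rin ('i *: x) y = - rin x ('i *: y).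
Proof.
rewrite -rin_conjZ -rinNl -scaleNr; congr (rin (_ *: _) _).
by congr Complex; rewrite /= ?oppr0 ?opprK.
Qed.

(** The imaginary part of <x, y> is, up to sign, the real part of <x, i y>, so
    for complex linear operators the real identity implies the complex one. *)
Lemma adjoint_rin H K (T : bop H K) (S : bop K H) :
  adjoint_pair T S <-> forall x y, rin (T x) y = rin x (S y).
Proof.
split=> h x y; first by rewrite /rin h.
rewrite !inner_rin h; congr Complex.
by rewrite -[LHS]opprK -rinZi -linearZ h rinZi opprK.
Qed.

(** Riesz representation: f is a multiple of the inner product with the
    residue of the projection of a vector u, f u != 0, on the kernel of f. *)
Lemma real_riesz H (f : H -> R) (M : R) : (forall x y, f (x + y) = f x + f y) ->
  (forall (r : R) x, f (r%:C *: x) = r * f x) ->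
  (forall x, `|f x| <= M * hnorm x) -> exists z, forall x, f x = rin x z.
Proof.
move=> fD fZ fM.
have [f0|/existsNP[u /eqP fu]] := pselect (forall x, f x = 0).
  by exists 0 => x; rewrite rin0r.
have f0 : f 0 = 0 by have := fZ 0 0; rewrite scaler0 mul0r.
have fN x : f (- x) = - f x.
  have := fZ (-1) x; rewrite rmorphN /= scaleN1r mulN1r; exact.
have [|||p [q [[a [b [Sab ap _]]] orth]]] :=
  @pair_projection R H H [set s | f s.1 = 0 /\ s.2 = 0] u 0.
- by [].
- by move=> [x ?] [y ?] /= [fx ->] [fy ->]; rewrite fD fx fy !addr0.
- by move=> r [x ?] /= [fx ->]; rewrite fZ fx mulr0 scaler0.
have fp : f p = 0.
  apply/eqP; rewrite -normr_le0; apply/ler_addgt0Pl => e e0; rewrite addr0.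
  have M1 : 0 < `|M| + 1 by rewrite ltr_wpDl.
  have [N hN] := (convP _ _).1 ap _ (divr_gt0 e0 M1).
  have [/= fa _] := Sab N; have -> : f p = f (p - a N) by rewrite fD fN fa subr0.
  apply: le_trans (fM _) _; rewrite hnormB.
  have := hN N (leqnn _); rewrite ltr_pdivlMr// mulrC => /ltW h.
  apply: le_trans h; rewrite ler_wpM2r ?hnorm_ge0//.
  by rewrite (le_trans (ler_norm _))// lerDl.
have oz x : f x = 0 -> rin (u - p) x = 0.
  by move=> fx; have := orth x 0 (conj fx erefl); rewrite rin0r addr0.
set z := u - p in oz.
have fz : f z = f u by rewrite fD fN fp subr0.
have z0 : hnorm z ^+ 2 != 0.
  rewrite sqrf_eq0; apply: contra fu => /eqP /hnorm_eq0 z0.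
  by rewrite -fz z0 f0.
exists ((f z / hnorm z ^+ 2)%:C *: z) => x; rewrite rinZr.
have := oz (x - (f x / f z)%:C *: z).
rewrite fD fN fZ fz divfK// subrr => /(_ erefl) /eqP.
rewrite rinBr rinZr rinxx subr_eq0 rinC => /eqP ->.
move: (hnorm z ^+ 2) z0 => N N0; by field; rewrite fu N0.
Qed.

Lemma adjoint_bound H K (T : bop H K) (S : K -> H) (M : R) : 0 <= M ->
  (forall x y, rin (T x) y = rin x (S y)) ->
  (forall x, hnorm (T x) <= M * hnorm x) -> forall y, hnorm (S y) <= M * hnorm y.
Proof.
move=> M0 TS hM y; apply: le_of_sqr_le_mul; rewrite ?mulr_ge0 ?hnorm_ge0//.
rewrite -rinxx -TS (le_trans (ler_norm _))// (le_trans (rin_CS _ _))//.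
by rewrite mulrAC ler_wpM2r ?hnorm_ge0.
Qed.

Lemma adj_exists H K (T : bop H K) : exists S : bop K H, adjoint_pair T S.
Proof.
have [M M0 hM] := bop_bound T.
have /choice[S hS] y : exists z, forall x, rin (T x) y = rin x z.
  apply: (@real_riesz _ _ (M * hnorm y)).
  - by move=> x x'; rewrite linearD rinDl.
  - by move=> r x; rewrite linearZ rinZl.
  - move=> x; apply: le_trans (rin_CS _ _) _.
    by rewrite mulrAC ler_wpM2r ?hnorm_ge0.
have [|y|S' hS'] := @mk_bop R K H S M.
- move=> a x y; apply: rin_ext => z; rewrite rinC [RHS]rinC -hS.
  by rewrite !rinDr -!rin_conjZ -!hS linearZ.
- by apply: (adjoint_bound (ltW M0) _ hM) => x z; exact: hS.
by exists S'; apply/adjoint_rin => x y; rewrite hS hS'.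
Qed.

Definition adj H K (T : bop H K) : bop K H := sval (cid (adj_exists T)).

Lemma adjP H K (T : bop H K) : adjoint_pair T (adj T).
Proof. exact: svalP (cid (adj_exists T)). Qed.

Lemma rin_adjr H K (T : bop H K) x y : rin (T x) y = rin x (adj T y).
Proof. exact: (adjoint_rin _ _).1 (adjP T) x y. Qed.

Lemma rin_adjl H K (T : bop H K) x y : rin (adj T y) x = rin y (T x).
Proof. by rewrite rinC -rin_adjr rinC. Qed.

Lemma adj_uniq H K (T : bop H K) S : adjoint_pair T S -> S = adj T.
Proof.
move/adjoint_rin => h; apply: bop_ext => y; apply: rin_ext => x.
by rewrite rinC -h rin_adjr rinC.
Qed.

Lemma adjK H K (T : bop H K) : adj (adj T) = T.
Proof.
apply/esym/adj_uniq/adjoint_rin => x y; exact: rin_adjl.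
Qed.

Lemma adj_comp H K L (S : bop K L) (T : bop H K) : adj (S \ob T) = adj T \ob adj S.
Proof.
by apply/esym/adj_uniq/adjoint_rin => x y; rewrite !bopE !rin_adjr.
Qed.

Lemma hnorm_adj_le H K (T : bop H K) (M : R) : 0 <= M ->
  (forall x, hnorm (T x) <= M * hnorm x) -> forall y, hnorm (adj T y) <= M * hnorm y.
Proof. by move=> M0; apply: adjoint_bound => // x y; exact: rin_adjr. Qed.

End Adjoint.

(** * Positive operators *)

Section Positive.
Context (R : realType) (H : hilbertType R).
Implicit Types (S T G : bop H H).

Definition selfadj T := forall x y, rin (T x) y = rin x (T y).

Definition pos T := selfadj T /\ forall x, 0 <= rin (T x) x.

Lemma selfadjP T : adjoint_pair T T <-> selfadj T.
Proof. exact: adjoint_rin. Qed.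

Lemma selfadj_adj T : selfadj T -> adj T = T.
Proof. by move=> sT; apply/esym/adj_uniq/adjoint_rin. Qed.

Lemma selfadjB S T : selfadj S -> selfadj T -> selfadj (S - T).
Proof. by move=> sS sT x y; rewrite bopBE rinBl rinBr sS sT. Qed.

Lemma pos_id : pos bid.
Proof. by split=> [x y|x]; rewrite ?bidE// rinxx_ge0. Qed.

Lemma pos0 : pos 0.
Proof. by split=> [x y|x]; rewrite !bop0E ?rin0l ?rin0r. Qed.

Lemma posD S T : pos S -> pos T -> pos (S + T).
Proof.
move=> [sS pS] [sT pT]; split=> [x y|x].
  by rewrite !bopDE rinDl rinDr sS sT.
by rewrite bopDE rinDl addr_ge0.
Qed.

Lemma pos_square K (T : bop H K) : pos (adj T \ob T).
Proof.
by split=> [x y|x]; rewrite !bcompE rin_adjl ?rinxx_ge0// rin_adjr.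
Qed.

(** Cauchy-Schwarz for the semi-inner product <G x, y>. *)
Lemma pos_CS G x y : pos G -> rin (G x) y ^+ 2 <= rin (G x) x * rin (G y) y.
Proof.
move=> [sG pG]; apply: discriminant_le => // t.
have -> : rin (G x) x - 2 * t * rin (G x) y + t ^+ 2 * rin (G y) y =
    rin (G (x - t%:C *: y)) (x - t%:C *: y); last exact: pG.
rewrite bop_sub bop_scale !rinBl !rinBr !rinZl !rinZr.
by rewrite (sG y x) (rinC y (G x)); ring.
Qed.

(** This turns convergence of quadratic forms into norm convergence. *)
Lemma pos_hnorm_le G (c : R) : pos G -> 0 <= c ->
  (forall x, rin (G x) x <= c * hnorm x ^+ 2) ->
  forall x, hnorm (G x) ^+ 2 <= c * rin (G x) x.
Proof.
move=> pG c0 Gc x; have := pos_CS x (G x) pG; rewrite rinxx.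
set N := hnorm (G x) ^+ 2 => h; apply: le_of_sqr_le_mul; first exact: sqr_ge0.
  by rewrite mulr_ge0// pG.2.
apply: le_trans h _; rewrite [c * _]mulrC -mulrA.
by rewrite ler_wpM2l ?pG.2// Gc.
Qed.

Lemma rin_bound T : exists2 M : R, 0 < M & forall x, `|rin (T x) x| <= M * hnorm x ^+ 2.
Proof.
have [M M0 hM] := bop_bound T; exists M => // x.
by rewrite (le_trans (rin_CS _ _))// expr2 mulrA ler_wpM2r ?hnorm_ge0.
Qed.

(** Monotone convergence: for m <= n the operator G m - G n is positive, hence
    |(G m - G n) x| is controlled by a difference of terms of the convergent real
    sequence <G n x, x>. *)
Lemma decreasing_limit (G : nat -> bop H H) : (forall n, pos (G n)) ->
  (forall n x, rin (G n.+1 x) x <= rin (G n x) x) ->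
  exists g, [/\ pos g, forall x, conv (fun n => G n x) (g x) &
    forall n x, rin (g x) x <= rin (G n x) x].
Proof.
move=> pG dG.
have dGmn m n x : (m <= n)%N -> rin (G n x) x <= rin (G m x) x.
  elim: n => [|n IH]; first by rewrite leqn0 => /eqP ->.
  rewrite leq_eqVlt => /orP[/eqP -> //|/IH h]; exact: le_trans (dG _ _) h.
have [M M0 hM] := rin_bound (G 0%N).
have diff m n x : hnorm (G m x - G n x) ^+ 2 <= M * `|rin (G m x) x - rin (G n x) x|.
  wlog mn : m n / (m <= n)%N.
    by move=> h; have /orP[/h//|/h] := leq_total m n; rewrite hnormB distrC.
  have pD : pos (G m - G n).
    split; first exact: selfadjB (pG m).1 (pG n).1.
    by move=> z; rewrite bopBE rinBl subr_ge0 dGmn.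
  rewrite ger0_norm ?subr_ge0 ?dGmn// -rinBl -bopBE.
  apply: (pos_hnorm_le pD (ltW M0)) => z.
  rewrite bopBE rinBl; apply: le_trans (_ : rin (G 0%N z) z <= _).
    have := dGmn 0%N m z isT; have := (pG n).2 z; lra.
  by rewrite (le_trans (ler_norm _)).
have cvr x : exists l, (fun n => rin (G n x) x) @ \oo --> (l : R).
  apply/cvg_ex/nonincreasing_is_cvgn.
    by move=> m n; exact: dGmn.
  by exists 0 => _ [n _ <-]; exact: (pG n).2.
have /choice[g hg] x : exists l, conv (fun n => G n x) l.
  have [l hl] := cvr x.
  apply: (@cauchy_sqr_conv _ _ _ (fun n => M * `|rin (G n x) x - l|)) => [m n|].
    apply: le_trans (diff m n x) _; rewrite -mulrDr ler_pM2l//.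
    by rewrite -[X in `|X|](subrKA l) (le_trans (ler_normD _ _))// lerD2l distrC.
  rewrite -[0](mulr0 M); apply: cvgMl_tmp; rewrite -(normr0 R).
  by apply: cvg_norm; rewrite -(subrr l); apply: cvgB => //; exact: cvg_cst.
have [B B0 hB] := bop_bound (G 0%N).
have gle n x : rin (g x) x <= rin (G n x) x.
  have c := conv_rin (y:=x) (hg x); rewrite -(cvg_lim _ c)//.
  apply: limr_le; first by apply/cvg_ex; eexists; exact: c.
  by exists n => // m /= nm; exact: dGmn.
have [||g' hg'] := @mk_bop R H H g (M + B).
- move=> a x y; apply: conv_unique (hg _) _.
  apply: (conv_eq (fun n => linearP (G n) a x y)).
  exact: convD (convZ a (hg x)) (hg y).
- move=> x; have c := conv_hnorm (hg x).
  rewrite -(cvg_lim _ c)//; apply: limr_le; first by apply/cvg_ex; eexists; exact: c.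
  apply: nearW => n.
  have h1 : hnorm (G n x - G 0%N x) <= M * hnorm x.
    rewrite -(@ler_sqr R) ?nnegrE ?mulr_ge0 ?hnorm_ge0 ?(ltW M0)//.
    rewrite (le_trans (diff _ _ _))// exprMn expr2 -mulrA ler_pM2l//.
    rewrite distrC ger0_norm ?subr_ge0 ?dGmn//.
    rewrite (le_trans _ (le_trans (ler_norm _) (hM x)))// gerDl oppr_le0.
    exact: (pG n).2.
  have := ler_hnormD (G n x - G 0%N x) (G 0%N x); rewrite subrK.
  rewrite mulrDl; have := hB x; lra.
exists g'; split.
- split=> [x y|x]; rewrite !hg'.
    have c1 := conv_rin (y:=y) (hg x); have c2 := conv_rin (y:=x) (hg y).
    have e : (fun n => rin (G n x) y) = (fun n => rin (G n y) x).
      by apply/funext => n; rewrite (pG n).1 rinC.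
    by rewrite e in c1; rewrite (rinC x); exact: (cvg_unique (@Rhausdorff R) c1 c2).
  have c := conv_rin (y:=x) (hg x); rewrite -(cvg_lim _ c)//.
  apply: limr_ge; first by apply/cvg_ex; eexists; exact: c.
  by apply: nearW => n; exact: (pG n).2.
- by move=> x; rewrite hg'; exact: hg.
- by move=> n x; rewrite hg'; exact: gle.
Qed.

(** The operator T = 1 + S satisfies |x| <= |T x|, so its range is closed; it
    is selfadjoint, so a vector orthogonal to its range is in its kernel, which is
    0. Hence T is onto. *)
Lemma resolvent S : pos S -> exists Q, [/\ pos Q,
  forall x, Q x + S (Q x) = x, forall x, Q (x + S x) = x &
  forall x, rin (Q x) x <= hnorm x ^+ 2].
Proof.
move=> [sS pS]; pose T x := x + S x.
have TD x y : T (x - y) = T x - T y by rewrite /T linearB opprD addrACA.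
have T_ge x : hnorm x <= hnorm (T x).
  apply: le_of_sqr_le_mul; rewrite ?hnorm_ge0//.
  apply: le_trans (le_trans (ler_norm _) (rin_CS (T x) x)).
  by rewrite /T rinDl rinxx lerDl.
have sT x y : rin (T x) y = rin x (T y) by rewrite /T rinDl rinDr sS.
have /choice[f Tf] x : exists w, T w = x.
  have [|||p [q [[a [b [Sab ap _]]] orth]]] :=
    @pair_projection R H H [set s | exists w, s = (T w, 0)] x 0.
  - by exists 0; rewrite /T linear0 addr0.
  - move=> _ _ [w ->] [w' ->]; exists (w + w').
    by rewrite /T linearD /= addr0 addrACA.
  - move=> r _ [w ->]; exists (r%:C *: w).
    by rewrite /T linearZ /= scaler0 scalerDr.
  have /choice[w hw] n : exists w, a n = T w.
    by have [w [-> _]] := Sab n; exists w.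
  have [l wl] : exists l, conv w l.
    apply: cauchy_conv => e e0; have e2 : 0 < e / 2 by rewrite divr_gt0.
    have [N hN] := (convP _ _).1 ap _ e2; exists N => m n Nm Nn.
    apply: le_lt_trans (T_ge _) _; rewrite TD -!hw.
    have := hN m Nm; have := hN n Nn; rewrite (hnormB (a n)).
    have := hnorm_triangle p (a m) (a n); lra.
  have pl : p = T l.
    apply: conv_unique ap _; rewrite (_ : a = fun n => w n + S (w n)).
      by apply: convD => //; exact: conv_bop.
    by apply/funext => n; rewrite hw.
  exists l; rewrite -pl; apply/eqP; rewrite eq_sym -subr_eq0; apply/eqP.
  have : T (x - p) = 0.
    apply: rin_eq0_all => y; rewrite sT.
    by have := orth (T y) 0 (ex_intro _ y erefl); rewrite rin0r addr0.
  move=> T0; apply: hnorm_eq0; apply/eqP; rewrite eq_le hnorm_ge0 andbT.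
  by rewrite (le_trans (T_ge _))// T0 hnorm0.
have Tinj x y : T x = T y -> x = y.
  move=> xy; apply/eqP; rewrite -subr_eq0; apply/eqP/hnorm_eq0/eqP.
  by rewrite eq_le hnorm_ge0 andbT (le_trans (T_ge _))// TD xy subrr hnorm0.
have [||Q hQ] := @mk_bop R H H f 1.
- move=> a x y; apply: Tinj; rewrite Tf /T linearP.
  rewrite addrACA -scalerDr; congr (_ *: _ + _); exact/esym/Tf.
- by move=> x; rewrite mul1r (le_trans (T_ge _))// Tf.
exists Q; split.
- split=> [x y|x]; rewrite !hQ.
    by rewrite -{2}(Tf x) sT Tf.
  by rewrite -{2}(Tf x) /T rinDr addr_ge0 ?rinxx_ge0// rinC.
- by move=> x; rewrite hQ; exact: Tf.
- by move=> x; rewrite hQ; apply: Tinj; rewrite Tf.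
- move=> x; rewrite hQ -{2 3}(Tf x); set w := f x.
  rewrite /T rinDr rinxx hnormD_sqr; have := pS w; rewrite rinC.
  by have := sqr_ge0 (hnorm (S w)); lra.
Qed.

(** Positivity from invertibility alone, which *-isomorphisms preserve. If the
    infimum m of <S x, x> on the unit sphere were negative, then S - m would be
    positive and, being a multiple of 1 - m^-1 S, bounded below in norm. By
    pos_hnorm_le its quadratic form would be bounded away from 0 on the sphere, and
    m would not be the infimum. *)
Lemma pos_of_inverses S : selfadj S ->
  (forall c : R, 0 < c -> exists Q : bop H H, forall x, Q (x + c%:C *: S x) = x) ->
  pos S.
Proof.
move=> sS hS; split=> // x0; rewrite leNgt; apply/negP => Sx0.
pose E := [set rin (S x) x | x in [set x : H | hnorm x = 1]].
have [M M0 hM] := rin_bound S.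
have nz : hnorm x0 != 0.
  by apply: contraTneq Sx0 => /hnorm_eq0 ->; rewrite rin0r ltxx.
have np : 0 < hnorm x0 by rewrite lt_neqAle eq_sym nz hnorm_ge0.
have normal x : hnorm x != 0 -> hnorm ((hnorm x)^-1%:C *: x) = 1.
  by move=> x1; rewrite hnormZr ger0_norm ?invr_ge0 ?hnorm_ge0// mulVf.
have normalE x : rin (S ((hnorm x)^-1%:C *: x)) ((hnorm x)^-1%:C *: x) =
    rin (S x) x / hnorm x ^+ 2.
  by rewrite bop_scale rinZl rinZr mulrA -expr2 exprVn mulrC.
have hi : has_inf E.
  split; first by eexists; exists ((hnorm x0)^-1%:C *: x0) => //; exact: normal.
  exists (- M) => _ [x /= x1 <-]; rewrite lerNl.
  by have := hM x; rewrite x1 expr1n mulr1; apply: le_trans; rewrite -normrN ler_norm.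
pose m := inf E.
have mE x : m * hnorm x ^+ 2 <= rin (S x) x.
  have [x1|x1] := eqVneq (hnorm x) 0.
    by rewrite x1 expr0n mulr0 (hnorm_eq0 x1) rin0r.
  have xp : 0 < hnorm x by rewrite lt_neqAle eq_sym x1 hnorm_ge0.
  rewrite -ler_pdivlMr ?exprn_gt0// -normalE; apply: ge_inf; first exact: hi.2.
  by exists ((hnorm x)^-1%:C *: x); first exact: normal.
have m0 : m < 0.
  apply: le_lt_trans (_ : rin (S x0) x0 / hnorm x0 ^+ 2 < 0).
    by rewrite ler_pdivlMr ?exprn_gt0.
  by rewrite pmulr_llt0// invr_gt0 exprn_gt0.
have c0 : 0 < - m^-1 by rewrite oppr_gt0 invr_lt0.
have [Q hQ] := hS _ c0; have [B B0 hB] := bop_bound Q.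
pose T := S - m%:C *: bid.
have TE x : T x = S x - m%:C *: x by [].
have pT : pos T.
  split=> [x y|x]; first by rewrite !TE rinBl rinBr rinZl rinZr sS.
  by rewrite TE rinBl rinZl rinxx subr_ge0.
have Mm : 0 < M - m by rewrite subr_gt0 (lt_trans m0).
have hT := @pos_hnorm_le T (M - m) pT (ltW Mm) _.
have {}hT x : hnorm (T x) ^+ 2 <= (M - m) * rin (T x) x.
  apply: hT => y; rewrite TE rinBl rinZl rinxx mulrBl lerD2r.
  by rewrite (le_trans (ler_norm _)).
have QT x : x = Q ((- m^-1)%:C *: T x).
  rewrite TE scalerBr scalerA -rmorphM /= mulNr mulVf ?lt_eqF//.
  by rewrite rmorphN1 scaleN1r opprK addrC hQ.
pose k := (B * - m^-1) ^+ 2 * (M - m).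
have k0 : 0 < k by rewrite mulr_gt0// exprn_gt0// mulr_gt0.
have lower x : hnorm x = 1 -> m + k^-1 <= rin (S x) x.
  move=> x1; have h : 1 <= k * rin (T x) x.
    rewrite -(expr1n _ 2) -x1 {1}(QT x); apply: le_trans (_ : (B * - m^-1 * hnorm (T x)) ^+ 2 <= _).
      rewrite ler_sqr ?nnegrE ?hnorm_ge0 ?mulr_ge0 ?hnorm_ge0 ?(ltW B0) ?(ltW c0)//.
      by rewrite (le_trans (hB _))// hnormZr gtr0_norm// mulrA.
    by rewrite exprMn /k -[leRHS]mulrA ler_wpM2l ?sqr_ge0.
  have : k^-1 <= rin (T x) x by rewrite -[leLHS]mul1r ler_pdivrMr// mulrC.
  by rewrite TE rinBl rinZl rinxx x1 expr1n mulr1 lerBrDl.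
have := @inf_adherent R E k^-1; rewrite invr_gt0 => /(_ k0 hi)[_ [x /= x1 <-]].
by rewrite ltNge lower.
Qed.

End Positive.

(** * The projection onto a subspace of pairs as an operator *)

Lemma scale_residue (R : realType) (V : lmodType R[i]) (c : R[i]) (x p y q r : V) :
  -1 *: (c *: (x - p) + (y - q)) + (c *: x + y - r) = c *: p + q - r.
Proof.
rewrite scaleN1r scalerBr (addrACA (c *: x)) -opprD opprB addrA subrK.
by [].
Qed.

Section PairProjector.
Context (R : realType) (K1 K2 : hilbertType R).

Definition pair_closure (S : set (K1 * K2)) p q :=
  exists a b, [/\ forall n : nat, S (a n, b n), conv a p & conv b q].

Definition pair_perp (S : set (K1 * K2)) x y :=
  forall a b, S (a, b) -> rin x a + rin y b = 0.

Lemma pair_perp_closure (S : set (K1 * K2)) x y p q :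
  pair_perp S x y -> pair_closure S p q -> rin x p + rin y q = 0.
Proof.
move=> xS [a [b [Sab ap bq]]].
have h : (fun n => rin (a n) x + rin (b n) y) @ \oo --> rin p x + rin q y.
  by apply: cvgD; exact: conv_rin.
rewrite (_ : (fun n => _) = cst 0) in h; last first.
  by apply/funext => n; rewrite (rinC _ x) (rinC _ y) xS.
rewrite rinC (rinC y).
exact: (cvg_unique (@Rhausdorff R) h (cvg_cst _)).
Qed.

Lemma pair_perp_closure0 S x y : pair_perp S x y -> pair_closure S x y ->
  x = 0 /\ y = 0.
Proof.
move=> xS cS; have := pair_perp_closure xS cS.
have := rinxx_ge0 x; have := rinxx_ge0 y => y0 x0 h.
by split; apply: rinxx_eq0; apply/eqP; rewrite eq_le ?x0 ?y0 andbT; lra.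
Qed.

Definition pair_subspace (S : set (K1 * K2)) :=
  S (0, 0) /\ forall (c : R[i]) p q, S p -> S q ->
    S (c *: p.1 + q.1, c *: p.2 + q.2).

(** P and Q are the first column of the matrix of the projection onto the
    closure of S in the direct sum of K1 and K2. *)
Lemma pair_projector S : pair_subspace S ->
  exists (P : bop K1 K1) (Q : bop K1 K2), forall u,
    pair_closure S (P u) (Q u) /\ pair_perp S (u - P u) (- Q u).
Proof.
move=> [S0 SL].
have clL (c : R[i]) p q p' q' : pair_closure S p q -> pair_closure S p' q' ->
    pair_closure S (c *: p + p') (c *: q + q').
  move=> [a [b [Sab ap bq]]] [a' [b' [Sab' ap' bq']]].
  exists (fun n => c *: a n + a' n), (fun n => c *: b n + b' n); split.
  - by move=> n; exact: SL (Sab n) (Sab' n).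
  - by apply: convD => //; exact: convZ.
  - by apply: convD => //; exact: convZ.
have peL (c : R[i]) p q p' q' : pair_perp S p q -> pair_perp S p' q' ->
    pair_perp S (c *: p + p') (c *: q + q').
  move=> h h' a b Sab; rewrite !rinDl.
  have /= Sc := SL (c^*%C) _ _ Sab S0; rewrite !addr0 in Sc.
  have := h _ _ Sc; rewrite -!rin_conjZ conjcK => e.
  have := h' _ _ Sab; lra.
have /choice[f hf] u : exists pq : K1 * K2,
    pair_closure S pq.1 pq.2 /\ pair_perp S (u - pq.1) (- pq.2).
  have [|||p [q [cl orth]]] := @pair_projection R K1 K2 S u 0; first exact: S0.
  - by move=> x y Sx Sy; have := SL 1 _ _ Sx Sy; rewrite !scale1r.
  - by move=> r x Sx; have := SL r%:C _ _ Sx S0; rewrite /= !addr0.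
  by exists (p, q); split=> // a b Sab; rewrite -[- q]sub0r orth.
have fL (c : R[i]) x y : (f (c *: x + y)).1 = c *: (f x).1 + (f y).1 /\
    (f (c *: x + y)).2 = c *: (f x).2 + (f y).2.
  have [clx pex] := hf x; have [cly pey] := hf y; have [clz pez] := hf (c *: x + y).
  have cl := clL (-1) _ _ _ _ clz (clL c _ _ _ _ clx cly).
  have pe := peL (-1) _ _ _ _ (peL c _ _ _ _ pex pey) pez.
  have [||e1 e2] := @pair_perp_closure0 S (c *: (f x).1 + (f y).1 - (f (c *: x + y)).1)
     (c *: (f x).2 + (f y).2 - (f (c *: x + y)).2).
  - move: pe; rewrite scale_residue; congr (pair_perp _ _ _).
    by rewrite scaleN1r opprD scalerN !opprK.
  - by move: cl; rewrite !scaleN1r ![- _ + _]addrC.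
  by split; apply/esym/eqP; rewrite -subr_eq0 ?e1 ?e2.
have bd u : hnorm (f u).1 <= hnorm u /\ hnorm (f u).2 <= hnorm u.
  have [cl pe] := hf u; have := pair_perp_closure pe cl.
  rewrite rinBl rinNl !rinxx => e; have := rin_CS u (f u).1.
  move/(le_trans (ler_norm _)) => h.
  have := hnorm_ge0 u; have := hnorm_ge0 (f u).1; have := hnorm_ge0 (f u).2.
  move: (hnorm u) (hnorm (f u).1) (hnorm (f u).2) e h => a b c e h c0 b0 a0.
  have ab : b <= a.
    rewrite leNgt; apply/negP => ab; have : a * b < b ^+ 2.
      by rewrite expr2 ltr_pM2r// (le_lt_trans a0).
    have := sqr_ge0 c; lra.
  split=> //; rewrite -(@ler_sqr R)//; have : a * b <= a ^+ 2 by rewrite expr2 ler_wpM2l.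
  have := sqr_ge0 b; lra.
have [||P hP] := @mk_bop R K1 K1 (fun u => (f u).1) 1.
- by move=> c x y; exact: (fL c x y).1.
- by move=> x; rewrite mul1r; exact: (bd x).1.
have [||Q hQ] := @mk_bop R K1 K2 (fun u => (f u).2) 1.
- by move=> c x y; exact: (fL c x y).2.
- by move=> x; rewrite mul1r; exact: (bd x).2.
by exists P, Q => u; rewrite hP hQ; exact: hf.
Qed.

End PairProjector.

(** * Intertwiners of a *-algebra of pairs *)

Section Intertwiners.
Context (R : realType).
Implicit Types K : hilbertType R.

(** A *-homomorphism or a *-isomorphism is handled through its graph, a set G
    of pairs (a, b). This keeps the two sides symmetric: reversing the
    isomorphism is swapping the pairs. *)
Definition star_subalgebra K1 K2 (G : set (bop K1 K1 * bop K2 K2)) :=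
  [/\ G (bid, bid),
      forall (c : R[i]) p q, G p -> G q -> G (c *: p.1 + q.1, c *: p.2 + q.2),
      forall p q, G p -> G q -> G (p.1 \ob q.1, p.2 \ob q.2) &
      forall p, G p -> G (adj p.1, adj p.2)].

Definition itw K1 K2 (G : set (bop K1 K1 * bop K2 K2)) (T : bop K1 K2) :=
  forall a b, G (a, b) -> forall x, T (a x) = b (T x).

(** The common kernel of the intertwiners. When it is everything, the two
    representations of G are disjoint. *)
Definition itw_null K1 K2 (G : set (bop K1 K1 * bop K2 K2)) (x : K1) :=
  forall T, itw G T -> T x = 0.

(** Disjoint representations can be separated. The projection onto the closure
    of {(a xi, b eta)} commutes with all (a, b) in G, so its corner Q from K1 to K2
    is an intertwiner and kills xi. Then xi - P xi is orthogonal both to xi and to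
    P xi; thus P xi = xi, and (xi, 0) is in the closure. *)
Lemma itw_null_approx K1 K2 (G : set (bop K1 K1 * bop K2 K2)) xi eta (e : R) :
  star_subalgebra G -> itw_null G xi -> 0 < e ->
  exists a b, [/\ G (a, b), hnorm (a xi - xi) < e & hnorm (b eta) < e].
Proof.
move=> [G1 GL GM GA] nxi e0.
pose S : set (K1 * K2) := 
  [set s | exists a b, G (a, b) /\ s = (a xi, b eta)].
have G0 : G (0, 0) by have := GL (-1) _ _ G1 G1; rewrite /= !scaleN1r !addNr.
have sS : pair_subspace S.
  split; first by exists 0, 0.
  move=> c _ _ [a [b [Gab ->]]] [a' [b' [Gab' ->]]].
  by exists (c *: a + a'), (c *: b + b'); split=> //; exact: GL Gab Gab'.
have [P [Q hPQ]] := pair_projector sS.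
have iQ : itw G Q.
  move=> a b Gab u; have [cl pe] := hPQ u; have [cl' pe'] := hPQ (a u).
  apply/eqP; rewrite -subr_eq0; apply/eqP.
  apply: (@pair_perp_closure0 _ _ _ S (P (a u) - a (P u)) (Q (a u) - b (Q u)) _ _).2.
  - move=> x y Sxy; have := pe' x y Sxy.
    case: (Sxy) => a' [b' [Gab' [ex ey]]].
    have Sa : S (adj a x, adj b y).
      exists (adj a \ob a'), (adj b \ob b'); split; first exact: GM (GA _ Gab) Gab'.
      by rewrite ex ey.
    have := pe _ _ Sa; rewrite -!rin_adjr bop_sub bop_opp !rinBl !rinNl; lra.
  - case: cl => x [y [Sxy xP yQ]]; case: cl' => x' [y' [Sxy' xP' yQ']].
    exists (fun n => x' n - a (x n)), (fun n => y' n - b (y n)); split.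
    + move=> n; have [c [d [Gcd [-> ->]]]] := Sxy n.
      have [c' [d' [Gcd' [-> ->]]]] := Sxy' n.
      exists ((-1) *: (a \ob c) + c'), ((-1) *: (b \ob d) + d'); split.
        exact: GL (GM _ _ Gab Gcd) Gcd'.
      by rewrite !bopE !scaleN1r (addrC (- a _)) (addrC (- b _)).
    + by apply: convB => //; exact: conv_bop.
    + by apply: convB => //; exact: conv_bop.
have [cl pe] := hPQ xi; rewrite (nxi Q iQ) oppr0 in cl pe.
have xiP : xi = P xi.
  apply/eqP; rewrite -subr_eq0; apply/eqP/rinxx_eq0; rewrite rinBr.
  have := pair_perp_closure pe cl; rewrite rin0l addr0 => ->; rewrite subr0.
  have : S (xi, eta) by exists bid, bid.
  by move/pe; rewrite rin0l addr0.
rewrite -xiP in cl; case: cl => a [b [Sab /convP/(_ e e0)[N hN] /convP/(_ e e0)[N' hN']]].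
have [c [d [Gcd [pa pb]]]] := Sab (maxn N N').
exists c, d; split=> //; first by rewrite -pa hN// leq_maxl.
by have := hN' _ (leq_maxr N N'); rewrite subr0 pb.
Qed.

End Intertwiners.

(** * The space l2 H and amplified operators *)

Section L2Tools.
Context (R : realType).
Implicit Types H K : hilbertType R.

Lemma l2_ext H (x y : l2 H) : (forall n, x n = y n) -> x = y.
Proof. by move=> h; apply/val_inj/funext. Qed.

Lemma l2DE H (x y : l2 H) n : (x + y) n = x n + y n. Proof. by []. Qed.
Lemma l2BE H (x y : l2 H) n : (x - y) n = x n - y n. Proof. by []. Qed.
Lemma l2ZE H a (x : l2 H) n : (a *: x) n = a *: x n. Proof. by []. Qed.
Lemma l20E H n : (0 : l2 H) n = 0. Proof. by []. Qed.

Lemma l2_rin_cvg H (x y : l2 H) :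
  series (fun n => rin (x n) (y n)) @ \oo --> rin x y.
Proof. exact: (l2_csummable x y).1. Qed.

Lemma l2_hnorm_cvg H (x : l2 H) :
  series (fun n => hnorm (x n) ^+ 2) @ \oo --> hnorm x ^+ 2.
Proof.
rewrite -rinxx; have := l2_rin_cvg (x := x) (y := x).
by under eq_fun do rewrite rinxx.
Qed.

Lemma l2_hnorm_coord H (x : l2 H) n : hnorm (x n) <= hnorm x.
Proof. by rewrite -lecR -!hnormE l2_coord_norm_le. Qed.

Lemma l2_hnorm_le H (x : l2 H) (e : R) : 0 <= e ->
  (forall n, \sum_(0 <= i < n) hnorm (x i) ^+ 2 <= e ^+ 2) -> hnorm x <= e.
Proof. by move=> e0 h; rewrite -lecR -hnormE l2_norm_le_sum. Qed.

Lemma l2_partial_sum_le H (x : l2 H) n :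
  \sum_(0 <= i < n) hnorm (x i) ^+ 2 <= hnorm x ^+ 2.
Proof.
apply: le_trans (l2_sum_le x n) _.
by rewrite (cvg_lim _ (l2_hnorm_cvg (x := x))).
Qed.

Lemma mk_l2 H (f : nat -> H) (e : R) : 0 <= e ->
  (forall n, \sum_(0 <= i < n) hnorm (f i) ^+ 2 <= e ^+ 2) ->
  exists x : l2 H, (forall n, x n = f n) /\ hnorm x <= e.
Proof.
move=> e0 h; have sf : f \in @l2_pred R H.
  apply/asboolP; apply: nondecreasing_is_cvgn.
    by apply: nondecreasing_series => i _ _; exact: sqr_ge0.
  by exists (e ^+ 2) => _ [n _ <-]; exact: h.
by exists (L2Seq sf); split=> //; exact: l2_hnorm_le.
Qed.

Lemma l2coord_exists H n : exists T : bop (l2 H) H, forall x : l2 H, T x = x n.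
Proof.
apply: (@mk_bop R (l2 H) H (fun x : l2 H => x n) 1) => // x.
by rewrite mul1r l2_hnorm_coord.
Qed.

Definition l2coord H n : bop (l2 H) H := sval (cid (l2coord_exists H n)).

Lemma l2coordE H n (x : l2 H) : l2coord H n x = x n.
Proof. exact: svalP (cid (l2coord_exists H n)) x. Qed.

Lemma conv_coord H (u : nat -> l2 H) l n : conv u l -> conv (fun k => u k n) (l n).
Proof.
move=> ul; rewrite -l2coordE; apply: (conv_eq (v := fun k => l2coord H n (u k))).
  by move=> k; rewrite l2coordE.
exact: conv_bop.
Qed.

Definition l2inj H n : bop H (l2 H) := adj (l2coord H n).

Lemma rin_l2inj H n x (y : l2 H) : rin (l2inj H n x) y = rin x (y n).
Proof. by rewrite /l2inj rin_adjl l2coordE. Qed.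

Lemma l2injE H n x m : l2inj H n x m = if m == n then x else 0.
Proof.
pose f k := if k == n then x else 0.
have [|k|z [hz _]] := @mk_l2 H f (hnorm x); first exact: hnorm_ge0.
  elim: k => [|k IH]; first by rewrite big_geq// sqr_ge0.
  have [kn|nk] := leqP k n; last first.
    by rewrite big_nat_recr//= /f gtn_eqF// hnorm0 expr0n addr0.
  rewrite big_nat_recr//= big1_seq ?add0r => [|i]; last first.
    rewrite mem_index_iota => /andP[_ /andP[_ ik]].
    by rewrite /f ltn_eqF ?hnorm0 ?expr0n// (leq_trans ik).
  by rewrite /f; case: eqP; rewrite ?hnorm0 ?expr0n ?sqr_ge0.
suff -> : l2inj H n x = z by rewrite hz.
apply: rin_ext => y; rewrite rin_l2inj.
have h := l2_rin_cvg (x := z) (y := y).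
have h' : series (fun k => rin (z k) (y k)) @ \oo --> rin x (y n).
  apply/cvgrPdist_lt => e e0; exists n.+1 => // k /= nk.
  rewrite /series /= (bigD1_seq n) ?mem_index_iota ?iota_uniq//=.
  rewrite hz /f eqxx big1 ?addr0 ?subrr ?normr0// => i /negbTE ni.
  by rewrite hz /f ni rin0l.
exact: (cvg_unique (@Rhausdorff R) h' h).
Qed.

Lemma l2inj_hnorm H n x : hnorm (l2inj H n x) = hnorm x.
Proof.
apply/eqP; rewrite -(@eqrXn2 _ 2) ?hnorm_ge0//.
by rewrite -!rinxx rin_l2inj l2injE eqxx.
Qed.

Lemma sum_l2injE H (x : l2 H) n m :
  (\sum_(0 <= i < n) l2inj H i (x i)) m = if (m < n)%N then x m else 0.
Proof.
elim: n => [|n IH]; first by rewrite big_geq.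
rewrite big_nat_recr// l2DE IH l2injE ltnS (leq_eqVlt m n).
by case: ltngtP => [_|_|->]; rewrite ?addr0 ?add0r.
Qed.

Lemma l2_conv_inj H (x : l2 H) : conv (fun n => \sum_(0 <= i < n) l2inj H i (x i)) x.
Proof.
apply/convP => e e0; have e2 : 0 < e ^+ 2 by rewrite exprn_gt0.
have /cvgrPdist_lt/(_ _ e2)[N _ hN] := l2_hnorm_cvg (x := x).
exists N => // n Nn; rewrite hnormB -(@ltr_sqr R) ?nnegrE ?hnorm_ge0 ?(ltW e0)//.
set s := \sum_(0 <= i < n) _.
have rs (y : l2 H) : rin s y = \sum_(0 <= i < n) rin (x i) (y i).
  rewrite /s; elim: n {Nn s} => [|n IH]; first by rewrite !big_geq// rin0l.
  by rewrite !big_nat_recr//= rinDl IH rin_l2inj.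
have sE i : (i < n)%N -> s i = x i by rewrite /s sum_l2injE => ->.
have ss : hnorm s ^+ 2 = \sum_(0 <= i < n) hnorm (x i) ^+ 2.
  rewrite -rinxx rs big_nat [RHS]big_nat; apply: eq_bigr => i /andP[_ ni].
  by rewrite sE// rinxx.
rewrite hnormB_sqr rinC ss rs.
have -> : \sum_(0 <= i < n) rin (x i) (x i) = \sum_(0 <= i < n) hnorm (x i) ^+ 2.
  by apply: eq_bigr => i _; rewrite rinxx.
have := hN n Nn; rewrite /series /= => h.
by apply: le_lt_trans h; rewrite -[leRHS]ger0_norm// ?normr_id//; rewrite (le_trans _ (ler_norm _))//; lra.
Qed.

Lemma amp_exists H K (A : bop H K) : exists T : bop (l2 H) (l2 K),
  forall (x : l2 H) n, T x n = A (x n).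
Proof.
have [M M0 hM] := bop_bound A.
have /choice[f hf] (x : l2 H) : exists y : l2 K,
    (forall n, y n = A (x n)) /\ hnorm y <= M * hnorm x.
  apply: (@mk_l2 K (fun n => A (x n))); first by rewrite mulr_ge0 ?hnorm_ge0 ?ltW.
  move=> n; rewrite exprMn; apply: le_trans (ler_wpM2l (sqr_ge0 M) (l2_partial_sum_le x n)).
  rewrite mulr_sumr; apply: ler_sum => i _; rewrite -exprMn.
  by rewrite ler_sqr ?nnegrE ?mulr_ge0 ?hnorm_ge0 ?(ltW M0).
have [||T hT] := @mk_bop R (l2 H) (l2 K) f M.
- move=> a x y; apply: l2_ext => n.
  by rewrite l2DE l2ZE !(hf _).1 l2DE l2ZE bop_add bop_scale.
- by move=> x; exact: (hf x).2.
by exists T => x n; rewrite hT (hf x).1.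
Qed.

(** The operator A tensor 1, that is, A acting in every coordinate. *)
Definition amp H K (A : bop H K) : bop (l2 H) (l2 K) := sval (cid (amp_exists A)).

Lemma ampE H K (A : bop H K) (x : l2 H) n : amp A x n = A (x n).
Proof. exact: svalP (cid (amp_exists A)) x n. Qed.

Lemma amp_inj H K (A : bop H K) n x : amp A (l2inj H n x) = l2inj K n (A x).
Proof.
by apply: l2_ext => m; rewrite ampE !l2injE; case: eqP; rewrite ?bop_zero.
Qed.

Lemma amp_adj H K (A : bop H K) : adj (amp A) = amp (adj A).
Proof.
apply/esym/adj_uniq/adjoint_rin => x y.
have h := l2_rin_cvg (x := amp A x) (y := y).
have h' := l2_rin_cvg (x := x) (y := amp (adj A) y).
have e : (fun n => rin (amp A x n) (y n)) = (fun n => rin (x n) (amp (adj A) y n)).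
  by apply/funext => n; rewrite !ampE rin_adjr.
rewrite e in h; exact: (cvg_unique (@Rhausdorff R) h h').
Qed.

Lemma amp_selfadj H (A : bop H H) : selfadj (amp A) -> selfadj A.
Proof.
move=> h x y; have := h (l2inj H 0 x) (l2inj H 0 y).
by rewrite !amp_inj !rin_l2inj !l2injE.
Qed.

End L2Tools.

(** * Separation by selfadjoint elements *)

Section Amplification.
Context (R : realType).
Implicit Types K : hilbertType R.

Definition amp_pairs K1 K2 (G : set (bop K1 K1 * bop K2 K2)) :
  set (bop (l2 K1) (l2 K1) * bop (l2 K2) (l2 K2)) :=
  [set (amp p.1, amp p.2) | p in G].

Lemma amp_star_subalgebra K1 K2 (G : set (bop K1 K1 * bop K2 K2)) :
  star_subalgebra G -> star_subalgebra (amp_pairs G).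
Proof.
move=> [G1 GL GM GA]; split.
- exists (bid, bid) => //.
  by congr pair; apply: bop_ext => x; apply: l2_ext => n; rewrite ampE.
- move=> c _ _ [p Gp <-] [q Gq <-]; exists (c *: p.1 + q.1, c *: p.2 + q.2).
    exact: GL.
  by congr pair; apply: bop_ext => x; apply: l2_ext => n;
    rewrite bopDE bopZE l2DE l2ZE !ampE.
- move=> _ _ [p Gp <-] [q Gq <-]; exists (p.1 \ob q.1, p.2 \ob q.2).
    exact: GM.
  by congr pair; apply: bop_ext => x; apply: l2_ext => n;
    rewrite bcompE !ampE.
- move=> _ [p Gp <-]; exists (adj p.1, adj p.2); first exact: GA.
  by rewrite /= !amp_adj.
Qed.

(** The matrix entries of an intertwiner of the amplified algebra are
    intertwiners of G. *)
Lemma amp_itw_null K1 K2 (G : set (bop K1 K1 * bop K2 K2)) (x : l2 K1) :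
  (forall n, itw_null G (x n)) -> itw_null (amp_pairs G) x.
Proof.
move=> nx T iT; have Tinj i : T (l2inj K1 i (x i)) = 0.
  apply: l2_ext => j; rewrite l20E -l2coordE.
  apply: (nx i (l2coord K2 j \ob T \ob l2inj K1 i)) => a b Gab y.
  rewrite !bcompE -amp_inj (iT (amp a) (amp b)); last by exists (a, b).
  by rewrite !l2coordE ampE.
move/conv_unique: (conv_bop T (l2_conv_inj x)); apply.
rewrite (_ : (fun n => _) = fun=> 0); first exact: conv_cst.
apply/funext => n; elim: n => [|n IH]; first by rewrite big_geq// bop_zero.
by rewrite big_nat_recr//= bop_add IH Tinj addr0.
Qed.

(** Amplification turns the separation of single vectors into a simultaneous
    separation of several ones. *)
Lemma itw_null_approx2 K1 K2 (G : set (bop K1 K1 * bop K2 K2)) x1 x2 y1 y2 (e : R) :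
  star_subalgebra G -> itw_null G x1 -> itw_null G x2 -> 0 < e ->
  exists a b, [/\ G (a, b), hnorm (a x1 - x1) < e, hnorm (a x2 - x2) < e,
    hnorm (b y1) < e & hnorm (b y2) < e].
Proof.
move=> sG n1 n2 e0.
pose xi : l2 K1 := l2inj K1 0 x1 + l2inj K1 1 x2.
pose eta : l2 K2 := l2inj K2 0 y1 + l2inj K2 1 y2.
have nxi : itw_null (amp_pairs G) xi.
  apply: amp_itw_null => n T iT; rewrite /xi l2DE bop_add !l2injE.
  by case: (n == 0%N); case: (n == 1%N); rewrite ?bop_zero ?n1 ?n2 ?addr0.
have [A [B [[[a b] /= Gab [<- <-]] h1 h2]]] :=
  itw_null_approx eta (amp_star_subalgebra sG) nxi e0.
exists a, b; split=> //.
- have := le_lt_trans (l2_hnorm_coord _ 0) h1.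
  by rewrite l2BE ampE /xi l2DE !l2injE /= addr0.
- have := le_lt_trans (l2_hnorm_coord _ 1) h1.
  by rewrite l2BE ampE /xi l2DE !l2injE /= add0r.
- have := le_lt_trans (l2_hnorm_coord _ 0) h2.
  by rewrite ampE /eta l2DE !l2injE /= addr0.
- have := le_lt_trans (l2_hnorm_coord _ 1) h2.
  by rewrite ampE /eta l2DE !l2injE /= add0r.
Qed.

(** The separating pairs can be taken selfadjoint. Project (xi, 0) onto the
    closure of the real subspace of vectors (c xi, d eta) with c, d selfadjoint,
    and let (x, y) be the residue. Since (a + adj a, b + adj b) is such a pair for
    every (a, b) in G, orthogonality says
    Re (<a xi, x> + <a x, xi> + <b eta, y> + <b y, eta>) = 0. Choosing (a, b) close to
    (1, 0) on xi, x and eta, y gives Re <xi, x> = 0, and then x = 0. *)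
Lemma itw_null_approx_selfadj K1 K2 (G : set (bop K1 K1 * bop K2 K2)) xi eta (e : R) :
  star_subalgebra G -> itw_null G xi -> 0 < e ->
  exists c d, [/\ G (c, d), selfadj c, selfadj d, hnorm (c xi - xi) < e &
    hnorm (d eta) < e].
Proof.
move=> sG nxi e0; have [G1 GL GM GA] := sG.
have G0 : G (0, 0) by have := GL (-1) _ _ G1 G1; rewrite /= !scaleN1r !addNr.
pose S : set (K1 * K2) :=
  [set s | exists c d, [/\ G (c, d), selfadj c, selfadj d & s = (c xi, d eta)]].
have [|||p [q [cl orth]]] := @pair_projection R K1 K2 S xi 0.
- by exists 0, 0; split=> //; move=> x y; rewrite !bop0E rin0l rin0r.
- move=> _ _ [c [d [Gcd sc sd ->]]] [c' [d' [Gcd' sc' sd' ->]]].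
  exists (c + c'), (d + d'); split.
  + by have := GL 1 _ _ Gcd Gcd'; rewrite !scale1r.
  + by move=> x y; rewrite !bopDE rinDl rinDr sc sc'.
  + by move=> x y; rewrite !bopDE rinDl rinDr sd sd'.
  + by [].
- move=> r _ [c [d [Gcd sc sd ->]]]; exists (r%:C *: c), (r%:C *: d); split.
  + by have := GL r%:C _ _ Gcd G0; rewrite /= !addr0.
  + by move=> x y; rewrite !bopZE rinZl rinZr sc.
  + by move=> x y; rewrite !bopZE rinZl rinZr sd.
  + by [].
have [x xp] : exists x, x = xi - p by exists (xi - p).
have [y yq] : exists y, y = - q by exists (- q).
rewrite sub0r -xp -yq in orth.
have nx : itw_null G x.
  move=> T iT; rewrite xp bop_sub (nxi T iT).
  case: cl => a [b [Sab ap _]]; have := conv_bop T ap => h.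
  have h' : conv (fun n => T (a n)) 0.
    apply: conv_eq (conv_cst 0) => n.
    by have [c [d [Gcd _ _ [-> _]]]] := Sab n; rewrite (iT c d)// (nxi T)// bop_zero.
  by rewrite (conv_unique h h') subrr.
have xxi : rin xi x = 0.
  pose N := hnorm x + hnorm xi + hnorm y + hnorm eta.
  have bnd t : 0 < t -> `|2 * rin xi x| <= t * N.
    move=> t0; have [a [b [Gab h1 h2 h3 h4]]] := itw_null_approx2 eta y sG nxi nx t0.
    have Sc : S ((a + adj a) xi, (b + adj b) eta).
      exists (a + adj a), (b + adj b); split=> //.
      + by have := GL 1 _ _ Gab (GA _ Gab); rewrite !scale1r.
      + by move=> u v; rewrite !bopDE rinDl rinDr rin_adjl rin_adjr addrC.
      + by move=> u v; rewrite !bopDE rinDl rinDr rin_adjl rin_adjr addrC.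
    have := orth _ _ Sc; rewrite !bopDE !rinDr -!rin_adjr.
    have e1 : rin x (a xi) = rin (a xi - xi) x + rin xi x by rewrite -rinDl subrK rinC.
    have e2 : rin (a x) xi = rin (a x - x) xi + rin xi x.
      by rewrite (rinC xi x) -rinDl subrK.
    rewrite e1 e2 (rinC y (b eta)) => h.
    have := rin_CS (a xi - xi) x; have := rin_CS (a x - x) xi.
    have := rin_CS (b eta) y; have := rin_CS (b y) eta.
    have l1 := ler_wpM2r (hnorm_ge0 x) (ltW h1).
    have l2 := ler_wpM2r (hnorm_ge0 xi) (ltW h2).
    have l3 := ler_wpM2r (hnorm_ge0 y) (ltW h3).
    have l4 := ler_wpM2r (hnorm_ge0 eta) (ltW h4).
    rewrite !ler_norml /N => /andP[? ?] /andP[? ?] /andP[? ?] /andP[? ?].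
    by apply/andP; split; lra.
  apply/eqP; rewrite -normr_le0; apply/ler_addgt0Pl => t t0; rewrite addr0.
  have N0 : 0 < N + 1 by rewrite ltr_wpDl// !addr_ge0 ?hnorm_ge0.
  have := bnd _ (divr_gt0 t0 N0); rewrite normrM ger0_norm// => h.
  have : t / (N + 1) * N <= t.
    by rewrite mulrAC ler_pdivrMr// ler_wpM2l ?(ltW t0)// lerDl.
  have := normr_ge0 (rin xi x); lra.
have := pair_perp_closure orth cl; rewrite yq => hpq.
have xE : rin x x = - rin q q.
  by rewrite {1}xp rinBl xxi; move: hpq; rewrite rinNl (rinC x); lra.
have x0 := rinxx_ge0 x; have q0 := rinxx_ge0 q.
have {}x0 : x = 0 by apply: rinxx_eq0; apply/eqP; rewrite eq_le x0 andbT; lra.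
have {}q0 : q = 0.
  by apply: rinxx_eq0; move: xE; rewrite x0 rin0l => /eqP; rewrite eq_sym oppr_eq0 => /eqP.
have px : p = xi by apply/esym/eqP; rewrite -subr_eq0 -xp x0.
case: cl => a [b [Sab]]; rewrite px q0 => /convP/(_ e e0)[n1 hn1] /convP/(_ e e0)[n2 hn2].
have [c [d [Gcd sc sd [ea eb]]]] := Sab (maxn n1 n2).
exists c, d; split=> //; first by rewrite -ea hn1// leq_maxl.
by have := hn2 _ (leq_maxr n1 n2); rewrite subr0 eb.
Qed.

End Amplification.

(** * The resolvent (1 + S)^-1 and the order of operators *)

Section ResolventOrder.
Context (R : realType) (H : hilbertType R).
Implicit Types (S Q g : bop H H).

Definition is_resolvent S Q := [/\ pos Q, forall x, Q x + S (Q x) = x,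
  forall x, Q (x + S x) = x & forall x, rin (Q x) x <= hnorm x ^+ 2].

Lemma resolvent_commute S Q (C : bop H H) : is_resolvent S Q ->
  (forall x, C (S x) = S (C x)) -> forall x, C (Q x) = Q (C x).
Proof.
by move=> [_ SQ QS _] CS x; rewrite -{2}(SQ x) bop_add CS QS.
Qed.

(** (1 + S)^-1 >= 1 - S; both sides are compared after writing x = (1 + S) y. *)
Lemma resolvent_ge S Q x : pos S -> is_resolvent S Q ->
  hnorm x ^+ 2 - rin (S x) x <= rin (Q x) x.
Proof.
move=> [sS pS] [_ SQ QS _]; have [y ->] : exists y, x = y + S y by exists (Q x).
rewrite QS bop_add hnormD_sqr !rinDl !rinDr !rinxx (sS (S y) y) rinxx (rinC y (S y)).
have := pS y; have := pS (S y); have := sqr_ge0 (hnorm (S y)); lra.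
Qed.

(** Cauchy-Schwarz for the form of Q = (1 + S)^-1, applied to x and to
    (1 + S) u with u = (1 + S')^-1 x. *)
Lemma resolvent_antitone S S' Q Q' : pos S -> pos S' ->
  is_resolvent S Q -> is_resolvent S' Q' ->
  (forall x, rin (S x) x <= rin (S' x) x) ->
  forall x, rin (Q' x) x <= rin (Q x) x.
Proof.
move=> pS pS' [pQ SQ QS _] [pQ' SQ' QS' _] SS' x.
set u := Q' x; have ux : x = u + S' u by rewrite SQ'.
have A0 : 0 <= rin u x by exact: pQ'.2.
have := pos_CS x (u + S u) pQ; rewrite QS (pQ.1 x) QS (rinC x u) => h.
have le : rin (u + S u) u <= rin u x.
  by rewrite rinC [X in _ <= rin _ X]ux !rinDr lerD2l rinC (rinC u) SS'.
have [->|A1] := eqVneq (rin u x) 0; first exact: pQ.2.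
have Ap : 0 < rin u x by rewrite lt_neqAle eq_sym A1.
rewrite -(ler_pM2r Ap) -expr2 (le_trans h)// (rinC u (u + _)).
by rewrite ler_wpM2l ?pQ.2// le.
Qed.

(** If 0 <= g <= (1 + S)^-1 then g (1 + S) g <= g. This bounds the form of S at
    g x by a quantity that does not depend on S. *)
Lemma le_resolvent S Q g x : pos S -> is_resolvent S Q -> pos g ->
  (forall x, rin (g x) x <= rin (Q x) x) ->
  rin (S (g x)) (g x) <= rin (g x) x.
Proof.
move=> pS [_ _ QS _] pg gQ; set v := g x.
have := pos_CS x (v + S v) pg; rewrite -/v => h.
have := gQ (v + S v); rewrite QS => h'.
have A0 : 0 <= rin v v by exact: rinxx_ge0.
have B0 : 0 <= rin (S v) v by exact: pS.2.
have C0 : 0 <= rin v x by exact: pg.2.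
have : rin v (v + S v) ^+ 2 <= rin v x * rin v (v + S v).
  by rewrite (le_trans h)// ler_wpM2l.
rewrite rinDr (rinC v (S v)); set A := rin v v + rin (S v) v.
have [A1|A1] := eqVneq A 0; first by move=> _; rewrite /A in A1; lra.
have Ap : 0 < A by rewrite lt_neqAle eq_sym A1 addr_ge0.
by rewrite expr2 ler_pM2r// /A; lra.
Qed.

(** The function t^2 / (1 + t^2) of c is 1/2 at the eigenvalue 1 of c, with an
    error controlled by |c x - x| uniformly in c. *)
Lemma resolvent_square_half (c Q : bop H H) x : selfadj c ->
  is_resolvent (c \ob c) Q ->
  hnorm (x - Q x - (2^-1)%:C *: x) <= hnorm (c x - x).
Proof.
move=> sc [_ SQ QS _].
have [y ->] : exists y, x = y + c (c y) by exists (Q x); rewrite -{1}(SQ x).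
rewrite (QS y); set z := c y - y.
have -> : c (y + c (c y)) - (y + c (c y)) = z + c (c z).
  by rewrite /z !bop_sub !bop_add opprD addrACA.
have -> : y + c (c y) - y - (2^-1)%:C *: (y + c (c y)) = (2^-1)%:C *: (c z + z).
  have -> : c z + z = c (c y) - y by rewrite /z bop_sub subrKA.
  rewrite [y + _]addrC addrK scalerDr scalerBr opprD addrA; congr (_ - _).
  rewrite -{1}[c (c y)]scale1r -scalerBl; congr (_ *: _).
  by rewrite -[1]/(1%:C) -rmorphB; congr (_%:C); field.
clearbody z; rewrite -(@ler_sqr R) ?nnegrE ?hnorm_ge0// hnormZr exprMn !hnormD_sqr.
have -> : rin z (c (c z)) = hnorm (c z) ^+ 2 by rewrite -sc rinxx.
rewrite ger0_norm ?invr_ge0// (_ : 2^-1 ^+ 2 = 4^-1 :> R); last by field.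
have := sqr_ge0 (hnorm (c z - z)); rewrite hnormB_sqr.
have := sqr_ge0 (hnorm (c (c z))); have := sqr_ge0 (hnorm z).
have := sqr_ge0 (hnorm (c z)); lra.
Qed.

End ResolventOrder.

(** * Projection onto a closed subspace *)

Section ClosedProjection.
Context (R : realType) (H : hilbertType R).

Lemma closed_projection (N : set H) : N 0 ->
  (forall (c : R[i]) x y, N x -> N y -> N (c *: x + y)) ->
  (forall u l, (forall n : nat, N (u n)) -> conv u l -> N l) ->
  exists E : bop H H, (forall u, N (E u)) /\
    (forall u v, N v -> rin (u - E u) v = 0).
Proof.
move=> N0 NL Ncl; have [|P [Q hPQ]] := @pair_projector R H H [set s | N s.1 /\ s.2 = 0].
  split=> [//|c [x x'] [y y'] /= [Nx ->] [Ny ->]].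
  by rewrite scaler0 addr0; split=> //; exact: NL.
exists P; split=> [u|u v Nv].
  have [[a [b [Sab aP _]]] _] := hPQ u; apply: Ncl aP => n.
  by have [] := Sab n.
have [_ pe] := hPQ u; have := pe v 0 (conj Nv erefl).
by rewrite rin0r addr0.
Qed.

Lemma projection_fix (N : set H) (E : bop H H) :
  (forall (c : R[i]) x y, N x -> N y -> N (c *: x + y)) ->
  (forall u, N (E u)) -> (forall u v, N v -> rin (u - E u) v = 0) ->
  forall v, N v -> E v = v.
Proof.
move=> NL NE EN v Nv; apply/esym/eqP; rewrite -subr_eq0; apply/eqP/rinxx_eq0.
by apply: EN; rewrite addrC -scaleN1r; exact: NL.
Qed.

Lemma projection_commute (N : set H) (E C : bop H H) :
  (forall (c : R[i]) x y, N x -> N y -> N (c *: x + y)) ->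
  (forall u, N (E u)) -> (forall u v, N v -> rin (u - E u) v = 0) ->
  (forall v, N v -> N (C v)) -> (forall v, N v -> N (adj C v)) ->
  forall u, C (E u) = E (C u).
Proof.
move=> NL NE EN NC NC' u; apply/eqP; rewrite -subr_eq0; apply/eqP.
have Nw : N (C (E u) - E (C u)) by rewrite addrC -scaleN1r; apply: NL => //; exact: NC.
apply: rinxx_eq0; rewrite -{1}(subrKA (C u)) rinDl (EN (C u))// addr0.
by rewrite -[C (E u) - C u]bop_sub rin_adjr -[E u - u]opprB rinNl EN ?oppr0//; exact: NC'.
Qed.

Lemma projection_contract (N : set H) (E : bop H H) :
  (forall u, N (E u)) -> (forall u v, N v -> rin (u - E u) v = 0) ->
  forall u, hnorm (E u) <= hnorm u.
Proof.
move=> NE EN u; have := EN u _ (NE u); rewrite rinBl => /eqP; rewrite subr_eq0 => /eqP e.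
apply: le_of_sqr_le_mul; rewrite ?hnorm_ge0// -rinxx -e.
exact: le_trans (ler_norm _) (rin_CS _ _).
Qed.

End ClosedProjection.

(** * Separability *)

Section Separable.
Context (R : realType) (H : hilbertType R).

Definition dense_seq (d : nat -> H) :=
  forall x (e : R), 0 < e -> exists n, hnorm (d n - x) < e.

Lemma separable_dense_seq : separable_space H -> exists d, dense_seq d.
Proof.
move=> [D /countable_injP[f finj] Dd].
have /choice[d hd] n : exists y, forall x, D x -> f x = n -> y = x.
  have [[x [Dx fx]]|h] := pselect (exists x, D x /\ f x = n).
    by exists x => y Dy fy; apply: finj; rewrite ?inE// fx fy.
  by exists 0 => x Dx fx; case: h; exists x.
exists d => x e e0; have e0' : 0 < e%:C by rewrite ltr0c.
have [||y [By Dy]] := Dd (ball x e%:C)^°.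
- by exists x; exact: nbhsx_ballx.
- exact: open_interior.
exists (f y); rewrite (hd (f y) y Dy erefl) hnormB.
by move/interior_subset: By; rewrite -ball_normE /= hnormE ltcR.
Qed.

End Separable.

(** * Graphs of *-isomorphisms of von Neumann algebras *)

Section VnIso.
Context (R : realType).
Implicit Types K : hilbertType R.

Definition swap_pairs K1 K2 (G : set (bop K1 K1 * bop K2 K2)) :=
  [set p | G (p.2, p.1)].

Definition left_ops K1 K2 (G : set (bop K1 K1 * bop K2 K2)) : set (bop K1 K1) :=
  [set a | exists b, G (a, b)].

(** One half of the axioms for the graph of a *-isomorphism of von Neumann
    algebras; the other half is obtained by swapping the pairs. By linearity it is
    enough to require the uniqueness of partners at 0. *)
Definition half_vn_iso K1 K2 (G : set (bop K1 K1 * bop K2 K2)) :=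
  [/\ star_subalgebra G, forall b, G (0, b) -> b = 0 &
      commutant (commutant (left_ops G)) `<=` left_ops G].

Definition vn_iso K1 K2 (G : set (bop K1 K1 * bop K2 K2)) :=
  half_vn_iso G /\ half_vn_iso (swap_pairs G).

Lemma vn_iso_swap K1 K2 (G : set (bop K1 K1 * bop K2 K2)) :
  vn_iso G -> vn_iso (swap_pairs G).
Proof. by move=> [h h']; split=> //; move: h; congr half_vn_iso; apply/seteqP; split=> -[]. Qed.

Section Graph.
Context K1 K2 (G : set (bop K1 K1 * bop K2 K2)) (vG : vn_iso G).

Lemma graph_star : star_subalgebra G. Proof. by case: vG => -[]. Qed.

Lemma graph_id : G (bid, bid). Proof. by case: graph_star. Qed.

Lemma graph_lin (c : R[i]) a b a' b' :
  G (a, b) -> G (a', b') -> G (c *: a + a', c *: b + b').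
Proof. by case: graph_star => _ GL _ _; exact: GL. Qed.

Lemma graph_comp a b a' b' : G (a, b) -> G (a', b') -> G (a \ob a', b \ob b').
Proof. by case: graph_star => _ _ GM _; exact: GM. Qed.

Lemma graph_adj a b : G (a, b) -> G (adj a, adj b).
Proof. by case: graph_star => _ _ _ GA; exact: GA. Qed.

Lemma graph0 : G (0, 0).
Proof. by have := graph_lin (-1) graph_id graph_id; rewrite !scaleN1r !addNr. Qed.

Lemma graph_scale c a b : G (a, b) -> G (c *: a, c *: b).
Proof. by move=> h; have := graph_lin c h graph0; rewrite !addr0. Qed.

Lemma graph_add a b a' b' : G (a, b) -> G (a', b') -> G (a + a', b + b').
Proof. by move=> h h'; have := graph_lin 1 h h'; rewrite !scale1r. Qed.

Lemma graph_sub a b a' b' : G (a, b) -> G (a', b') -> G (a - a', b - b').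
Proof.
by move=> h h'; have := graph_lin (-1) h' h; rewrite !scaleN1r ![- _ + _]addrC.
Qed.

Lemma graph_eqr a b b' : G (a, b) -> G (a, b') -> b = b'.
Proof.
move=> h h'; have := graph_sub h h'; rewrite subrr => e.
have [[_ inj _] _] := vG.
by apply/eqP; rewrite -subr_eq0; apply/eqP/inj.
Qed.

Lemma graph_eql a a' b : G (a, b) -> G (a', b) -> a = a'.
Proof.
move=> h h'; have := graph_sub h h'; rewrite subrr => e.
have [_ [_ inj _]] := vG.
by apply/eqP; rewrite -subr_eq0; apply/eqP/inj.
Qed.

(** An operator commuting with the commutant of the left algebra belongs to
    it. This is how resolvents and limits are seen to have a partner on the other
    side. *)
Lemma graph_left (a : bop K1 K1) :
  (forall C : bop K1 K1, (forall (a' : bop K1 K1) (b' : bop K2 K2), G (a', b') -> forall x, C (a' x) = a' (C x)) ->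
     forall x, a (C x) = C (a x)) -> exists b, G (a, b).
Proof.
move=> h; have [[_ _ cc] _] := vG; apply: cc => C hC; apply: bop_ext => x.
apply: h => a' b' Gab y.
have : C \ob a' = a' \ob C by apply: hC; exists b'.
by move/(congr1 (fun T : bop K1 K1 => T y)).
Qed.

End Graph.

Lemma graph_right K1 K2 (G : set (bop K1 K1 * bop K2 K2)) (vG : vn_iso G) (b : bop K2 K2) :
  (forall C : bop K2 K2, (forall (a' : bop K1 K1) (b' : bop K2 K2), G (a', b') -> forall x, C (b' x) = b' (C x)) ->
     forall x, b (C x) = C (b x)) -> exists a, G (a, b).
Proof.
move=> h; apply: (graph_left (vn_iso_swap vG)) => C hC x.
by apply: h => a' b' Gab y; exact: (hC b' a').
Qed.

Lemma graph_resolvent K1 K2 (G : set (bop K1 K1 * bop K2 K2)) (vG : vn_iso G) s t :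
  G (s, t) -> pos s -> pos t -> exists r r',
  [/\ G (r, r'), is_resolvent s r & is_resolvent t r'].
Proof.
move=> Gst ps pt; have [r hr] := resolvent ps; have [r' hr'] := resolvent pt.
have [|q Gq] := graph_left vG (a := r).
  move=> C hC x; rewrite (resolvent_commute hr)// => y; exact: hC Gst y.
suff rq : r' = q by exists r, q; split=> //; rewrite -rq.
have [_ _ rs _] := hr; have [_ tr' _ _] := hr'.
have e : q \ob (bid + t) = bid.
  have := graph_comp vG Gq (graph_add vG (graph_id vG) Gst).
  rewrite (_ : r \ob (bid + s) = bid); last by apply: bop_ext => x; rewrite bcompE rs.
  by move=> /(graph_eqr vG)/(_ (graph_id vG)).
apply: bop_ext => x; rewrite -{2}(tr' x).
by have := congr1 (fun T : bop K2 K2 => T (r' x)) e.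
Qed.

(** *-isomorphisms preserve positivity: they preserve the invertibility of
    1 + c s for c > 0. *)
Lemma graph_pos K1 K2 (G : set (bop K1 K1 * bop K2 K2)) (vG : vn_iso G) s t :
  G (s, t) -> pos t -> pos s.
Proof.
move=> Gst pt; apply: pos_of_inverses.
  apply/selfadjP; rewrite -[X in adjoint_pair _ X](_ : adj s = s); first exact: adjP.
  by apply: (graph_eql vG (graph_adj vG Gst)); rewrite (selfadj_adj pt.1).
move=> c c0; have Gc := graph_scale vG c%:C Gst.
have pc : pos (c%:C *: t).
  split=> [x y|x]; first by rewrite !bopZE rinZl rinZr pt.1.
  by rewrite bopZE rinZl mulr_ge0 ?(ltW c0)// pt.2.
have [r' hr'] := resolvent pc.
have [|q Gq] := graph_right vG (b := r').
  move=> C hC x; rewrite (resolvent_commute hr')// => y; exact: hC Gc y.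
exists q => x; have [_ _ rt _] := hr'.
have e : q \ob (bid + c%:C *: s) = bid.
  have := graph_comp vG Gq (graph_add vG (graph_id vG) Gc).
  rewrite (_ : r' \ob (bid + c%:C *: t) = bid); last by apply: bop_ext => y; rewrite bcompE rt.
  by move=> /(graph_eql vG)/(_ (graph_id vG)).
by have := congr1 (fun T : bop K1 K1 => T x) e.
Qed.

(** The limit g' commutes with the commutant of the right algebra, hence has a
    partner g, and the preservation of order puts g below every r n. *)
Lemma graph_decreasing_limit K1 K2 (G : set (bop K1 K1 * bop K2 K2)) (vG : vn_iso G)
    (r : nat -> bop K1 K1) (r' : nat -> bop K2 K2) :
  (forall n : nat, G (r n, r' n)) -> (forall n, pos (r' n)) ->
  (forall n x, rin (r' n.+1 x) x <= rin (r' n x) x) ->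
  exists g g', [/\ G (g, g'), pos g, forall n x, rin (g x) x <= rin (r n x) x &
    forall x, conv (fun n => r' n x) (g' x)].
Proof.
move=> Gr pr dr; have [g' [pg' cg' lg']] := decreasing_limit pr dr.
have [|g Gg] := graph_right vG (b := g').
  move=> C hC x; have h := cg' (C x).
  apply: conv_unique h _; apply: conv_eq (conv_bop C (cg' x)) => n.
  by rewrite (hC _ _ (Gr n)).
exists g, g'; split=> //; first exact: (graph_pos vG Gg pg').
move=> n x; rewrite -subr_ge0 -rinBl -bopBE.
apply: (graph_pos vG (graph_sub vG (Gr n) Gg) _).2.
split=> [y z|y]; first by rewrite !bopBE rinBl rinBr (pr n).1 pg'.1.
by rewrite bopBE rinBl subr_ge0 lg'.
Qed.

Lemma itw_null_lin K1 K2 (G : set (bop K1 K1 * bop K2 K2)) c x y :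
  itw_null G x -> itw_null G y -> itw_null G (c *: x + y).
Proof. by move=> nx ny T iT; rewrite bop_add bop_scale nx// ny// scaler0 addr0. Qed.

Lemma itw_null_closed K1 K2 (G : set (bop K1 K1 * bop K2 K2)) u l :
  (forall n : nat, itw_null G (u n)) -> conv u l -> itw_null G l.
Proof.
move=> nu ul T iT; apply: conv_unique (conv_bop T ul) _.
by apply: conv_eq (conv_cst 0) => n; exact: nu.
Qed.

(** Intertwiners can be composed with the commutant of the left algebra. *)
Lemma itw_null_commutant K1 K2 (G : set (bop K1 K1 * bop K2 K2)) (C : bop K1 K1) x :
  (forall (a : bop K1 K1) (b : bop K2 K2), G (a, b) -> forall x, C (a x) = a (C x)) ->
  itw_null G x -> itw_null G (C x).
Proof.
move=> hC nx T iT; rewrite -bcompE; apply: nx => a b Gab y.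
by rewrite !bcompE (hC _ _ Gab) (iT _ _ Gab).
Qed.

Lemma itw_null_stable K1 K2 (G : set (bop K1 K1 * bop K2 K2)) a b x :
  G (a, b) -> itw_null G x -> itw_null G (a x).
Proof. by move=> Gab nx T iT; rewrite (iT a b)// nx// bop_zero. Qed.

(** The common kernel of the intertwiners is invariant under the left algebra
    and under its commutant, so the projection E onto it is central in the left
    algebra. *)
Lemma itw_null_projection K1 K2 (G : set (bop K1 K1 * bop K2 K2)) (vG : vn_iso G) :
  exists E F, [/\ G (E, F), forall u, itw_null G (E u),
    forall v, itw_null G v -> E v = v, forall u, hnorm (E u) <= hnorm u &
    forall (a : bop K1 K1) (b : bop K2 K2), G (a, b) -> forall x, a (E x) = E (a x)].
Proof.
have null0 : itw_null G 0 by move=> T iT; rewrite bop_zero.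
have [E [NE EN]] := closed_projection null0 (@itw_null_lin _ _ G) (@itw_null_closed _ _ G).
have com := projection_commute (@itw_null_lin _ _ G) NE EN.
have [|F GE] := graph_left vG (a := E).
  move=> C hC x; apply/esym/com => v; apply: itw_null_commutant => //.
  move=> a b Gab y; apply: rin_ext => z; rewrite rin_adjl.
  by rewrite rin_adjr -(hC _ _ (graph_adj vG Gab)) -rin_adjl -rin_adjr.
exists E, F; split=> //.
- exact: projection_fix (@itw_null_lin _ _ G) NE EN.
- exact: projection_contract NE EN.
- move=> a b Gab x; apply: com => v; first exact: itw_null_stable Gab.
  exact: itw_null_stable (graph_adj vG Gab).
Qed.

End VnIso.

(** * Intertwiners of isomorphic von Neumann algebras separate vectors *)

Section Disjointness.
Context (R : realType) (K1 K2 : hilbertType R).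
Variables (G : set (bop K1 K1 * bop K2 K2)) (vG : vn_iso G).

Definition half_pow (k : nat) : R := (2^-1) ^+ k.+1.

Lemma half_pow_gt0 k : 0 < half_pow k.
Proof. by rewrite exprn_gt0// invr_gt0. Qed.

Lemma half_pow_sum n : \sum_(0 <= i < n) half_pow i ^+ 2 <= 1.
Proof.
suff : \sum_(0 <= i < n) half_pow i ^+ 2 <= 1 - (2^-1) ^+ n.
  move=> h; apply: le_trans h _; rewrite gerBl exprn_ge0// invr_ge0//.
elim: n => [|n IH]; first by rewrite big_geq// expr0 subrr.
rewrite big_nat_recr//=; have h0 := half_pow_gt0 n.
have h1 : half_pow n <= 1 by rewrite exprn_ile1// ?invr_ge0// invf_le1// ler1n.
have e : (2^-1) ^+ n = 2 * half_pow n by rewrite /half_pow exprS; field.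
have : half_pow n ^+ 2 <= half_pow n by rewrite expr2 ler_piMr// ltW.
rewrite e in IH; rewrite -/(half_pow n); lra.
Qed.

Lemma half_pow_cvg : half_pow @ \oo --> (0 : R).
Proof.
have := @cvg_geometric R (2^-1) 2^-1; rewrite ger0_norm ?invr_ge0// => h.
have : half_pow = geometric 2^-1 2^-1.
  by apply/funext => n; rewrite /geometric /= /half_pow exprS.
by move=> ->; apply: h; rewrite invf_lt1// ltr1n.
Qed.

(** Rescaling makes any sequence of vectors square summable. *)
Lemma normalized_l2 (v : nat -> K1) : exists (xi : l2 K1) (w : nat -> R),
  forall n, 0 < w n /\ xi n = (w n)%:C *: v n.
Proof.
pose w n := half_pow n / (1 + hnorm (v n)).
have v1 n : 0 < 1 + hnorm (v n) by rewrite ltr_pwDl ?hnorm_ge0.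
have [|n|xi [hxi _]] := @mk_l2 R K1 (fun n => (w n)%:C *: v n) 1; first by [].
  rewrite expr1n; apply: le_trans (half_pow_sum n); apply: ler_sum => i _.
  rewrite ler_sqr ?nnegrE ?hnorm_ge0 ?(ltW (half_pow_gt0 _))// hnormZr.
  rewrite ger0_norm ?divr_ge0 ?(ltW (half_pow_gt0 _)) ?(ltW (v1 _))//.
  by rewrite /w mulrAC ler_pdivrMr// ler_wpM2l ?(ltW (half_pow_gt0 _))// lerDr.
by exists xi, w => n; rewrite hxi divr_gt0 ?half_pow_gt0.
Qed.

(** With (c, d) a selfadjoint pair close to (1, 0) on xi and eta, D is
    c^2 (1 + c^2)^-1 and D' its partner. In contrast to c, the operator D is
    bounded by 1 whatever c is. *)
Lemma separating_operator (xi : l2 K1) (eta : K2) (e : R) :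
  (forall n, itw_null G (xi n)) -> 0 < e ->
  exists D D', [/\ G (D, D'), pos D, pos D', forall x, hnorm (D x) <= hnorm x &
    (forall n, hnorm (D (xi n) - (2^-1)%:C *: xi n) <= e) /\
    rin (D' eta) eta <= e ^+ 2].
Proof.
move=> nxi e0; have [_ [_ [[[c d] Gcd [<- <-]] sc sd h1 h2]]] :=
  itw_null_approx_selfadj (l2inj K2 0 eta) (amp_star_subalgebra (graph_star vG))
    (amp_itw_null nxi) e0.
rewrite /= in sc sd h1 h2; have {}sc := amp_selfadj sc; have {}sd := amp_selfadj sd.
have pc : pos (c \ob c) by rewrite -{1}(selfadj_adj sc); exact: pos_square.
have pd : pos (d \ob d) by rewrite -{1}(selfadj_adj sd); exact: pos_square.
have [J [J' [GJ hJ hJ']]] := graph_resolvent vG (graph_comp vG Gcd Gcd) pc pd.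
have pB (H : hilbertType R) (S Q : bop H H) : is_resolvent S Q -> pos (bid - Q).
  move=> [pQ _ _ Q1]; split; first exact: selfadjB (pos_id H).1 pQ.1.
  by move=> x; rewrite bopBE rinBl bidE rinxx subr_ge0.
have pD := pB _ _ _ hJ; have pD' := pB _ _ _ hJ'.
exists (bid - J), (bid - J'); split=> //.
- exact: (graph_sub vG (graph_id vG) GJ).
- move=> x; rewrite -(@ler_sqr R) ?nnegrE ?hnorm_ge0//.
  have D1 y : rin ((bid - J) y) y <= 1 * hnorm y ^+ 2.
    by rewrite bopBE rinBl bidE rinxx mul1r gerBl; case: hJ => pJ _ _ _; exact: pJ.2.
  have := pos_hnorm_le pD ler01 D1 x; rewrite mul1r => h.
  by rewrite (le_trans h)// -[leRHS]mul1r.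
- split=> [n|].
    rewrite bopBE bidE (le_trans (resolvent_square_half _ sc hJ))//.
    rewrite -ampE -l2BE (le_trans (l2_hnorm_coord _ _))// ltW//.
  rewrite bopBE bidE rinBl rinxx.
  have := resolvent_ge eta pd hJ'; rewrite bcompE sd rinxx => h.
  apply: (@le_trans _ _ (hnorm (d eta) ^+ 2)); first by lra.
  rewrite ler_sqr ?nnegrE ?hnorm_ge0 ?(ltW e0)//.
  by move: h2; rewrite amp_inj l2inj_hnorm => /ltW.
Qed.

Lemma graph_sum (D : nat -> bop K1 K1) (D' : nat -> bop K2 K2) m :
  (forall k, G (D k, D' k)) ->
  G (\sum_(0 <= k < m) D k, \sum_(0 <= k < m) D' k).
Proof.
move=> GD; elim: m => [|m IH]; first by rewrite !big_geq//; exact: graph0.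
by rewrite !big_nat_recr//; apply: (graph_add vG).
Qed.

Lemma pos_sum (H : hilbertType R) (D : nat -> bop H H) m :
  (forall k, pos (D k)) -> pos (\sum_(0 <= k < m) D k).
Proof.
move=> pD; elim: m => [|m IH]; first by rewrite big_geq//; exact: pos0.
by rewrite big_nat_recr//; exact: posD.
Qed.

Lemma rin_sum (H : hilbertType R) (D : nat -> bop H H) m x :
  rin ((\sum_(0 <= k < m) D k) x) x = \sum_(0 <= k < m) rin (D k x) x.
Proof.
elim: m => [|m IH]; first by rewrite !big_geq// rin0l.
by rewrite !big_nat_recr// bopDE rinDl IH.
Qed.

(** Assume that the common kernel is not 0, let E be the projection onto it, F
    the partner of E, and eta a nonzero vector in the range of F. There are positive
    contractions D k with partners D' k such that D k converges to 1/2 on the range of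
    E, while the sum of the <D' k eta, eta> is at most |eta|^2 / 4. Put
    r m = (1 + D 0 + ... + D (m - 1))^-1, with partner r' m. The sequence r' decreases
    to an operator g' with <g' eta, eta> >= 3/4 |eta|^2. Its partner g satisfies
    0 <= g <= r m for all m, so by le_resolvent the sum of the <D k g x, g x> is at
    most <g x, x>; its terms tend to 0, and for x in the range of E they tend to
    |g x|^2 / 2. Hence g E = 0, so g' F = 0 and g' eta = 0, a contradiction. *)
Lemma vn_iso_itw_null x0 : separable_space K1 -> itw_null G x0 -> x0 = 0.
Proof.
move=> /separable_dense_seq[d dd] nx0; apply: contrapT => x00.
have [E [F [GE NE EN Econ Ecom]]] := itw_null_projection vG.
have FF : F \ob F = F.
  apply: (graph_eqr vG _ GE); rewrite -[E in G (E, _)](_ : E \ob E = E).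
    exact: (graph_comp vG GE GE).
  by apply: bop_ext => x; rewrite bcompE EN.
have [y Fy] : exists y, F y <> 0.
  apply/not_existsP => h; apply: x00; rewrite -(EN _ nx0).
  have F0 : F = 0 by apply: bop_ext => y; apply: contrapT; exact: h.
  by rewrite F0 in GE; rewrite (graph_eql vG GE (graph0 vG)) bop0E.
set eta := F y in Fy.
have Feta : F eta = eta by rewrite /eta -bcompE FF.
have eta0 : 0 < hnorm eta.
  by rewrite lt_neqAle hnorm_ge0 andbT eq_sym; apply/eqP => /hnorm_eq0.
(* The coordinates of xi span a dense subspace of the range of E. *)
have [xi [w hw]] := normalized_l2 (fun n => E (d n)).
have nxi n : itw_null G (xi n).
  have [_ ->] := hw n; rewrite -[_ *: _]addr0; apply: itw_null_lin => //.
  by move=> T iT; rewrite bop_zero.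
(* The squares of the e k sum to at most |eta|^2 / 4. *)
pose e k := hnorm eta * half_pow k / 2.
have e0 k : 0 < e k by rewrite divr_gt0// mulr_gt0 ?half_pow_gt0.
have /choice[D hD] k := separating_operator eta nxi (e0 k).
have {hD} /choice[D' hD'] := hD.
have GD k : G (D k, D' k) by have [] := hD' k.
have pD k : pos (D k) by have [] := hD' k.
have pD' k : pos (D' k) by have [] := hD' k.
pose S m := \sum_(0 <= k < m) D k; pose S' m := \sum_(0 <= k < m) D' k.
have GS m : G (S m, S' m) by exact: graph_sum.
have pS m : pos (S m) by exact: pos_sum.
have pS' m : pos (S' m) by exact: pos_sum.
have /choice[r hr] m := graph_resolvent vG (GS m) (pS m) (pS' m).
have {hr} /choice[r' hr'] := hr.
have Gr m : G (r m, r' m) by have [] := hr' m.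
have rr m : is_resolvent (S m) (r m) by have [] := hr' m.
have rr' m : is_resolvent (S' m) (r' m) by have [] := hr' m.
have [||g [g' [Gg pg gr cg']]] := graph_decreasing_limit vG Gr.
- by move=> m; have [] := rr' m.
- move=> m; apply: resolvent_antitone (pS' m) (pS' m.+1) (rr' m) (rr' m.+1) _ => x.
  by rewrite !rin_sum big_nat_recr//= lerDl (pD' m).2.
have low m : hnorm eta ^+ 2 * (3 / 4) <= rin (r' m eta) eta.
  have := resolvent_ge eta (pS' m) (rr' m); apply: le_trans.
  have : rin (S' m eta) eta <= hnorm eta ^+ 2 / 4.
    rewrite rin_sum; apply: (@le_trans _ _ (\sum_(0 <= k < m) (hnorm eta ^+ 2 / 4) * half_pow k ^+ 2)).
      apply: ler_sum => k _; have [_ _ _ _ [_ h]] := hD' k; rewrite (le_trans h)//.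
      by rewrite /e expr_div_n exprMn mulrAC expr2 (_ : 2 ^+ 2 = 4 :> R)//; ring.
    rewrite -mulr_sumr ler_piMr ?half_pow_sum// divr_ge0// sqr_ge0//.
  lra.
have low' : hnorm eta ^+ 2 * (3 / 4) <= rin (g' eta) eta.
  have c := conv_rin (y:=eta) (cg' eta); rewrite -(cvg_lim _ c)//.
  by apply: limr_ge; [apply/cvg_ex; eexists; exact: c|exact: nearW].
suff gE : g \ob E = 0.
  have := graph_comp vG Gg GE; rewrite gE => /(graph_eqr vG)/(_ (graph0 vG)).
  move=> /(congr1 (fun T : bop K2 K2 => T eta)); rewrite bcompE Feta bop0E => g0.
  move: low'; rewrite g0 rin0l leNgt mulr_gt0// ?divr_gt0// ?exprn_gt0//.
apply: bop_ext => x; rewrite bcompE bop0E (Ecom _ _ Gg).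
set u := g x; set v := E u.
have Ev : E v = v by rewrite /v (EN (E u)).
have vE : v = g (E x) by rewrite (Ecom _ _ Gg).
have bnd m : \sum_(0 <= k < m) rin (D k v) v <= rin (g (E x)) (E x).
  by rewrite -rin_sum vE; exact: le_resolvent (pS m) (rr m) pg (gr m).
have c0 : (fun k => rin (D k v) v) @ \oo --> (0 : R).
  apply: cvg_series_cvg_0; apply: nondecreasing_is_cvgn.
    by apply: nondecreasing_series => k _ _; exact: (pD k).2.
  by exists (rin (g (E x)) (E x)) => _ [m _ <-]; exact: bnd.
have c1 : conv (fun k => D k v) ((2^-1)%:C *: v).
  apply/convP => t t0; have [j hj] := dd v _ (divr_gt0 t0 (ltr0n R 4)).
  have [wj xij] := hw j.
  have tw : 0 < t / 4 * w j by rewrite mulr_gt0// divr_gt0.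
  have ce : e @ \oo --> (0 : R).
    rewrite -[0](mul0r 2^-1) -(mulr0 (hnorm eta)); apply: cvgMr_tmp.
    by apply: cvgMl_tmp; exact: half_pow_cvg.
  have /cvgrPdist_lt/(_ _ tw)[N _ hN] := ce.
  exists N => // k Nk; have := hN k Nk; rewrite /= sub0r normrN ger0_norm ?(ltW (e0 k))// => ek.
  have [_ _ _ Dk1 [/(_ j) hk _]] := hD' k.
  have h1 : hnorm (D k (E (d j)) - (2^-1)%:C *: E (d j)) < t / 4.
    rewrite -(ltr_pM2r wj); apply: le_lt_trans ek; apply: le_trans hk.
    rewrite xij bop_scale (scalerA (2^-1)%:C) (mulrC (2^-1)%:C) -scalerA -scalerBr hnormZr.
    by rewrite ger0_norm ?(ltW wj)// mulrC.
  have h2 : hnorm (v - E (d j)) < t / 4.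
    by rewrite -{1}Ev -bop_sub (le_lt_trans (Econ _))// hnormB.
  have h3 : hnorm (D k v - D k (E (d j))) < t / 4.
    by rewrite -bop_sub (le_lt_trans (Dk1 _)).
  have h4 : hnorm ((2^-1)%:C *: E (d j) - (2^-1)%:C *: v) < t / 4.
    rewrite -scalerBr hnormZr ger0_norm ?invr_ge0// hnormB.
    by have := hnorm_ge0 (v - E (d j)); lra.
  have := hnorm_triangle (D k (E (d j))) (D k v) ((2^-1)%:C *: v).
  have := hnorm_triangle ((2^-1)%:C *: E (d j)) (D k (E (d j))) ((2^-1)%:C *: v).
  lra.
have c2 := conv_rin (y:=v) c1; have : rin ((2^-1)%:C *: v) v = 0 by exact: (cvg_unique (@Rhausdorff R) c2 c0).
rewrite rinZl => /eqP; rewrite mulf_eq0 invr_eq0 pnatr_eq0 /= => /eqP.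
exact: rinxx_eq0.
Qed.

End Disjointness.

(** * Resolving the identity along a ternary ring of operators *)

Section Greedy.
Context (R : realType) (K H : hilbertType R).
Implicit Types (T : bop K H) (Q : bop K K) (M : set (bop K H)).

Definition total_seq (L : hilbertType R) (x : nat -> L) :=
  forall Q : bop L L, (forall j, Q (x j) = 0) -> Q = 0.

Definition contraction T := forall x, hnorm (T x) <= hnorm x.

Lemma tro_comp M S T U : tro M -> M S -> M T -> M U -> M (S \ob adj T \ob U).
Proof.
move=> [_ MMM] MS MT MU; apply: MMM.
exists (S \ob adj T); last by exists U.
by exists S => //; exists (adj T) => //; exists T => //; exact: adjP.
Qed.

Lemma half_maximal M y : tro M -> exists T, [/\ M T, contraction T &
  forall T', M T' -> contraction T' -> hnorm (T' y) <= 2 * hnorm (T y)].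
Proof.
move=> [[M0 _] _]; pose A := [set hnorm (T y) | T in [set T | M T /\ contraction T]].
have c0 : contraction 0 by move=> x; rewrite bop0E hnorm0 hnorm_ge0.
have A0 : A 0 by exists 0 => //; rewrite bop0E hnorm0.
have hs : has_sup A.
  by split; [exists 0|exists (hnorm y) => _ [T [_ cT] <-]; exact: cT].
have ub T' : M T' -> contraction T' -> hnorm (T' y) <= sup A.
  by move=> MT' cT'; apply: ub_le_sup; [exact: hs.2|exists T'].
have [s0|s0] := leP (sup A) 0.
  exists 0; split=> // T' MT' cT'; rewrite bop0E hnorm0 mulr0.
  exact: le_trans (ub _ MT' cT') s0.
have [_ [T [MT cT] <-] h] := @sup_adherent R A (sup A / 2) (divr_gt0 s0 (ltr0n R 2)) hs.
by exists T; split=> // T' MT' cT'; have := ub _ MT' cT'; lra.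
Qed.

(** The 2-adic valuation of n + 1 takes every value infinitely often, so that
    every vector of a sequence is revisited. *)
Definition recurrent (n : nat) : nat := logn 2 n.+1.

Lemma recurrentP j N : exists2 n, (N <= n)%N & recurrent n = j.
Proof.
exists (2 ^ j * (2 * N).+1).-1.
  rewrite -ltnS prednK ?muln_gt0 ?expn_gt0//.
  rewrite (leq_trans (n := (2 * N).+1))// ?leq_pmull ?expn_gt0// ltnS.
  by rewrite leq_pmull.
rewrite /recurrent prednK ?muln_gt0 ?expn_gt0//.
rewrite lognM ?expn_gt0// pfactorK// lognE /= dvdn2 /= oddM /= addn0.
by [].
Qed.

(** If M has no common kernel, the identity is the strong sum of operators
    adj W W with W in M. The remainders are Q 0 = 1 and Q' = Q - Q (adj T) T Q with T
    a contraction in M: since 0 <= Q (adj T) T Q <= Q^2 <= Q, they remain between 0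
    and 1, and S Q' = S Q - (S Q) (adj T) (T Q) stays in M for S in M. They decrease
    to some g. At stage n the operator T is half maximal at Q n (x j), where each j
    comes back infinitely often; as T (Q n) (x j) tends to 0, all S in M kill g (x j).
    This replaces the polar decomposition of elements of M. *)
Lemma greedy_resolution M (x : nat -> K) : tro M -> total_seq x ->
  (forall y, (forall T, M T -> T y = 0) -> y = 0) ->
  exists (W : nat -> bop K H) (Q : nat -> bop K K), [/\ forall n, M (W n),
    forall n, pos (Q n), forall n y, hnorm (Q n y) <= hnorm y,
    (Q 0%N = bid /\ forall n, Q n.+1 = Q n - adj (W n) \ob W n) &
    forall y, conv (fun n => Q n y) 0].
Proof.
move=> tM tx nM.
have /choice[st hst] (y : K) := half_maximal y tM.
pose step (Q : bop K K) n := st (Q (x (recurrent n))).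
pose Q := fix F n := if n is m.+1 then F m - F m \ob adj (step (F m) m) \ob step (F m) m \ob F m
  else (bid : bop K K).
pose T n := step (Q n) n.
have QS n : Q n.+1 = Q n - Q n \ob adj (T n) \ob T n \ob Q n by [].
have MT n : M (T n) by have [] := hst (Q n (x (recurrent n))).
have cT n : contraction (T n) by have [] := hst (Q n (x (recurrent n))).
have sub1 (P : bop K K) : pos P -> (forall y, rin (P y) y <= hnorm y ^+ 2) ->
    forall y, hnorm (P y) ^+ 2 <= rin (P y) y.
  move=> pP P1 y; rewrite -[leRHS]mul1r; apply: pos_hnorm_le => // z.
  by rewrite mul1r.
have TQ n y z : selfadj (Q n) ->
    rin ((Q n \ob adj (T n) \ob T n \ob Q n) y) z = rin (T n (Q n y)) (T n (Q n z)).
  by move=> sQ; rewrite !bcompE (sQ (adj _ _)) rin_adjl.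
have qf n y : selfadj (Q n) -> rin (Q n.+1 y) y = rin (Q n y) y - hnorm (T n (Q n y)) ^+ 2.
  by move=> sQ; rewrite QS bopBE rinBl TQ// rinxx.
have inv n : [/\ pos (Q n), forall y, rin (Q n y) y <= hnorm y ^+ 2 &
    forall S, M S -> M (S \ob Q n)].
  elim: n => [|n [pQ Q1 MQ]].
    split; [exact: pos_id|by move=> y; rewrite bidE rinxx|move=> S MS].
    by rewrite (_ : S \ob _ = S)//; exact: bop_ext.
  split.
  - split=> [y z|y].
      rewrite QS !bopBE rinBl rinBr pQ.1; congr (_ - _).
      by rewrite (TQ _ _ _ pQ.1) (rinC y) (TQ _ _ _ pQ.1) rinC.
    rewrite qf ?subr_ge0; last exact: pQ.1.
    apply: le_trans (sub1 _ pQ Q1 y); rewrite ler_sqr ?nnegrE ?hnorm_ge0//.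
    exact: cT.
  - move=> y; rewrite qf; last exact: pQ.1.
    by apply: le_trans (Q1 y); rewrite gerBl sqr_ge0.
  - move=> S MS; have := tM.1.2 (-1) _ _ (tro_comp tM (MQ _ MS) (MT n) (MQ _ (MT n))) (MQ _ MS).
    congr M; apply: bop_ext => y; rewrite bopDE bopZE scaleN1r !bcompE QS bopBE bop_sub !bcompE.
    by rewrite addrC.
have pQ n : pos (Q n) by have [] := inv n.
pose W n := T n \ob Q n.
have [g [pg cg gQ]] : exists g, [/\ pos g, forall x, conv (fun n => Q n x) (g x) &
    forall n x, rin (g x) x <= rin (Q n x) x].
  apply: decreasing_limit => // n y; rewrite qf ?gerBl ?sqr_ge0//; exact: (pQ n).1.
exists W, Q; split=> //.
- by move=> n; have [_ _] := inv n; exact.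
- move=> n y; have [_ Q1 _] := inv n.
  have h := sub1 _ (pQ n) Q1 y; rewrite -(@ler_sqr R) ?nnegrE ?hnorm_ge0//.
  exact: le_trans h (Q1 y).
- split=> // n; rewrite QS /W adj_comp (selfadj_adj (pQ n).1).
  by congr (_ - _); apply: bop_ext.
suff g0 : g = 0 by move=> y; have := cg y; rewrite g0 bop0E.
apply: tx => j; apply: nM => S MS.
have Wcvg : (fun n => hnorm (W n (x j)) ^+ 2) @ \oo --> (0 : R).
  have c := conv_rin (y:=x j) (cg (x j)).
  have c' : (fun n => rin (Q n.+1 (x j)) (x j)) @ \oo --> rin (g (x j)) (x j).
    by rewrite (cvg_shiftS (fun n => rin (Q n (x j)) (x j))).
  have -> : (fun n => hnorm (W n (x j)) ^+ 2) =
      (fun n => rin (Q n (x j)) (x j) - rin (Q n.+1 (x j)) (x j)).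
    apply/funext => n; rewrite qf; last exact: (pQ n).1.
    by rewrite bcompE opprB addrC subrK.
  by rewrite -(subrr (rin (g (x j)) (x j))); exact: cvgB.
have [B B0 hB] := bop_bound S.
pose S' := (B^-1)%:C *: S.
have MS' : M S'.
  by have := tM.1.2 (B^-1)%:C _ _ MS tM.1.1; rewrite addr0.
have cS' : contraction S'.
  move=> y; rewrite bopZE hnormZr ger0_norm ?invr_ge0 ?(ltW B0)//.
  by rewrite mulrC ler_pdivrMr// mulrC.
have S'0 : S' (g (x j)) = 0.
  apply: hnorm_eq0; apply/eqP; rewrite -normr_le0; apply/ler_addgt0Pl => e e0.
  rewrite addr0 ger0_norm ?hnorm_ge0//.
  have e4 : 0 < e / 4 by rewrite divr_gt0.
  have [N1 hN1] := (convP _ _).1 (cg (x j)) _ e4.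
  have /cvgrPdist_lt/(_ ((e / 4) ^+ 2))[|N2 _ hN2] := Wcvg; first by rewrite exprn_gt0.
  have [n Nn jn] := recurrentP j (maxn N1 N2).
  have h1 := hN1 n (leq_trans (leq_maxl _ _) Nn).
  have := hN2 n (leq_trans (leq_maxr _ _) Nn).
  rewrite /= sub0r normrN ger0_norm ?sqr_ge0// ltr_sqr ?nnegrE ?hnorm_ge0 ?(ltW e4)// => h2.
  have [_ _ /(_ _ MS' cS')] := hst (Q n (x (recurrent n))); rewrite jn => h3.
  have h4 := cS' (Q n (x j) - g (x j)); rewrite bop_sub in h4.
  have h5 := ler_hnormD (S' (g (x j)) - S' (Q n (x j))) (S' (Q n (x j))).
  rewrite subrK hnormB in h5.
  have h6 : hnorm (W n (x j)) = hnorm (st (Q n (x j)) (Q n (x j))).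
    by rewrite bcompE /T /step jn.
  lra.
have : S (g (x j)) = B%:C *: S' (g (x j)).
  by rewrite bopZE scalerA -rmorphM /= divff ?gt_eqF// scale1r.
by rewrite S'0 scaler0.
Qed.

(** The operators W of greedy_resolution are the rows of an isometry. *)
Lemma greedy_isometry M (x : nat -> K) : tro M -> total_seq x ->
  (forall y, (forall T, M T -> T y = 0) -> y = 0) ->
  exists V : bop K (l2 H), (forall y, hnorm (V y) = hnorm y) /\
    forall n, M (l2coord H n \ob V).
Proof.
move=> tM tx nM; have [W [Q [MW pQ Q1 [Q0 QS] cQ]]] := greedy_resolution tM tx nM.
have sumW y n : \sum_(0 <= i < n) hnorm (W i y) ^+ 2 = hnorm y ^+ 2 - rin (Q n y) y.
  elim: n => [|n IH]; first by rewrite big_geq// Q0 bidE rinxx subrr.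
  rewrite big_nat_recr//= IH QS bopBE rinBl bcompE rin_adjl rinxx opprB addrA.
  by rewrite addrAC.
have /choice[V hV] y : exists z : l2 H, (forall n, z n = W n y) /\ hnorm z <= hnorm y.
  apply: mk_l2; first exact: hnorm_ge0.
  by move=> n; rewrite sumW gerBl (pQ n).2.
have [||V' hV'] := @mk_bop R K (l2 H) V 1.
- move=> a y z; apply: l2_ext => n.
  by rewrite l2DE l2ZE !(hV _).1 bop_add bop_scale.
- by move=> y; rewrite mul1r (hV y).2.
exists V'; split=> [y|n]; last first.
  by rewrite (_ : _ \ob _ = W n)//; apply: bop_ext => y; rewrite bcompE l2coordE hV' (hV y).1.
apply/eqP; rewrite -(@eqrXn2 _ 2) ?hnorm_ge0//; apply/eqP.
have h := l2_hnorm_cvg (x := V' y).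
have h' : series (fun n => hnorm (V' y n) ^+ 2) @ \oo --> hnorm y ^+ 2 - rin 0 y.
  rewrite (_ : series _ = fun n => hnorm y ^+ 2 - rin (Q n y) y).
    by apply: cvgB; [exact: cvg_cst|exact: conv_rin].
  by apply/funext => n; rewrite -sumW /series /=; apply: eq_bigr => i _; rewrite hV' (hV y).1.
rewrite rin0l subr0 in h'.
exact: (cvg_unique (@Rhausdorff R) h h').
Qed.

End Greedy.

(** * Sequences that determine operators *)

Section TotalSequences.
Context (R : realType).
Implicit Types K H : hilbertType R.

Lemma dense_total K : separable_space K -> exists d : nat -> K,
  forall H (T : bop K H), (forall n, T (d n) = 0) -> T = 0.
Proof.
move=> /separable_dense_seq[d dd]; exists d => H T Td; apply: bop_ext => x.
have [B B0 hB] := bop_bound T.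
apply: hnorm_eq0; apply/eqP; rewrite -normr_le0; apply/ler_addgt0Pl => e e0.
rewrite addr0 ger0_norm ?hnorm_ge0//; have [n hn] := dd x _ (divr_gt0 e0 B0).
rewrite -[T x]subr0 -(Td n) -bop_sub (le_trans (hB _))// hnormB mulrC.
by rewrite -ler_pdivlMr// ltW.
Qed.

Lemma separable_total K : separable_space K -> exists d, @total_seq R K d.
Proof. by move=> /dense_total[d hd]; exists d => Q; exact: hd. Qed.

Lemma separable_total_l2 K : separable_space K -> exists d, @total_seq R (l2 K) d.
Proof.
move=> /dense_total[d hd].
exists (fun n => if (choice.unpickle n : option (nat * nat)) is Some p then l2inj K p.1 (d p.2) else 0) => Q hQ.
have Qinj i : Q \ob l2inj K i = 0.
  by apply: hd => j; have := hQ (choice.pickle (i, j)); rewrite choice.pickleK bcompE.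
apply: bop_ext => x; apply: conv_unique (conv_bop Q (l2_conv_inj x)) _.
apply: conv_eq (conv_cst 0) => n; elim: n => [|n IH]; first by rewrite big_geq// bop_zero.
by rewrite big_nat_recr// bop_add IH -bcompE Qinj bop0E addr0.
Qed.

End TotalSequences.

(** * The ternary ring of intertwiners *)

Section IntertwinerTro.
Context (R : realType).
Implicit Types K : hilbertType R.

Lemma itw_adj K1 K2 (G : set (bop K1 K1 * bop K2 K2)) T :
  (forall a b, G (a, b) -> G (adj a, adj b)) ->
  itw G T -> itw (swap_pairs G) (adj T).
Proof.
move=> GA iT b a Gab x; apply: rin_ext => z.
by rewrite rin_adjl rin_adjr -(iT _ _ (GA _ _ Gab)) -rin_adjl -rin_adjr.
Qed.

Lemma itw_tro K1 K2 (G : set (bop K1 K1 * bop K2 K2)) :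
  (forall a b, G (a, b) -> G (adj a, adj b)) -> tro (itw G).
Proof.
move=> GA; split.
  split=> [a b _ x|c S T iS iT a b Gab x]; first by rewrite !bop0E bop_zero.
  by rewrite !bopDE !bopZE (iS _ _ Gab) (iT _ _ Gab) bop_add bop_scale.
move=> _ [_ [S iS [_ [T iT /adj_uniq ->] <-]] [U iU <-]] a b Gab x.
rewrite !bcompE (iU _ _ Gab) (itw_adj GA iT (a := b) (b := a))//.
exact: iS.
Qed.

Lemma adjoint_set_itw K1 K2 (G : set (bop K1 K1 * bop K2 K2)) :
  (forall a b, G (a, b) -> G (adj a, adj b)) ->
  adjoint_set (itw G) = itw (swap_pairs G).
Proof.
move=> GA; apply/seteqP; split=> [_ [T iT /adj_uniq ->]|S iS].
  exact: itw_adj.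
exists (adj S); last by apply/adjoint_rin => x y; rewrite rin_adjl.
have GA' a b : swap_pairs G (a, b) -> swap_pairs G (adj a, adj b).
  exact: GA.
by move=> a b Gab; apply: (itw_adj GA' iS).
Qed.

End IntertwinerTro.

(** * The weak* topology *)

Section WeakStar.
Context (R : realType).
Implicit Types H K : hilbertType R.

Lemma wstar_pairingE H K (xi : l2 H) (eta : l2 K) (T : bop H K) :
  wstar_pairing xi eta T = inner (amp T xi) eta.
Proof. by congr csum; apply/funext => n; rewrite ampE. Qed.

Lemma inner_l2inj H (x : l2 H) n y : inner x (l2inj H n y) = inner (x n) y.
Proof. by rewrite -l2coordE (adjP (l2coord H n)). Qed.

Lemma wstar_pairing_inj H K (x : H) (y : K) (T : bop H K) :
  wstar_pairing (l2inj H 0 x) (l2inj K 0 y) T = inner (T x) y.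
Proof. by rewrite wstar_pairingE amp_inj inner_l2inj l2injE. Qed.

Lemma amp_bound H K (A : bop H K) (M : R) : 0 <= M ->
  (forall x, hnorm (A x) <= M * hnorm x) ->
  forall xi, hnorm (amp A xi) <= M * hnorm xi.
Proof.
move=> M0 hM xi; apply: l2_hnorm_le => [|n]; first by rewrite mulr_ge0 ?hnorm_ge0.
rewrite exprMn; apply: le_trans (ler_wpM2l (sqr_ge0 M) (l2_partial_sum_le xi n)).
rewrite mulr_sumr; apply: ler_sum => i _; rewrite -exprMn ampE.
by rewrite ler_sqr ?nnegrE ?mulr_ge0 ?hnorm_ge0.
Qed.

(** Finitely supported vectors are dense in l2 H, and the operators are
    uniformly bounded. *)
Lemma amp_conv0 H K (B : nat -> bop H K) (C : R) : 0 <= C ->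
  (forall n x, hnorm (B n x) <= C * hnorm x) ->
  (forall x, conv (fun n => B n x) 0) ->
  forall xi, conv (fun n => amp (B n) xi) 0.
Proof.
move=> C0 hC cB xi.
have fin N : conv (fun n => amp (B n) (\sum_(0 <= i < N) l2inj H i (xi i))) 0.
  elim: N => [|N IH].
    by apply: conv_eq (conv_cst 0) => n; rewrite big_geq// bop_zero.
  have h := convD IH (conv_bop (l2inj K N) (cB (xi N))).
  rewrite bop_zero addr0 in h; apply: (conv_eq _ h) => n.
  by rewrite big_nat_recr// bop_add amp_inj.
apply/convP => e e0; have C1 : 0 < C + 1 by rewrite ltr_wpDl.
have e2 : 0 < e / 2 by rewrite divr_gt0.
have [N hN] := (convP _ _).1 (l2_conv_inj xi) _ (divr_gt0 e2 C1).
have [N' hN'] := (convP _ _).1 (fin N) _ e2; exists N' => n Nn.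
have := hN N (leqnn N); have := hN' n Nn.
set s := \sum_(0 <= i < N) _; rewrite !subr0 hnormB (ltr_pdivlMr _ _ C1) => h1 h2.
have := amp_bound C0 (hC n) (xi - s); rewrite bop_sub => h3.
have := ler_hnormD (amp (B n) xi - amp (B n) s) (amp (B n) s); rewrite subrK.
have := hnorm_ge0 (xi - s). lra.
Qed.

(** A bounded strong limit is a weak* limit: the pairing with (xi, eta) is an
    inner product of amplified operators, and amp_conv0 applies to T - S n. *)
Lemma wstar_closure_limit H K (X : set (bop H K)) (T : bop H K)
    (S : nat -> bop H K) (C : R) : 0 <= C -> (forall n, X (S n)) ->
  (forall n x, hnorm ((T - S n) x) <= C * hnorm x) ->
  (forall x, conv (fun n => (T - S n) x) 0) -> wstar_closure X T.
Proof.
move=> C0 XS hC cT s e e0.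
have one (xi : l2 H) (eta : l2 K) : exists N, forall n, (N <= n)%N ->
    normc (wstar_pairing xi eta (T - S n)) < e.
  have e1 : 0 < hnorm eta + 1 by rewrite ltr_wpDl ?hnorm_ge0.
  have [N hN] := (convP _ _).1 (amp_conv0 C0 hC cT xi) _ (divr_gt0 e0 e1).
  exists N => n Nn; rewrite wstar_pairingE; apply: le_lt_trans (inner_CS _ _) _.
  have := hN n Nn; rewrite subr0 ltr_pdivlMr// => h; apply: le_lt_trans h.
  by rewrite ler_wpM2l ?hnorm_ge0// lerDl.
have [N hN] : exists N, forall n, (N <= n)%N -> forall p, p \in s ->
    normc (wstar_pairing p.1 p.2 (T - S n)) < e.
  elim: s => [|p s [N hN]]; first by exists 0%N.
  have [N' hN'] := one p.1 p.2; exists (maxn N N') => n Nn q.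
  rewrite inE => /predU1P[->|qs]; first by apply: hN'; rewrite (leq_trans (leq_maxr N N')).
  by apply: hN => //; rewrite (leq_trans (leq_maxl N N')).
by exists (S N) => //; exact: hN.
Qed.

Lemma wstar_closure_inner H K (X : set (bop H K)) x y :
  (forall S, X S -> inner (S x) y = 0) ->
  forall T, wstar_closure X T -> inner (T x) y = 0.
Proof.
move=> Xxy T cT; apply/eq0_normc/eqP; rewrite eq_le normc_ge0 andbT.
apply/ler_addgt0Pl => e e0; rewrite addr0.
have [S XS h] := cT [:: (l2inj H 0 x, l2inj K 0 y)] e e0.
have {h} : normc (wstar_pairing (l2inj H 0 x) (l2inj K 0 y) (T - S)) < e.
  exact: (h (_, _) (mem_head _ _)).
by rewrite wstar_pairing_inj bopBE linearBl /= (Xxy S XS) subr0 => /ltW.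
Qed.

End WeakStar.

(** * Reflexive algebras of isomorphic lattices *)

Section AlgSpan.
Context (R : realType).
Implicit Types H K : hilbertType R.

Lemma AlgP H (L : set (bop H H)) A :
  Alg L A <-> forall P, L P -> forall x, P (A (P x)) = A (P x).
Proof.
split=> [h P LP x|h P LP].
  have := congr1 (fun T : bop H H => T x) (h P LP).
  by rewrite !bcompE bopBE bidE => /eqP; rewrite subr_eq0 => /eqP.
by apply: bop_ext => x; rewrite !bcompE bopBE bidE h// subrr.
Qed.

Lemma projection_selfadj H (P : bop H H) : projection P -> selfadj P.
Proof. by move=> [_ /selfadjP]. Qed.

Lemma projection_idem H (P : bop H H) x : projection P -> P (P x) = P x.
Proof. by move=> [PP _]; rewrite -bcompE PP. Qed.

Definition lattice_graph K1 K2 (G : set (bop K1 K1 * bop K2 K2))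
    (L1 : set (bop K1 K1)) (L2 : set (bop K2 K2)) :=
  [/\ forall P, L1 P -> projection P, forall Q, L2 Q -> projection Q,
      forall P, L1 P -> exists2 Q, L2 Q & G (P, Q) &
      forall Q, L2 Q -> exists2 P, L1 P & G (P, Q)].

Lemma lattice_graph_swap K1 K2 (G : set (bop K1 K1 * bop K2 K2)) L1 L2 :
  lattice_graph G L1 L2 -> lattice_graph (swap_pairs G) L2 L1.
Proof. by case. Qed.

Lemma Alg_subspace H (L : set (bop H H)) : subspace (Alg L).
Proof.
split=> [|c S T /AlgP hS /AlgP hT]; apply/AlgP => P LP x.
  by rewrite !bop0E bop_zero.
by rewrite !bopDE !bopZE bop_add bop_scale hS// hT.
Qed.

(** Let Q in L2 have partner P in L1. Then A maps the range of P into itself,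
    S maps it into the range of Q, and adj T maps the range of Q into that of P. *)
Lemma Alg_itw K1 K2 (G : set (bop K1 K1 * bop K2 K2)) L1 L2 A S T :
  lattice_graph G L1 L2 -> itw G S -> itw G T ->
  Alg L1 A -> Alg L2 (S \ob A \ob adj T).
Proof.
move=> [pL1 pL2 _ L21] iS iT /AlgP hA; apply/AlgP => Q LQ x.
have [P LP GPQ] := L21 Q LQ.
have TQ y : adj T (Q y) = P (adj T y).
  apply: rin_ext => z; rewrite rin_adjl (projection_selfadj (pL2 _ LQ)) -(iT _ _ GPQ).
  by rewrite -rin_adjl (projection_selfadj (pL1 _ LP)).
by rewrite !bcompE TQ -(iS _ _ GPQ) hA.
Qed.

Lemma subspace_sum H K (X : set (bop H K)) n (F : nat -> bop H K) : subspace X ->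
  (forall k, X (F k)) -> X (\sum_(0 <= k < n) F k).
Proof.
move=> [X0 XL] XF; elim: n => [|n IH]; first by rewrite big_geq.
by have := XL 1 _ _ IH (XF n); rewrite scale1r big_nat_recr.
Qed.

Lemma bcomp_sum H K L L' n (F : nat -> bop K L) (F' : nat -> bop L' H) (A : bop H K) :
  (\sum_(0 <= k < n) F k) \ob A \ob (\sum_(0 <= k < n) F' k) =
  \sum_(0 <= k < n) \sum_(0 <= l < n) F k \ob A \ob F' l.
Proof.
have sumE (H1 H2 : hilbertType R) m (U : nat -> bop H1 H2) x :
    (\sum_(0 <= k < m) U k) x = \sum_(0 <= k < m) U k x.
  elim: m => [|m IH]; first by rewrite !big_geq.
  by rewrite !big_nat_recr// bopDE IH.
apply: bop_ext => x; rewrite !bcompE !sumE; apply: eq_bigr => k _.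
rewrite sumE; elim: n => [|m IH]; first by rewrite !big_geq// !bop_zero.
by rewrite !big_nat_recr// !bop_add IH.
Qed.

(** With 1 = sum of the adj (W k) W k, an operator A in Alg L1 is the limit of
    the finite sums of adj (W k) (W k A adj (W l)) W l, whose middle factors are in
    Alg L2. *)
Lemma Alg_wstar_span K1 K2 (G : set (bop K1 K1 * bop K2 K2)) L1 L2 :
  vn_iso G -> separable_space K1 -> lattice_graph G L1 L2 ->
  Alg L1 = wstar_span (comp_set (comp_set (adjoint_set (itw G)) (Alg L2)) (itw G)).
Proof.
move=> vG sep lG; have GA : forall a b, G (a, b) -> G (adj a, adj b) by exact: (graph_adj vG).
have lG' := lattice_graph_swap lG; have [pL1 _ _ _] := lG.
apply/seteqP; split=> [A hA|A].
  have [x tx] := separable_total sep.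
  have [|W [Q [MW pQ Q1 [Q0 QS] cQ]]] := greedy_resolution (itw_tro GA) tx.
    by move=> y; exact: (vn_iso_itw_null vG sep).
  pose S n := (bid - Q n) \ob A \ob (bid - Q n).
  have QW n : bid - Q n = \sum_(0 <= k < n) adj (W k) \ob W k.
    elim: n => [|n IH]; first by rewrite big_geq// Q0 subrr.
    by rewrite big_nat_recr// -IH QS opprB addrCA addrC.
  have [M M0 hM] := bop_bound A.
  have SE n y : (A - S n) y = Q n (A y) + A (Q n y) - Q n (A (Q n y)).
    rewrite bopBE !bcompE !bopBE !bidE !bop_sub.
    by rewrite !opprB addrC -addrA subrK addrAC.
  apply: (@wstar_closure_limit _ _ _ _ _ S (3 * M)).
  - by rewrite mulr_ge0// ltW.
  - move=> n; rewrite /S QW bcomp_sum => X [sX gX].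
    apply: subspace_sum => // k; apply: subspace_sum => // l; apply: gX.
    exists (adj (W k) \ob (W k \ob A \ob adj (W l))); last first.
      by exists (W l) => //; exact: bop_ext.
    exists (adj (W k)); first by exists (W k) => //; exact: adjP.
    by exists (W k \ob A \ob adj (W l)) => //; exact: Alg_itw lG _ _ hA.
  - move=> n y; rewrite SE.
    have h1 := Q1 n (A y); have h2 := hM y; have h3 := hM (Q n y).
    have h4 := ler_wpM2l (ltW M0) (Q1 n y); have h5 := Q1 n (A (Q n y)).
    have h6 := ler_hnormB (Q n (A y) + A (Q n y)) (Q n (A (Q n y))).
    have h7 := ler_hnormD (Q n (A y)) (A (Q n y)); lra.
  - move=> y.
    have hQA : conv (fun n => Q n (A (Q n y))) 0.
      have := conv_bop A (cQ y); rewrite bop_zero => h.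
      by apply: (conv_squeeze _ h) => n; rewrite !subr0.
    have h := convB (convD (cQ (A y)) (conv_bop A (cQ y))) hQA.
    by rewrite bop_zero addr0 subr0 in h; apply: (conv_eq _ h) => n; exact: SE.
move=> hA; apply/AlgP => P LP x; apply/esym/rin_ext => z.
have pP := pL1 _ LP.
have -> : rin (P (A (P x))) z = rin (A (P x)) (P z).
  exact: projection_selfadj.
apply/eqP; rewrite -subr_eq0 -rinBr /rin (wstar_closure_inner _ hA)// => S hS.
have {hS} /AlgP hS : Alg L1 S.
  move: S hS; apply: smallest_sub; first exact: Alg_subspace.
  move=> _ [_ [_ [T iT /adj_uniq ->] [B hB <-]] [U iU <-]].
  by have := Alg_itw lG' (itw_adj GA iT) (itw_adj GA iU) hB; rewrite adjK.
by rewrite -hS// pP.2 bop_sub projection_idem// subrr linear0r.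
Qed.

End AlgSpan.

(** * Finitely supported vectors of l2 H *)

Section L2Sums.
Context (R : realType) (H : hilbertType R).

Lemma sum_l2inj_seqE (I : seq nat) (x : nat -> H) m : uniq I ->
  (\sum_(i <- I) l2inj H i (x i)) m = if m \in I then x m else 0.
Proof.
elim: I => [|i I IH] /=; first by rewrite big_nil.
move=> /andP[iI uI]; rewrite big_cons l2DE IH// l2injE inE.
by case: eqP => [->|_]; rewrite /= ?(negbTE iI) ?addr0 ?add0r.
Qed.

Lemma rin_sum_l2inj (I : seq nat) (x : nat -> H) (y : l2 H) :
  rin (\sum_(i <- I) l2inj H i (x i)) y = \sum_(i <- I) rin (x i) (y i).
Proof.
elim: I => [|i I IH]; first by rewrite !big_nil rin0l.
by rewrite !big_cons rinDl IH rin_l2inj.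
Qed.

Lemma hnorm_sum_l2inj (I : seq nat) (x : nat -> H) : uniq I ->
  hnorm (\sum_(i <- I) l2inj H i (x i)) ^+ 2 = \sum_(i <- I) hnorm (x i) ^+ 2.
Proof.
move=> uI; rewrite -rinxx rin_sum_l2inj; apply: eq_big_seq => i iI.
by rewrite sum_l2inj_seqE// iI rinxx.
Qed.

Lemma l2_bessel (I : seq nat) (y : l2 H) : uniq I ->
  \sum_(i <- I) hnorm (y i) ^+ 2 <= hnorm y ^+ 2.
Proof.
move=> uI; have := sqr_ge0 (hnorm (y - \sum_(i <- I) l2inj H i (y i))).
rewrite hnormB_sqr rinC rin_sum_l2inj hnorm_sum_l2inj//.
have -> : \sum_(i <- I) rin (y i) (y i) = \sum_(i <- I) hnorm (y i) ^+ 2.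
  by apply: eq_bigr => i _; rewrite rinxx.
lra.
Qed.

End L2Sums.

(** * Operators on l2 H with entries in Alg L *)

Section MinftyAlg.
Context (R : realType) (H : hilbertType R).

(** Every bounded operator on the infinite direct sum is given by its matrix,
    so membership in Minfty only concerns the entries. *)
Lemma matrix_operator_entries K (T : bop (l2 H) (l2 K)) :
  bounded_submatrices (fun i j => l2coord K i \ob T \ob l2inj H j) /\
  matrix_operator (fun i j => l2coord K i \ob T \ob l2inj H j) T.
Proof.
split=> [|x i].
  have [C C0 hC] := bop_bound T; exists C => I J x.
  pose z := \sum_(j <- J) l2inj H j (x j).
  apply: (@le_trans _ _ (hnorm (T z) ^+ 2)); last first.
    rewrite -hnorm_sum_l2inj ?fset_uniq// -exprMn.
    by rewrite ler_sqr ?nnegrE ?mulr_ge0 ?hnorm_ge0 ?(ltW C0).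
  apply: (le_trans _ (l2_bessel (T z) (fset_uniq I))).
  apply: ler_sum => i _; rewrite le_eqVlt; apply/orP; left; apply/eqP.
  congr (hnorm _ ^+ 2); rewrite -[RHS]l2coordE /z -[RHS]bcompE.
  elim: (J : seq nat) => [|j s IH]; first by rewrite !big_nil bop_zero.
  by rewrite !big_cons bop_add IH.
apply/convE; have := conv_coord i (conv_bop T (l2_conv_inj x)); apply: conv_eq => n.
rewrite /series [LHS]/= -[RHS]l2coordE -[RHS]bcompE.
elim: n => [|n IH]; first by rewrite !big_geq// bop_zero.
by rewrite !big_nat_recr// bop_add -IH.
Qed.

(** Minfty (Alg L) is the algebra of the lattice of the P tensor 1; in this form
    it is transported by operators intertwining these projections. *)
Lemma Minfty_AlgP (L : set (bop H H)) (T : bop (l2 H) (l2 H)) :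
  (forall P, L P -> projection P) ->
  Minfty (Alg L) T <->
  forall P, L P -> forall x, amp P x = x -> amp P (T x) = T x.
Proof.
move=> pL; split=> [[a [La _ aT]] P LP x Px|hT].
  apply: l2_ext => i; rewrite ampE; have /convE h := aT x i.
  apply: conv_unique (conv_bop P h) _; apply: conv_eq h => n.
  rewrite /series /=; elim: n => [|n IH]; first by rewrite !big_geq// bop_zero.
  rewrite !big_nat_recr//= bop_add IH; congr (_ + _).
  have -> : x n = P (x n) by rewrite -{1}Px ampE.
  exact: (AlgP _ _).1 (La i n) _ LP _.
have [bT mT] := matrix_operator_entries T.
exists (fun i j => l2coord H i \ob T \ob l2inj H j); split=> // i j.
apply/AlgP => P LP x; rewrite !bcompE !l2coordE.
rewrite -{2}(hT P LP (l2inj H j (P x))) ?ampE//.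
by rewrite amp_inj projection_idem//; exact: pL.
Qed.

End MinftyAlg.

(** * Hyperreflexivity constants and compressions *)

Section Constants.
Context (R : realType).
Implicit Types H K : hilbertType R.

Lemma opnorm_ub H K (T : bop H K) x : hnorm x <= 1 -> hnorm (T x) <= opnorm T.
Proof.
move=> x1; have [M M0 hM] := bop_bound T; apply: ub_le_sup; last by exists x.
exists M => _ [y /= y1 <-]; rewrite (le_trans (hM y))//.
by rewrite ler_piMr// ltW.
Qed.

Lemma opnorm_le H K (T : bop H K) (c : R) :
  (forall x, hnorm x <= 1 -> hnorm (T x) <= c) -> opnorm T <= c.
Proof.
move=> h; apply: ge_sup; first by exists (hnorm (T 0)), 0; rewrite //= hnorm0.
by move=> _ [x /= x1 <-]; exact: h.
Qed.

Lemma opnorm_ge0 H K (T : bop H K) : 0 <= opnorm T.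
Proof. by apply: le_trans (hnorm_ge0 (T 0)) (opnorm_ub T _); rewrite hnorm0. Qed.

Lemma dist_op_le H K (T S : bop H K) X : X S -> dist_op T X <= opnorm (T - S).
Proof.
move=> XS; apply: ge_inf; last by exists S.
by exists 0 => _ [U _ <-]; exact: opnorm_ge0.
Qed.

Lemma le_dist_op H K (T : bop H K) X c : X 0 ->
  (forall S, X S -> c <= opnorm (T - S)) -> c <= dist_op T X.
Proof.
move=> X0 h; apply: lb_le_inf; first by exists (opnorm (T - 0)), 0.
by move=> _ [S XS <-]; exact: h.
Qed.

Lemma dist_op_ge0 H K (T : bop H K) X : X 0 -> 0 <= dist_op T X.
Proof. by move=> X0; apply: le_dist_op => // S _; exact: opnorm_ge0. Qed.

Lemma refl_seminorm_ub H K (X : set (bop H K)) (T : bop H K) x y : hnorm x = 1 -> hnorm y = 1 ->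
  (forall S, X S -> inner (S x) y = 0) ->
  normc (inner (T x) y) <= refl_seminorm X T.
Proof.
move=> x1 y1 hX; apply: ub_le_sup; last by exists x, y; split.
have [M M0 hM] := bop_bound T; exists M => _ [u [v [u1 v1 _ ->]]].
by rewrite (le_trans (inner_CS _ _))// v1 mulr1 (le_trans (hM _))// u1 mulr1.
Qed.

Lemma refl_seminorm_le H K (X : set (bop H K)) (T : bop H K) (c : R) : 0 <= c ->
  (forall x y, hnorm x = 1 -> hnorm y = 1 ->
    (forall S, X S -> inner (S x) y = 0) -> normc (inner (T x) y) <= c) ->
  refl_seminorm X T <= c.
Proof.
move=> c0 h; rewrite /refl_seminorm; set E := [set r | _].
have [->|/set0P E0] := eqVneq E set0; first by rewrite sup0.
by apply: ge_sup => // _ [x [y [x1 y1 hX ->]]]; exact: h.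
Qed.

Lemma refl_seminorm_ge0 H K (X : set (bop H K)) (T : bop H K) : 0 <= refl_seminorm X T.
Proof.
rewrite {1}/refl_seminorm; set E := [set r | _].
have [->|/set0P[_ [x [y [x1 y1 hX _]]]]] := eqVneq E set0; first by rewrite sup0.
exact: le_trans (normc_ge0 _) (refl_seminorm_ub T x1 y1 hX).
Qed.

Lemma refl_seminorm_ub1 H K (X : set (bop H K)) (T : bop H K) x y :
  hnorm x <= 1 -> hnorm y <= 1 -> (forall S, X S -> inner (S x) y = 0) ->
  normc (inner (T x) y) <= refl_seminorm X T.
Proof.
move=> x1 y1 hX; have r0 := refl_seminorm_ge0 X T.
have [x0|x0] := eqVneq (hnorm x) 0.
  by rewrite (hnorm_eq0 x0) bop_zero linear0l normc0.
have [y0|y0] := eqVneq (hnorm y) 0.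
  by rewrite (hnorm_eq0 y0) linear0r normc0.
have scale (U : bop H K) : inner (U ((hnorm x)^-1%:C *: x)) ((hnorm y)^-1%:C *: y) =
    ((hnorm x)^-1 * (hnorm y)^-1)%:C * inner (U x) y.
  rewrite !inner_rin bop_scale !rinZl scalerA (mulrC 'i) -scalerA !rinZr.
  apply/eqP; rewrite eq_complex /= !mul0r subr0 addr0.
  by apply/andP; split; apply/eqP; ring.
have normal (L : hilbertType R) (z : L) : hnorm z != 0 -> hnorm ((hnorm z)^-1%:C *: z) = 1.
  by move=> z1; rewrite hnormZr ger0_norm ?invr_ge0 ?hnorm_ge0// mulVf.
have := refl_seminorm_ub (X := X) T (normal _ _ x0) (normal _ _ y0).
rewrite scale normcM /= => /(_ _)/wrap[|h].
  by move=> S XS; rewrite scale hX// mulr0.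
have xp : 0 < hnorm x by rewrite lt_neqAle eq_sym x0 hnorm_ge0.
have yp : 0 < hnorm y by rewrite lt_neqAle eq_sym y0 hnorm_ge0.
move: h; rewrite expr0n addr0 sqrtr_sqr ger0_norm ?mulr_ge0 ?invr_ge0 ?hnorm_ge0//.
rewrite -invfM mulrC ler_pdivrMr ?mulr_gt0// => h; apply: le_trans h _.
by rewrite ler_piMr// mulr_ile1 ?hnorm_ge0.
Qed.

Section Compression.
Context K1 K2 (X1 : set (bop K1 K1)) (X2 : set (bop K2 K2)) (V : bop K1 K2).
Hypotheses (X10 : X1 0) (X20 : X2 0) (isoV : forall x, hnorm (V x) = hnorm x).
Hypotheses (X21 : forall T, X2 T -> X1 (adj V \ob T \ob V))
  (X12 : forall T, X1 T -> X2 (V \ob T \ob adj V)).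

Lemma adj_isometry x : adj V (V x) = x.
Proof.
apply: rin_ext => y; rewrite rin_adjl.
have h : forall z, rin (V z) (V z) = rin z z by move=> z; rewrite !rinxx isoV.
have := h (x + y); rewrite bop_add !rinDl !rinDr !h (rinC (V y)) (rinC y); lra.
Qed.

Lemma adj_isometry_le y : hnorm (adj V y) <= hnorm y.
Proof.
rewrite -[leRHS]mul1r; apply: hnorm_adj_le => // x.
by rewrite isoV mul1r.
Qed.

Lemma compress_expand T : adj V \ob (V \ob T \ob adj V) \ob V = T.
Proof. by apply: bop_ext => x; rewrite !bcompE !adj_isometry. Qed.

Lemma dist_op_expand T : dist_op T X1 <= dist_op (V \ob T \ob adj V) X2.
Proof.
apply: le_dist_op => // S XS; apply: le_trans (dist_op_le T (X21 XS)) _.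
apply: opnorm_le => x x1.
have -> : (T - adj V \ob S \ob V) x = adj V ((V \ob T \ob adj V - S) (V x)).
  by rewrite !bopBE !bcompE bop_sub !adj_isometry.
by rewrite (le_trans (adj_isometry_le _))// opnorm_ub// isoV.
Qed.

Lemma refl_seminorm_expand T : refl_seminorm X2 (V \ob T \ob adj V) <= refl_seminorm X1 T.
Proof.
apply: refl_seminorm_le => [|x y x1 y1 hX]; first exact: refl_seminorm_ge0.
have e (S : bop K1 K1) : inner ((V \ob S \ob adj V) x) y = inner (S (adj V x)) (adj V y).
  by rewrite !bcompE (adjP V).
rewrite e; apply: refl_seminorm_ub1.
- by rewrite -x1 adj_isometry_le.
- by rewrite -y1 adj_isometry_le.
by move=> S XS; rewrite -e; apply: hX; exact: X12.
Qed.

Lemma compress_setT : X2 = setT -> X1 = setT.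
Proof.
move=> X2T; apply/seteqP; split=> // T _; rewrite -(compress_expand T).
by apply: X21; rewrite X2T.
Qed.

(** Passing from T to V T (adj V) does not decrease the distance, since
    compression by the isometry V maps X2 into X1, and does not increase the
    seminorm, since a pair of vectors annihilated by X2 is mapped by adj V to a pair
    annihilated by X1. So every quotient for X1 is at most a quotient for X2. *)
Lemma hyperreflexivity_constant_compress : (X1 = setT -> X2 = setT) ->
  (hyperreflexivity_constant X1 <= hyperreflexivity_constant X2)%E.
Proof.
move=> X1T; rewrite /hyperreflexivity_constant.
case: ifPn => [/asboolP/X1T ->|/asboolPn n1]; first by rewrite asboolT.
have -> : `[< X2 = setT >] = false.
  by apply/asboolPn => e; exact: n1 (compress_setT e).
case: (asboolP (hyperreflexive X2)) => [[k k0 hk]|_]; last by rewrite leey.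
rewrite asboolT; last first.
  exists k => // T; apply: le_trans (dist_op_expand T) _.
  apply: le_trans (hk _) _; rewrite ler_pM2l//; exact: refl_seminorm_expand.
apply: ge_ereal_sup => _ [T nT <-]; apply: le_ereal_sup_tmp.
eexists; first by exists (V \ob T \ob adj V) => // h; apply: nT; rewrite -(compress_expand T); exact: X21.
rewrite lee_fin.
have h1 := dist_op_expand T; have h2 := refl_seminorm_expand T.
have d0 := dist_op_ge0 T X10; have h3 := hk (V \ob T \ob adj V).
have r0 := refl_seminorm_ge0 X2 (V \ob T \ob adj V).
(* When the seminorm vanishes, hyperreflexivity makes the distances vanish. *)
have [r2|r2] := eqVneq (refl_seminorm X2 (V \ob T \ob adj V)) 0.
  rewrite r2 mulr0 in h3; rewrite r2 invr0 mulr0.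
  have -> : dist_op T X1 = 0 by apply/eqP; rewrite eq_le d0 andbT (le_trans h1).
  by rewrite mul0r.
have rp : 0 < refl_seminorm X2 (V \ob T \ob adj V) by rewrite lt_neqAle eq_sym r2.
apply: ler_pM => //; first by rewrite invr_ge0 refl_seminorm_ge0.
by rewrite lef_pV2 ?posrE// (lt_le_trans rp).
Qed.

End Compression.

End Constants.

(** * Commutants *)

Section Commutants.
Context (R : realType) (H : hilbertType R).
Implicit Types X Y : set (bop H H).

Lemma commutant_anti X Y : X `<=` Y -> commutant Y `<=` commutant X.
Proof. by move=> XY T hT S /XY; exact: hT. Qed.

Lemma sub_bicommutant X : X `<=` commutant (commutant X).
Proof. by move=> T XT S hS; rewrite hS. Qed.

Lemma commutant_id X : commutant X bid.
Proof. by move=> S _; exact: bop_ext. Qed.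

Lemma commutant_lin X (c : R[i]) S T : commutant X S -> commutant X T ->
  commutant X (c *: S + T).
Proof.
move=> hS hT U XU; apply: bop_ext => x.
have app (T1 T2 : bop H H) : T1 = T2 -> T1 x = T2 x by move->.
have := app _ _ (hS U XU); have := app _ _ (hT U XU); rewrite !bcompE => eT eS.
by rewrite !bopDE !bopZE eS eT bop_add bop_scale.
Qed.

Lemma commutant_comp X S T : commutant X S -> commutant X T -> commutant X (S \ob T).
Proof. by move=> hS hT U XU; rewrite -bcompA hT// bcompA hS// -bcompA. Qed.

Lemma commutant_adj X : (forall S, X S -> X (adj S)) ->
  forall T, commutant X T -> commutant X (adj T).
Proof.
move=> hX T hT S XS; rewrite -[S]adjK -!adj_comp.
by rewrite hT//; exact: hX.
Qed.

End Commutants.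

(** * Isomorphic lattices *)

Section Main.
Context (R : realType).
Implicit Types H : hilbertType R.

Lemma star_isomorphism_graph H1 H2 (L1 : set (bop H1 H1)) (L2 : set (bop H2 H2)) theta :
  (forall P, L1 P -> projection P) ->
  star_isomorphism (commutant (commutant L1)) (commutant (commutant L2)) theta ->
  vn_iso [set p | commutant (commutant L1) p.1 /\ p.2 = theta p.1].
Proof.
move=> pL1 [[fA injA surA] thL thM thA].
set A1 := commutant (commutant L1) in fA injA surA thL thM thA *.
set A2 := commutant (commutant L2) in fA injA surA thL thM thA *.
have adjA1 T : A1 T -> A1 (adj T).
  apply: commutant_adj; apply: commutant_adj => P LP.
  by rewrite (selfadj_adj (projection_selfadj (pL1 _ LP))).
have A11 : A1 bid by exact: commutant_id.
have A1L c S T : A1 S -> A1 T -> A1 (c *: S + T) by exact: commutant_lin.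
have A10 : A1 0 by have := A1L (-1) _ _ A11 A11; rewrite scaleN1r addNr.
have th1 : theta bid = bid.
  have [U AU thU] := surA bid (commutant_id (X := commutant L2)).
  have := thM _ _ A11 AU; rewrite thU.
  rewrite (_ : bid \ob U = U); last exact: bop_ext.
  by rewrite thU => e; rewrite [RHS]e; exact: bop_ext.
have th0 : theta 0 = 0.
  have := thL (-1) _ _ A11 A11.
  by rewrite !scaleN1r !addNr.
have star : star_subalgebra [set p | A1 p.1 /\ p.2 = theta p.1].
  split=> /=.
  - by [].
  - by move=> c p q [Ap ->] [Aq ->]; split; [exact: A1L|rewrite thL].
  - by move=> p q [Ap ->] [Aq ->]; split; [exact: commutant_comp|rewrite thM].
  - move=> p [Ap ->]; split; first exact: adjA1.
    by apply/esym/adj_uniq/thA => //; [exact: adjA1|exact: adjP].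
have bic H (L : set (bop H H)) :
    commutant (commutant (commutant (commutant L))) `<=` commutant (commutant L).
  by apply: commutant_anti; exact: sub_bicommutant.
split; split=> //.
- by move=> b [/= _ ->].
- have -> : left_ops [set p | A1 p.1 /\ p.2 = theta p.1] = A1.
    by apply/seteqP; split=> [a [b []]//|a Aa]; exists (theta a).
  exact: bic.
- case: star => s1 sL sM sA; split=> //.
  + by move=> c p q Gp Gq; exact: (sL c (p.2, p.1) (q.2, q.1)).
  + by move=> p q Gp Gq; exact: (sM (p.2, p.1) (q.2, q.1)).
  + by move=> p Gp; exact: (sA (p.2, p.1)).
- move=> a [/= Aa tha]; apply: injA; rewrite ?inE//.
  by rewrite -tha th0.
- have -> : left_ops (swap_pairs [set p | A1 p.1 /\ p.2 = theta p.1]) = A2.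
    apply/seteqP; split=> [b [a [/= Aa ->]]|b /surA[a Aa <-]].
      exact: fA.
    by exists a.
  exact: bic.
Qed.

(** Greedy resolution for the intertwiners between the representations a
    tensor 1 on l2 H1 and b on H2: an intertwiner of G can be composed with the
    coordinates, so there is no common kernel. *)
Lemma amplified_isometry H1 H2 (G : set (bop H1 H1 * bop H2 H2)) :
  vn_iso G -> separable_space H1 -> exists V : bop (l2 H1) (l2 H2),
    (forall x, hnorm (V x) = hnorm x) /\
    forall a b, G (a, b) -> forall x, V (amp a x) = amp b (V x).
Proof.
move=> vG sep; pose G' := [set (amp p.1, p.2) | p in G].
have GA' a b : G' (a, b) -> G' (adj a, adj b).
  move=> [[a' b'] /= Gab [<- <-]]; exists (adj a', adj b').
    exact: (graph_adj vG).
  by rewrite /= amp_adj.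
have [x tx] := separable_total_l2 sep.
have [|V [isoV MV]] := greedy_isometry (itw_tro GA') tx.
  move=> y ny; apply: l2_ext => n; rewrite l20E.
  apply: (vn_iso_itw_null vG sep) => T iT.
  rewrite -l2coordE -bcompE; apply: ny => _ _ [[a b] Gab [<- <-]] z.
  by rewrite !bcompE !l2coordE ampE; exact: iT.
exists V; split=> // a b Gab y; apply: l2_ext => n.
have G'ab : G' (amp a, b) by exists (a, b).
by have := MV n _ _ G'ab y; rewrite !bcompE !l2coordE ampE.
Qed.

Lemma Minfty_Alg_transport (K1 K2 : hilbertType R) (G' : set (bop K1 K1 * bop K2 K2)) L1' L2'
    (V : bop (l2 K1) (l2 K2)) : lattice_graph G' L1' L2' ->
    (forall a b, G' (a, b) -> forall x, V (amp a x) = amp b (V x)) ->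
    (forall T, Minfty (Alg L2') T -> Minfty (Alg L1') (adj V \ob T \ob V)) /\
    (forall T, Minfty (Alg L1') T -> Minfty (Alg L2') (V \ob T \ob adj V)).
Proof.
move=> [pL1 pL2 L12 L21] iV.
have iV' P Q : L1' P -> L2' Q -> G' (P, Q) -> forall y,
    amp P (adj V y) = adj V (amp Q y).
  move=> LP LQ GPQ y; apply: rin_ext => x; rewrite rin_adjl.
  rewrite -[amp P]adjK rin_adjl rin_adjl amp_adj.
  rewrite (selfadj_adj (projection_selfadj (pL1 _ LP))) (iV _ _ GPQ).
  by rewrite rin_adjr amp_adj (selfadj_adj (projection_selfadj (pL2 _ LQ))).
split=> T.
  move=> /(Minfty_AlgP _ pL2) hT; apply/(Minfty_AlgP _ pL1) => P LP x Px.
  have [Q LQ GPQ] := L12 P LP.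
  by rewrite !bcompE (iV' P Q)// hT// -(iV _ _ GPQ) Px.
move=> /(Minfty_AlgP _ pL1) hT; apply/(Minfty_AlgP _ pL2) => Q LQ x Qx.
have [P LP GPQ] := L21 Q LQ.
by rewrite !bcompE -(iV _ _ GPQ) hT// (iV' P Q)// Qx.
Qed.

Lemma complete_constant_le H1 H2 (G : set (bop H1 H1 * bop H2 H2)) L1 L2 :
  vn_iso G -> separable_space H1 -> separable_space H2 -> lattice_graph G L1 L2 ->
  (complete_hyperreflexivity_constant (Alg L1) <=
   complete_hyperreflexivity_constant (Alg L2))%E.
Proof.
move=> vG sep1 sep2 lG.
have [V [isoV iV]] := amplified_isometry vG sep1.
have [W [isoW iW]] := amplified_isometry (vn_iso_swap vG) sep2.
have [V21 V12] := Minfty_Alg_transport lG iV.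
have [W21 W12] := Minfty_Alg_transport (lattice_graph_swap lG) iW.
have M0 H (L : set (bop H H)) : (forall P, L P -> projection P) -> Minfty (Alg L) 0.
  by move=> pL; apply/(Minfty_AlgP _ pL) => P LP x _; rewrite bop0E bop_zero.
have [pL1 pL2 _ _] := lG.
apply: hyperreflexivity_constant_compress isoV V21 V12 _; try exact: M0.
exact: compress_setT isoW W21.
Qed.

End Main.

Theorem theorem4p4 (R : realType) (H1 H2 : hilbertType R)
    (L1 : set (bop H1 H1)) (L2 : set (bop H2 H2)) :
  separable_space H1 -> separable_space H2 ->
  reflexive_lattice L1 -> reflexive_lattice L2 ->
  (exists theta : bop H1 H1 -> bop H2 H2,
    star_isomorphism (commutant (commutant L1)) (commutant (commutant L2))
      theta /\
    theta @` L1 = L2) ->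
  weak_tro_equivalent (Alg L1) (Alg L2) /\
  complete_hyperreflexivity_constant (Alg L1) =
    complete_hyperreflexivity_constant (Alg L2).
Proof.
move=> sep1 sep2 [[pL1 _ _ _ _] _] [[pL2 _ _ _ _] _] [theta [iso L12]].
have vG := star_isomorphism_graph pL1 iso.
set G := [set p | _] in vG.
have lG : lattice_graph G L1 L2.
  split=> //.
  - move=> P LP; exists (theta P); first by rewrite -L12; exists P.
    by split=> //; exact: sub_bicommutant.
  - move=> Q; rewrite -L12 => -[P LP <-]; exists P => //.
    by split=> //; exact: sub_bicommutant.
have lG' := lattice_graph_swap lG; have vG' := vn_iso_swap vG.
have GA : forall a b, G (a, b) -> G (adj a, adj b) by exact: (graph_adj vG).
have GA' a b : swap_pairs G (a, b) -> swap_pairs G (adj a, adj b) by exact: GA.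
split; last by apply/eqP; rewrite eq_le !(complete_constant_le vG)// (complete_constant_le vG').
exists (itw (swap_pairs G)), (itw (swap_pairs G)); split.
- exact: itw_tro.
- exact: itw_tro.
- have := Alg_wstar_span vG sep1 lG; rewrite adjoint_set_itw// => {1}->.
  by rewrite adjoint_set_itw.
- by rewrite {1}(Alg_wstar_span vG' sep2 lG').
Qed.
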